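(* Consider weighted scale-free percolation $\mathrm{SFP}_{W,L}$ on $\mathbb{Z}^d$ with parameters $\lambda>0$, $\alpha>d$, vertex-weight distribution $W$ with $\mathbb{P}(W>t)=\ell(t)/t^{\tau-1}$ for some $\tau>1$ and $\ell$ slowly varying at infinity, $\gamma:=\alpha(\tau-1)/d\in(1,2)$, and edge-weight distribution $L$ with $\mathbf{I}(L)=\infty$. Fix an arbitrary unit vector $\underline e\in\mathbb{R}^d$. Then, as $m\to\infty$, $$\frac{\mathrm{d}_L(0,\lfloor m\underline e\rfloor)}{\sum_{k=1}^{\lfloor \log\log m/|\log(\gamma-1)|\rfloor}2F_L^{(-1)}\big(\exp\{-1/(\gamma-1)^k\}\big)}\to 1\qquad\text{in probability.}$$
   Context: Scale-free percolation model. Fix $d\ge1$, $\alpha>d$ and $\lambda>0$. Each $x\in\mathbb{Z}^d$ gets an i.i.d. vertex-weight $W_x$ distributed as $W$, where $\mathbb{P}(W\ge1)=1$ and $\mathbb{P}(W>t)=\ell(t)/t^{\tau-1}$, with $\tau>1$ and $\ell$ slowly varying at infinity. Conditionally on $(W_x)_{x\in\mathbb{Z}^d}$, edges are present independently: each pair $x,y$ with $\|x-y\|=1$ (Euclidean norm) is always connected by an edge, and each pair with $\|x-y\|>1$ is connected with probability $1-\exp\{-\lambda W_xW_y/\|x-y\|^\alpha\}$. Then every present edge $e$ is given an i.i.d. edge-weight $L_e\ge0$ distributed as $L$, independent of everything else; the resulting weighted graph is $\mathrm{SFP}_{W,L}$. Set $\gamma:=\alpha(\tau-1)/d$. $\mathrm{d}_L(x,y)$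 is the infimum over paths $\pi$ from $x$ to $y$ of $\sum_{e\in\pi}L_e$. $\lfloor m\underline e\rfloor\in\mathbb{Z}^d$ is the vertex obtained by taking coordinate-wise integer parts of $m\underline e$. $F_L(t)=\mathbb{P}(L\le t)$, $F_L^{(-1)}(y)=\inf\{t\in\mathbb{R}:F_L(t)\ge y\}$, and $\mathbf{I}(L):=\int_0^\infty F_L^{(-1)}(\exp\{-e^{y}\})\,dy$. *)

(* Defs.v *)
From mathcomp Require Import all_boot all_order all_algebra.
From mathcomp Require Import all_classical all_reals all_analysis.

Set Implicit Arguments.
Unset Strict Implicit.
Unset Printing Implicit Defensive.

Import Order.TTheory GRing.Theory Num.Theory.
Import numFieldNormedType.Exports.

Local Open Scope classical_set_scope.
Local Open Scope ring_scope.

(* The library norm `|v| on row vectors is the sup norm, hence this definition. *)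
Definition enorm (R : realType) (d : nat) (v : 'rV[R]_d) : R :=
  Num.sqrt (\sum_i v 0 i ^+ 2).

Definition edist (R : realType) (d : nat) (x y : 'rV[int]_d) : R :=
  enorm (map_mx intr (x - y)).

Definition floor_vec (R : realType) (d : nat) (v : 'rV[R]_d) : 'rV[int]_d :=
  map_mx Num.floor v.

Definition slowly_varying (R : realType) (ell : R -> R) : Prop :=
  [/\ measurable_fun [set t : R | 0 < t] ell,
      forall t, 0 < t -> 0 < ell t
    & forall c, 0 < c -> ell (c * t) / ell t @[t --> +oo] --> (1 : R)].

(* Only meaningful for 0 < y < 1: the real-valued inf is 0 on sets that are
   empty or unbounded below. *)
Definition quantile (dO : measure_display) (O : measurableType dO)
    (R : realType) (P : probability O R) (X : {RV P >-> R}) (y : R) : R :=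
  inf [set t | (y%:E <= cdf X t)%E].

Definition explosion_integral (dO : measure_display) (O : measurableType dO)
    (R : realType) (P : probability O R) (L : {RV P >-> R}) : \bar R :=
  (\int[lebesgue_measure]_(y in `[0%R, +oo[)
     (quantile L (expR (- expR y)))%:E)%E.

(* A list of ordered pairs that represents a list of pairwise distinct
   unordered pairs {x, y} with x != y. *)
Definition distinct_edges (V : eqType) (E : seq (V * V)) : bool :=
  all (fun e => e.1 != e.2) E &&
  pairwise (fun e f => (f != e) && (f != (e.2, e.1))) E.

Section WeightedScaleFreePercolation.
Context (dO : measure_display) (O : measurableType dO) (R : realType).
Context (P : probability O R) (d : nat).
Implicit Types (Wv : 'rV[int]_d -> {RV P >-> R}).
Implicit Types (adj : O -> rel 'rV[int]_d).
Implicit Types (Le : 'rV[int]_d -> 'rV[int]_d -> {RV P >-> R}).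

Definition conn_prob (alpha lambda : R) Wv (x y : 'rV[int]_d) (w : O) : R :=
  if edist R x y == 1 then 1
  else 1 - expR (- (lambda * Wv x w * Wv y w / edist R x y `^ alpha)).

Definition edge_event adj (x y : 'rV[int]_d) : set O := [set w | adj w x y].

Definition weight_events Wv : set (set O) :=
  \bigcup_x preimage_set_system setT (Wv x) measurable.

Definition edge_events adj : set (set O) :=
  [set A | exists x y, A = edge_event adj x y].

(* Wv x is the weight of the vertex x, adj w is the graph at the sample point w
   and Le x y is the weight of the edge {x, y}.  The variables Le x y exist for
   all pairs; those of the pairs that are not edges are never used.
   [sfp_edges] says that, conditionally on the sigma-algebra of the vertex
   weights, the edge events are independent and have probabilities conn_prob:
   this is the defining property of the conditional probability of a finite
   intersection of edge events.
   In [sfp_lengths], the case G = setT says that the edge weights are mutually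
   independent. *)
Record weighted_sfp (alpha lambda : R) (W L : {RV P >-> R}) Wv adj Le : Prop :=
  WeightedSFP {
    sfp_weight_law : forall x (B : set R), measurable B ->
      distribution P (Wv x) B = distribution P W B ;
    sfp_weights : forall (s : seq 'rV[int]_d) (B : 'rV[int]_d -> set R),
      uniq s -> (forall x, measurable (B x)) ->
      P (\bigcap_(x in [set` s]) (Wv x @^-1` B x)) =
        (\prod_(x <- s) P (Wv x @^-1` B x))%E ;
    sfp_adj_sym : forall w, symmetric (adj w) ;
    sfp_adj_measurable : forall x y, measurable (edge_event adj x y) ;
    sfp_edges : forall (E : seq ('rV[int]_d * 'rV[int]_d)) (G : set O),
      distinct_edges E -> <<s weight_events Wv >> G ->
      P (G `&` \bigcap_(e in [set` E]) edge_event adj e.1 e.2) =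
        (\int[P]_(w in G)
           (\prod_(e <- E) conn_prob alpha lambda Wv e.1 e.2 w)%R%:E)%E ;
    sfp_length_sym : forall x y, Le x y = Le y x ;
    sfp_length_law : forall x y (B : set R), x != y -> measurable B ->
      distribution P (Le x y) B = distribution P L B ;
    sfp_lengths : forall (E : seq ('rV[int]_d * 'rV[int]_d)) (G : set O)
        (B : 'rV[int]_d * 'rV[int]_d -> set R),
      distinct_edges E -> <<s weight_events Wv `|` edge_events adj >> G ->
      (forall e, measurable (B e)) ->
      P (G `&` \bigcap_(e in [set` E]) (Le e.1 e.2 @^-1` B e)) =
        (P G * \prod_(e <- E) P (Le e.1 e.2 @^-1` B e))%E }.

(* The path is x :: p. *)
Definition path_length Le (w : O) (x : 'rV[int]_d) (p : seq 'rV[int]_d) : R :=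
  \sum_(l <- pairmap (fun u v => Le u v w) x p) l.

Definition graph_dist adj Le (x y : 'rV[int]_d) (w : O) : \bar R :=
  ereal_inf [set (path_length Le w x p)%:E | p in
    [set p : seq 'rV[int]_d |
       [/\ path (adj w) x p, uniq (x :: p) & last x p = y]]].

Definition cvg_in_probability (X : R -> O -> \bar R) (c : R) : Prop :=
  forall eps : R, 0 < eps ->
    P [set w | (eps%:E < `|X m w - c%:E|)%E] @[m --> +oo] --> 0%E.

End WeightedScaleFreePercolation.

(* Num.truncn is the floor on nonnegative reals (and 0 on negative ones). *)
Definition norming (dO : measure_display) (O : measurableType dO)
    (R : realType) (P : probability O R) (L : {RV P >-> R})
    (gamma : R) (m : R) : R :=
  \sum_(1 <= k < (Num.truncn (ln (ln m) / `|ln (gamma - 1)|)).+1)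
    2 * quantile L (expR (- (1 / (gamma - 1) ^+ k))).

(* Main.v *)
(* With eta = |log (gamma - 1)|, both bounds compare the distance with twice the
   sum of F_L^(-1)(exp (- e^(k eta'))) over k eta' <= log log m, for eta' slightly
   larger (lower bound) or smaller (upper bound) than eta. As F_L^(-1) is monotone
   and I(L) = oo, such a sum is eta / eta' times the norming, up to an additive
   constant that is negligible because the norming diverges.

   Lower bound: a path from x is followed as long as its k-th vertex has weight at
   most exp (b th^k), where th = e^eta' > 1 / (gamma - 1). Bounding the connection
   probability by a power of the product of the weights makes the expected number
   of such paths grow at most like exp (rho b th^k / (th - 1)), whereas a (k+1)-st
   step that is too long, too cheap, or reaches too heavy a vertex costs a factor
   exp (- sigma b th^k) with sigma larger than rho / (th - 1). For b large there is
   no bad step with high probability, so that the first h steps from either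
   endpoint remain short and pay the quantiles; the two pieces are disjoint since
   they cannot cover the distance m.

   Upper bound: at scale l_k = l_0 th^k, with th < 1 / (gamma - 1), every heavy
   vertex (weight e^(nu l_k)) of the box of radius e^(l_k) is joined to a heavy
   vertex of the next box by an edge of cost at most F_L^(-1)(exp (- dl l_(k+1))).
   The failure probabilities are doubly exponentially small in l_k, hence summable
   over all heavy vertices. The chains from the two endpoints are joined by two
   edges of bounded cost once e^(l_k) reaches m, and start inside a box of bounded
   radius, which the nearest-neighbour edges cross at tight cost. *)
From mathcomp Require Import all_boot all_order all_algebra.
From mathcomp Require Import all_classical all_reals all_analysis.
From mathcomp Require Import measurable_realfun.
From mathcomp Require Import ring lra zify.
Require Import Defs.

Set Implicit Arguments.
Unset Strict Implicit.
Unset Printing Implicit Defensive.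

Import Order.TTheory GRing.Theory Num.Theory.
Import numFieldNormedType.Exports.

Local Open Scope classical_set_scope.
Local Open Scope ring_scope.

(** * Series of nonnegative terms *)

Section SumsLe.
Context {R : realType}.
Implicit Types (T U : eqType).

Definition sums_le T (b : T -> R) (S : R) : Prop :=
  forall s : seq T, uniq s -> \sum_(t <- s) b t <= S.

Lemma uniq_sum_le T (b : T -> R) s s' : (forall t, 0 <= b t) -> uniq s ->
  {subset s <= s'} -> \sum_(t <- s) b t <= \sum_(t <- s') b t.
Proof.
move=> b0; elim: s s' => [|x s IH] s' /= us ss'.
  by rewrite big_nil sumr_ge0.
move: us => /andP[xs us].
have xs' : x \in s' by apply: ss'; rewrite mem_head.
rewrite big_cons (big_rem x xs') /= lerD2l; apply: IH => // t ts.
have tx : t != x by apply: contraNneq xs => <-.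
have : t \in s' by apply: ss'; rewrite in_cons ts orbT.
by rewrite (perm_mem (perm_to_rem xs')) in_cons (negbTE tx).
Qed.

Lemma sums_le_ge0 T (b : T -> R) S : sums_le b S -> 0 <= S.
Proof. by move=> /(_ [::] isT); rewrite big_nil. Qed.

Lemma sums_leW T (b b' : T -> R) S S' : (forall t, b t <= b' t) -> S <= S' ->
  sums_le b' S -> sums_le b S'.
Proof.
move=> bb' SS' H s us; apply: le_trans SS'; apply: le_trans (H s us).
exact: ler_sum.
Qed.

Lemma sums_le_scale T (b : T -> R) S c : 0 <= c -> sums_le b S ->
  sums_le (fun t => c * b t) (c * S).
Proof. by move=> c0 H s us; rewrite -mulr_sumr ler_wpM2l// H. Qed.

Lemma sums_le_inj T U (f : U -> T) (b : T -> R) S : injective f ->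
  sums_le b S -> sums_le (b \o f) S.
Proof.
move=> fi H s us; rewrite -(big_map f xpredT b); apply: H.
by rewrite map_inj_uniq.
Qed.

Lemma sums_le_prod T U (f : T -> R) (g : U -> R) Sf Sg :
  (forall t, 0 <= f t) -> (forall t, 0 <= g t) ->
  sums_le f Sf -> sums_le g Sg ->
  sums_le (fun p : T * U => f p.1 * g p.2) (Sf * Sg).
Proof.
move=> f0 g0 Hf Hg s us.
pose s' := [seq (x, y) | x <- undup (map fst s), y <- undup (map snd s)].
apply: (@le_trans _ _ (\sum_(p <- s') f p.1 * g p.2)).
  apply: uniq_sum_le => //; first by move=> t; rewrite mulr_ge0.
  move=> [x y] xys; apply/allpairsP; exists (x, y); split => //=;
    by rewrite mem_undup; apply/mapP; exists (x, y).
rewrite big_allpairs /=.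
under eq_bigr do rewrite -mulr_sumr.
rewrite -mulr_suml ler_pM ?sumr_ge0 ?Hf ?Hg ?undup_uniq//.
Qed.

Lemma sums_le_seq T (b b' : seq T -> R) k r S : (forall p, 0 <= b' p) -> 0 <= r ->
  (forall p, size p = k -> sums_le (fun t => b' (t :: p)) (r * b p)) ->
  sums_le (fun p => if size p == k then b p else 0) S ->
  sums_le (fun p => if size p == k.+1 then b' p else 0) (r * S).
Proof.
move=> b0 r0 Hb HS s us; rewrite -big_mkcond -big_filter.
pose ps := undup (map behead s); pose ts := undup (flatten s).
pose s' := [seq t :: p | p <- ps, t <- ts].
apply: (@le_trans _ _ (\sum_(p <- s') if size p == k.+1 then b' p else 0)).
  rewrite big_filter big_mkcond -[leLHS](big_rmcond (fun p => size p == k.+1)); last by move=> p /negbTE ->.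
  rewrite -big_filter; apply: uniq_sum_le; first by move=> p; case: ifP.
    by rewrite filter_uniq.
  move=> [|t p]; rewrite mem_filter //= => /andP[_ tps].
  apply/allpairsP; exists (p, t); split => //=; rewrite mem_undup.
    by apply/mapP; exists (t :: p).
  by apply/flattenP; exists (t :: p); rewrite ?mem_head.
rewrite big_allpairs_dep /=.
apply: (@le_trans _ _ (\sum_(p <- ps) r * if size p == k then b p else 0)).
  apply: ler_sum => p _; under eq_bigr do rewrite eqSS.
  case: eqP => [kp|_]; last by rewrite big1 ?mulr0.
  exact/Hb/undup_uniq.
by rewrite -mulr_sumr ler_wpM2l// HS// undup_uniq.
Qed.

Lemma geometric_sum_le (q : R) n : 0 <= q < 1 ->
  \sum_(0 <= i < n) q ^+ i <= (1 - q)^-1.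
Proof.
move=> /andP[q0 q1]; have q10 : 0 < 1 - q by rewrite subr_gt0.
rewrite -(ler_pM2l q10) divff ?gt_eqF// big_mkord -opprB mulNr -subrX1.
by rewrite opprB gerBl exprn_ge0.
Qed.

Lemma sums_le_nat (b : nat -> R) S : (forall n, 0 <= b n) ->
  (forall n, \sum_(0 <= i < n) b i <= S) -> sums_le b S.
Proof.
move=> b0 H s us; apply: le_trans (H (\max_(i <- s) i).+1).
rewrite /index_iota subn0; apply: uniq_sum_le => // i si.
by rewrite mem_iota /= add0n ltnS; exact: leq_bigmax_seq.
Qed.

Lemma sums_le_geometric (q : R) : 0 <= q < 1 ->
  sums_le (fun n => q ^+ n) (1 - q)^-1.
Proof.
move=> q01; apply: sums_le_nat => [n|n]; last exact: geometric_sum_le.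
by case/andP: q01 => q0 _; rewrite exprn_ge0.
Qed.

Lemma powR_expR (a x : R) : 0 < a -> a `^ x = expR (x * ln a).
Proof. by move=> a0; rewrite /powR gt_eqF. Qed.

Lemma ler_powRN (a b x : R) : 0 < a -> a <= b -> 0 <= x -> b `^ (- x) <= a `^ (- x).
Proof.
move=> a0 ab x0; have b0 := lt_le_trans a0 ab.
by rewrite !powR_expR// ler_expR !mulNr lerN2 ler_wpM2l// ler_ln.
Qed.

Lemma sums_le_powR (B : R) : 1 < B ->
  sums_le (fun n : nat => n.+1%:R `^ (- B)) (1 - 2 `^ (1 - B))^-1.
Proof.
move=> B1; have q01 : 0 <= (2 : R) `^ (1 - B) < 1.
  rewrite powR_ge0 /= powR_expR// expR_lt1 pmulr_llt0 ?subr_lt0//.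
  by rewrite ln_gt0// ltr1n.
apply: sums_le_nat => [n|n]; first exact: powR_ge0.
apply: (le_trans _ (geometric_sum_le n q01)).
apply: (@le_trans _ _ (\sum_(0 <= i < 2 ^ n - 1) i.+1%:R `^ (- B))).
  rewrite -[in leRHS](@subnK n (2 ^ n - 1)) ?[(_ + n)%N]addnC.
    rewrite [leRHS](big_cat_nat _ (n := n)) ?leq_addr//= lerDl.
    by apply: sumr_ge0 => i _; exact: powR_ge0.
  by have := ltn_expl n (isT : (1 < 2)%N); lia.
elim: n => [|n IH]; first by rewrite !big_geq.
rewrite big_nat_recr //= (big_cat_nat _ (n := 2 ^ n - 1)) //=; last first.
  by rewrite expnS; lia.
apply: lerD => //.
apply: (@le_trans _ _ (\sum_(2 ^ n - 1 <= i < 2 ^ n.+1 - 1) (2 ^+ n) `^ (- B))).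
  apply: ler_sum_nat => i /andP[i1 _].
  apply: ler_powRN; rewrite ?exprn_gt0//; last by lra.
  by rewrite -natrX ler_nat; lia.
rewrite sumr_const_nat expnS.
rewrite (_ : (2 * 2 ^ n - 1 - (2 ^ n - 1) = 2 ^ n)%N); last first.
  by have := expn_gt0 2 n; lia.
rewrite -[leLHS]mulr_natr natrX -!powR_mulrn// -!powRrM -powRD.
  by rewrite le_eqVlt; apply/orP; left; apply/eqP; congr powR; ring.
by rewrite pnatr_eq0 implybT.
Qed.

End SumsLe.

(** * The lattice *)

Section Lattice.
Context {R : realType} {d : nat}.
Implicit Types (x y z : 'rV[int]_d).

Lemma enorm_coord (v : 'rV[R]_d) i : `|v 0 i| <= enorm v.
Proof.
rewrite -sqrtr_sqr ler_sqrt; last by apply: sumr_ge0 => j _; exact: sqr_ge0.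
by rewrite (bigD1 i)//= lerDl; apply: sumr_ge0 => j _; exact: sqr_ge0.
Qed.

Lemma enorm_le (v : 'rV[R]_d) r : 0 <= r -> (forall i, `|v 0 i| <= r) ->
  enorm v <= d%:R * r.
Proof.
move=> r0 H; rewrite -[leRHS]ger0_norm ?mulr_ge0// -sqrtr_sqr.
apply: ler_wsqrtr; apply: (@le_trans _ _ (\sum_(i < d) r ^+ 2)).
  by apply: ler_sum => i _; rewrite -real_normK ?num_real// lerXn2r ?nnegrE.
rewrite sumr_const card_ord exprMn -[leLHS]mulr_natl ler_wpM2r ?sqr_ge0//.
by rewrite -natrX ler_nat; nia.
Qed.

Lemma edistC x y : edist R x y = edist R y x.
Proof.
rewrite /edist /enorm; congr Num.sqrt; apply: eq_bigr => i _.
by rewrite !mxE -sqrrN -rmorphN opprB.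
Qed.

Lemma edist_coord x y i : `|x 0 i - y 0 i|%:~R <= edist R x y.
Proof.
have := enorm_coord (map_mx intr (x - y) : 'rV[R]_d) i.
by rewrite !mxE -intr_norm.
Qed.

Lemma edist_le x y (r : R) : 0 <= r ->
  (forall i, `|x 0 i - y 0 i|%:~R <= r) -> edist R x y <= d%:R * r.
Proof.
by move=> r0 H; apply: enorm_le => // i; rewrite !mxE -intr_norm.
Qed.

Lemma neq_coord x y : x != y -> exists i, x 0 i != y 0 i.
Proof.
move=> xy; apply/existsP; apply: contraNT xy; rewrite negb_exists.
move=> /forallP H; apply/eqP/rowP => i; apply/eqP.
by have := H i; rewrite negbK.
Qed.

Lemma edist_ge1 x y : x != y -> 1 <= edist R x y.
Proof.
move=> /neq_coord[i xyi]; apply: le_trans (edist_coord x y i).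
by rewrite ler1z -gtz0_ge1 normr_gt0 subr_eq0.
Qed.

Lemma edist_ge_half x y i : x != y -> (`|x 0 i - y 0 i| + 1)%:~R / 2 <= edist R x y.
Proof.
move=> xy; have := edist_coord x y i; have := edist_ge1 xy.
by rewrite intrD; lra.
Qed.

Definition box x0 (N : nat) : seq 'rV[int]_d :=
  [seq x0 + \row_i ((f i)%:Z - N%:Z) | f : {ffun 'I_d -> 'I_(N.*2.+1)}].

Lemma mem_box x0 N x : (x \in box x0 N) = [forall i, `|x 0 i - x0 0 i| <= N%:Z].
Proof.
apply/mapP/forallP => [[f _ ->] i|H].
  by rewrite !mxE [x0 0 i + _]addrC addrK; case: (f i) => k kN /=; lia.
exists [ffun i => inord (absz (x 0 i - x0 0 i + N%:Z))]; first by rewrite mem_enum.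
apply/rowP => i; rewrite !mxE ffunE.
have := H i; move: (x 0 i) (x0 0 i) => a b ab.
have ab0 : 0 <= a - b + N%:Z by move: ab; lia.
rewrite inordK; first by rewrite gez0_abs//; lia.
by move: ab; lia.
Qed.

Lemma box_inj x0 N : injective (fun f : {ffun 'I_d -> 'I_(N.*2.+1)} =>
  x0 + \row_i ((f i)%:Z - N%:Z)).
Proof.
move=> f g /addrI /rowP fg; apply/ffunP => i; apply/val_inj.
by have := fg i; rewrite !mxE => /addIr [].
Qed.

Lemma uniq_box x0 N : uniq (box x0 N).
Proof. by rewrite map_inj_uniq ?enum_uniq//; exact: box_inj. Qed.

Lemma size_box x0 N : size (box x0 N) = (N.*2.+1 ^ d)%N.
Proof. by rewrite size_map -cardE card_ffun !card_ord. Qed.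

Lemma sum_box_prod N (g : int -> R) :
  \sum_(x <- box 0 N) \prod_i g (x 0 i) =
  (\sum_(j < N.*2.+1) g (j%:Z - N%:Z)) ^+ d.
Proof.
rewrite big_map -[X in _ ^+ X](card_ord d) -prodr_const bigA_distr_bigA /=.
rewrite big_enum /=; apply: eq_bigr => f _; apply: eq_bigr => i _.
by rewrite !mxE add0r.
Qed.

Lemma box_cover (s : seq 'rV[int]_d) : exists N, {subset s <= box 0 N}.
Proof.
exists (\max_(x <- s) \max_i `|x 0%R i|)%N => x xs; rewrite mem_box.
apply/forallP => i; rewrite mxE subr0.
have h1 := @leq_bigmax_seq _ s xpredT (fun x : 'rV[int]_d => \max_i `|x 0%R i|)%N _ xs isT.
have h2 := @leq_bigmax _ (fun i => `|x 0%R i|%N) i.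
by rewrite -abszE lez_nat; exact: leq_trans h2 h1.
Qed.

Lemma sums_le_int_powR (B : R) : 1 < B -> exists2 C, 0 <= C &
  sums_le (fun j : int => (`|j| + 1)%:~R `^ (- B) : R) C.
Proof.
move=> B1; have Hn := sums_le_powR B1.
have Hb : sums_le (fun b : bool => 1 : R) 2.
  move=> s us; rewrite big_const_seq count_predT iter_addr_0 ler_nat.
  by rewrite -card_bool -(card_uniqP us) max_card.
pose f (j : int) := (j < 0, `|j|%N).
have fI : injective f by move=> i j [] /=; lia.
have H := sums_le_inj fI (sums_le_prod (fun=> ler01)
  (fun n => powR_ge0 n.+1%:R (- B)) Hb Hn).
eexists; first exact: sums_le_ge0 H.
apply: sums_leW H => // j; rewrite /= mul1r -addn1 natrD intrD.
by rewrite -abszE -pmulrn.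
Qed.

Lemma lattice_sum (A : R) : (0 < d)%N -> d%:R < A -> exists2 C, 0 <= C &
  forall x0 : 'rV[int]_d,
    sums_le (fun x => if x == x0 then 0 else edist R x0 x `^ (- A)) C.
Proof.
move=> d0 dA; have dR : 0 < d%:R :> R by rewrite ltr0n.
have B1 : 1 < A / d%:R by rewrite ltr_pdivlMr// mul1r.
have [C C0 HC] := sums_le_int_powR B1.
pose g (j : int) : R := (`|j| + 1)%:~R `^ (- (A / d%:R)).
exists (2 `^ A * C ^+ d) => [|x0]; first by rewrite mulr_ge0 ?powR_ge0 ?exprn_ge0.
have shiftI : injective (fun x => x - x0) by exact: addIr.
suff H : sums_le (fun x : 'rV[int]_d => 2 `^ A * \prod_i g (x 0 i)) (2 `^ A * C ^+ d).
  apply: sums_leW (sums_le_inj shiftI H) => // x /=.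
  case: eqVneq => [_|xx0].
    by rewrite mulr_ge0 ?powR_ge0// prodr_ge0// => i _; exact: powR_ge0.
  have e0 : 0 < edist R x0 x.
    by apply: lt_le_trans (edist_ge1 _); rewrite // eq_sym.
  have -> : edist R x0 x `^ (- A) = \prod_(i < d) (edist R x0 x `^ (- (A / d%:R))).
    rewrite prodr_const card_ord -powR_mulrn ?powR_ge0// -powRrM.
    by congr powR; field; rewrite gt_eqF.
  have -> : 2 `^ A = \prod_(i < d) (2 `^ (A / d%:R)) :> R.
    rewrite prodr_const card_ord -powR_mulrn ?powR_ge0// -powRrM.
    by congr powR; field; rewrite gt_eqF.
  rewrite -big_split /=; apply: ler_prod => i _; rewrite powR_ge0/=.
  rewrite !mxE /g; set u := (_ + 1)%:~R.
  have u0 : 0 < u :> R by rewrite /u ltr0z; lia.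
  have -> : 2 `^ (A / d%:R) * u `^ (- (A / d%:R)) = (u / 2) `^ (- (A / d%:R)).
    rewrite powRM ?ltW// mulrC; congr (_ * _).
    by rewrite -[2^-1]powR_inv1// -powRrM; congr powR; ring.
  apply: ler_powRN; [by lra| |by rewrite divr_ge0//; lra].
  by rewrite edistC; apply: edist_ge_half.
apply: sums_le_scale; first exact: powR_ge0.
move=> s us; have [N sN] := box_cover s.
apply: (@le_trans _ _ (\sum_(x <- box 0 N) \prod_i g (x 0 i))).
  by apply: uniq_sum_le => // x; apply: prodr_ge0 => i _; exact: powR_ge0.
rewrite sum_box_prod lerXn2r ?nnegrE ?sumr_ge0//.
  by move=> j _; exact: powR_ge0.
rewrite -(big_map (fun j : 'I__ => (j : nat)%:Z - N%:Z) xpredT g); apply: HC.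
rewrite map_inj_uniq ?index_enum_uniq//.
by move=> i j /addIr [] /val_inj.
Qed.

End Lattice.

(** * Quantiles and the explosion integral *)

Section Quantile.
Context (dO : measure_display) (O : measurableType dO) (R : realType).
Context (P : probability O R) (L : {RV P >-> R}).
Context (L0 : P [set w | 0 <= L w] = 1%E).
Implicit Types (y t : R).

Lemma cdf_lt0 t : t < 0 -> cdf L t = 0%E.
Proof.
move=> t0; apply/eqP; rewrite eq_le measure_ge0 andbT.
rewrite [leLHS](_ : _ = P (L @^-1` `]-oo, t]))//.
have m0 : measurable [set w | 0 <= L w].
  by rewrite -[X in measurable X]setTI; exact: measurable_fun_le.
rewrite -[leRHS](subee (_ : 1%E \is a fin_num))// -[X in (_ - X)%E]L0 -probability_setC//.
apply: le_measure; rewrite ?inE//; first exact: measurable_funPTI.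
  exact: measurableC.
by move=> w /=; rewrite in_itv/= => Lt; apply/negP; rewrite -ltNge (le_lt_trans Lt).
Qed.

Lemma quantile_set_ge0 y t : 0 < y -> (y%:E <= cdf L t)%E -> 0 <= t.
Proof.
move=> y0 yt; rewrite leNgt; apply/negP => t0; move: yt.
by rewrite cdf_lt0// lee_fin leNgt y0.
Qed.

Lemma quantile_set_nonempty y : y < 1 -> exists t, (y%:E <= cdf L t)%E.
Proof.
move=> y1; apply: contrapT => /forallNP H.
have : (1%E <= y%:E)%E.
  apply: (cvge_to_le (cvg_cdfy1 L)); apply: nearW => t; apply/ltW.
  by rewrite ltNge; apply/negP; exact: H.
by rewrite lee_fin leNgt y1.
Qed.

Lemma quantile_lbound y : 0 < y -> has_lbound [set t | (y%:E <= cdf L t)%E].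
Proof. by move=> y0; exists 0 => t; exact: quantile_set_ge0. Qed.

Lemma quantile_ge0 y : 0 < y -> 0 <= quantile L y.
Proof.
move=> y0; rewrite /quantile.
have [->|/set0P ne] := eqVneq [set t | (y%:E <= cdf L t)%E] set0.
  by rewrite inf0.
by apply: lb_le_inf => // t; exact: quantile_set_ge0.
Qed.

Lemma quantile_le y y' : 0 < y -> y <= y' -> y' < 1 ->
  quantile L y <= quantile L y'.
Proof.
move=> y0 yy' y'1; apply: lb_le_inf; first exact: quantile_set_nonempty.
move=> t yt; apply: ge_inf; first exact: quantile_lbound.
by apply: le_trans yt; rewrite lee_fin.
Qed.

Lemma cdf_lt_quantile y t : 0 < y -> t < quantile L y -> (cdf L t < y%:E)%E.
Proof.
move=> y0 tq; rewrite ltNge; apply/negP => yt.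
by have := ge_inf (quantile_lbound y0) yt; rewrite leNgt tq.
Qed.

Lemma distribution_lt_quantile y : 0 < y ->
  (distribution P L `]-oo, quantile L y[ <= y%:E)%E.
Proof.
move=> y0; set q := quantile L y.
have -> : `]-oo, q[%classic = \bigcup_n `]-oo, q - n.+1%:R^-1]%classic.
  apply/seteqP; split => t /=; rewrite in_itv/=.
    move=> tq; have [n /= Hn] := ltr_add_invr tq; exists n => //=.
    by rewrite in_itv/= lerBrDr ltW.
  by move=> [n _] /=; rewrite in_itv/= => /le_lt_trans; apply; rewrite ltrBlDr ltrDl.
have H := @nondecreasing_cvg_mu _ _ _ (distribution P L) (fun n => `]-oo, q - n.+1%:R^-1]%classic).
apply: (cvge_to_le (H _ _ _)) => //.
- exact: bigcup_measurable.
- move=> m n mn; apply/subsetPset => t /=; rewrite !in_itv/= => /le_trans; apply.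
  by rewrite lerD2l lerN2 lef_pV2 ?posrE// ler_nat.
- by apply: nearW => n; apply/ltW/cdf_lt_quantile => //; rewrite ltrBlDr ltrDl.
Qed.

Lemma distribution_le_quantile y : 0 < y -> y < 1 ->
  (y%:E <= distribution P L `]-oo, quantile L y])%E.
Proof.
move=> y0 y1; apply: (cvge_to_ge (@cdf_right_continuous _ _ _ _ L (quantile L y))).
near=> t.
have tq : 0 < t - quantile L y by rewrite subr_gt0; near: t; exact: nbhs_right_gt.
have [|s /= ys st] := @inf_adherent _ [set t | (y%:E <= cdf L t)%E] _ tq.
  by split; [exact: quantile_set_nonempty|exact: quantile_lbound].
apply: (le_trans ys); apply: cdf_nondecreasing; apply/ltW.
by apply: lt_le_trans st _; rewrite addrC subrK.
Unshelve. all: by end_near. Qed.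

Definition dexp_quantile t : R := quantile L (expR (- expR t)).

Lemma dexp_gt0 t : 0 < expR (- expR t) :> R. Proof. exact: expR_gt0. Qed.

Lemma dexp_lt1 t : expR (- expR t) < 1 :> R.
Proof. by rewrite expR_lt1 oppr_lt0 expR_gt0. Qed.

Lemma dexp_quantile_ge0 t : 0 <= dexp_quantile t.
Proof. exact/quantile_ge0/dexp_gt0. Qed.

Lemma dexp_quantile_noninc t t' : t <= t' -> dexp_quantile t' <= dexp_quantile t.
Proof.
move=> tt'; apply: quantile_le; rewrite ?dexp_gt0 ?dexp_lt1//.
by rewrite ler_expR lerN2 ler_expR.
Qed.

End Quantile.

Section Primitive.
Context {R : realType} (Q : R -> R).
Context (Q0 : forall t, 0 <= Q t) (Qn : forall t t', t <= t' -> Q t' <= Q t).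

Let mu := @lebesgue_measure R.

Definition primitive t : R := fine (\int[mu]_(y in `[0, t]) (Q y)%:E).

Let mQ (D : set (measurableTypeR R)) : measurable D ->
  measurable_fun D (fun y => (Q y)%:E).
Proof.
move=> mD; apply/measurable_EFinP; apply: nonincreasing_measurable => //.
Qed.

Let int_le (a b : R) (i : interval R) : a <= b ->
  (forall y, y \in i -> a <= y) -> mu [set` i] = (b - a)%:E ->
  (\int[mu]_(y in [set` i]) (Q y)%:E <= ((b - a) * Q a)%:E)%E.
Proof.
move=> ab ia mi; rewrite mulrC EFinM -mi -integral_cst//.
apply: ge0_le_integral => //.
- by move=> x _; rewrite lee_fin.
- exact: mQ.
- by move=> x /= xi; rewrite lee_fin Qn// ia.
Qed.

Let int_ge (a b : R) (i : interval R) : a <= b ->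
  (forall y, y \in i -> y <= b) -> mu [set` i] = (b - a)%:E ->
  (((b - a) * Q b)%:E <= \int[mu]_(y in [set` i]) (Q y)%:E)%E.
Proof.
move=> ab ib mi; rewrite mulrC EFinM -mi -integral_cst//.
apply: ge0_le_integral => //.
- by move=> x _; rewrite lee_fin.
- exact: mQ.
- by move=> x /= xi; rewrite lee_fin Qn// ib.
Qed.

Let fin_int t : 0 <= t -> (\int[mu]_(y in `[0%R, t]) (Q y)%:E)%E \is a fin_num.
Proof.
move=> t0; rewrite ge0_fin_numE; last by apply: integral_ge0 => y _; rewrite lee_fin.
apply: (le_lt_trans (@int_le 0 t _ t0 _ _)); last exact: ltry.
  by move=> y; rewrite in_itv/= => /andP[].
rewrite /mu lebesgue_measure_itv/= lte_fin; case: ltP => // h.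
by have /eqP := le_anti (introT andP (conj t0 h)) => /eqP <-; rewrite subr0.
Qed.

Lemma primitive_bounds a b : 0 <= a -> a <= b ->
  (b - a) * Q b <= primitive b - primitive a <= (b - a) * Q a.
Proof.
move=> a0 ab; have b0 := le_trans a0 ab.
have E : (\int[mu]_(y in `[0%R, b]) (Q y)%:E = \int[mu]_(y in `[0%R, a]) (Q y)%:E +
    \int[mu]_(y in `]a, b]) (Q y)%:E)%E.
  rewrite (@itv_bndbnd_setU _ _ (BLeft 0) (BRight a) (BRight b)) ?bnd_simp//.
  rewrite ge0_integral_setU//=.
  - by apply: mQ; exact: measurableU.
  - by move=> x _; rewrite lee_fin.
  - apply/disj_setPLR => y /=; rewrite !in_itv/= => /andP[_ ya].
    by apply/negP; rewrite negb_and -leNgt ya.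
have M : mu `]a, b] = (b - a)%:E.
  rewrite /mu lebesgue_measure_itv/= lte_fin; case: ltP => // h.
  by have -> : a = b; [apply/le_anti/andP|rewrite subrr].
have ia y : y \in `]a, b] -> a <= y by rewrite in_itv/= => /andP[/ltW].
have ib y : y \in `]a, b] -> y <= b by rewrite in_itv/= => /andP[].
have h1 := int_le ab ia M; have h2 := int_ge ab ib M.
have F : (\int[mu]_(y in `]a, b]) (Q y)%:E)%E \is a fin_num.
  rewrite ge0_fin_numE; last by apply: integral_ge0 => y _; rewrite lee_fin.
  by apply: le_lt_trans h1 _; exact: ltry.
have Fa := fin_int a0.
rewrite /primitive E fineD//; set u := fine _; set v := fine _.
rewrite addrAC subrr add0r {}/v.
by rewrite -!lee_fin fineK// h1 h2.
Qed.

Lemma primitive_unbounded : (\int[mu]_(y in `[0%R, +oo[) (Q y)%:E = +oo)%E ->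
  forall M, exists2 T, 0 <= T & forall t, T <= t -> M <= primitive t.
Proof.
move=> HQ M; apply: contrapT => H.
have {}H t : 0 <= t -> primitive t < M.
  move=> t0; rewrite ltNge; apply/negP => Mt; apply: H; exists t => // t' tt'.
  apply: (le_trans Mt); rewrite -subr_ge0.
  have /andP[+ _] := primitive_bounds t0 tt'; apply: le_trans.
  by rewrite mulr_ge0// subr_ge0.
have : (\int[mu]_(y in `[0%R, +oo[) (Q y)%:E <= M%:E)%E.
  have -> : `[0%R, +oo[%classic = \bigcup_n `[0, n%:R : R]%classic.
    apply/seteqP; split => t /=; rewrite in_itv/= ?andbT.
      move=> t0; exists (Num.truncn t).+1 => //=; rewrite in_itv/= t0/=.
      exact/ltW/truncnS_gt.
    by move=> [n _] /=; rewrite in_itv/= => /andP[].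
  have nd : nondecreasing_seq (fun n => `[0, n%:R : R]%classic).
    move=> m n mn; apply/subsetPset => t /=; rewrite !in_itv/= => /andP[-> /le_trans]; apply.
    by rewrite ler_nat.
  have f0 (n : nat) (x : R) : `[0, n%:R : R]%classic x -> (0 <= (Q x)%:E)%E.
    by rewrite lee_fin.
  have C := ge0_nondecreasing_set_cvg_integral (mu := mu) nd (fun n => measurable_itv _)
    (fun n => mQ (measurable_itv _)) f0.
  apply: (cvge_to_le C).
  by apply: nearW => n; rewrite -(fineK (fin_int _))// lee_fin ltW// H.
by rewrite HQ leye_eq.
Qed.

End Primitive.

Section UnionBound.
Context (dO : measure_display) (O : measurableType dO) (R : realType).
Context (P : probability O R).

Lemma union_bound (T : countType) (A : T -> set O) (b : T -> R) S :
  (forall t, measurable (A t)) -> (forall t, (P (A t) <= (b t)%:E)%E) ->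
  sums_le b S -> (P (\bigcup_t A t) <= S%:E)%E.
Proof.
move=> mA Ab bS; pose F n := oapp A set0 (pickle_inv n).
have mF n : measurable (F n) by rewrite /F; case: pickle_inv => [t|] //=.
have -> : \bigcup_t A t = \bigcup_n F n.
  apply/seteqP; split => w [t _ At].
    by exists (pickle t) => //; rewrite /F pickleK_inv.
  by move: At; rewrite /F; case: pickle_inv => //= u Au; exists u.
apply: (le_trans (generalized_Boole_inequality _ mF _)).
  exact: bigcup_measurable.
apply: lime_le; first exact: is_cvg_nneseries.
apply: nearW => N.
apply: (@le_trans _ _ (\sum_(t <- pmap (@pickle_inv T) (iota 0 N)) (b t)%:E)%E).
  rewrite big_mkord -(big_mkord xpredT (fun i => P (F i))) /index_iota subn0.
  elim: (iota 0 N) => [|n s IH]; first by rewrite !big_nil.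
  rewrite big_cons /= /F; case: pickle_inv => [t|] /=.
    by rewrite big_cons leeD.
  by rewrite measure0 add0e.
rewrite sumEFin lee_fin; apply: bS; apply: (pmap_uniq (@pickle_invK T)).
exact: iota_uniq.
Qed.

Lemma finite_union_bound (T : eqType) (s : seq T) (A : T -> set O) (b : T -> R) :
  (forall t, measurable (A t)) -> (forall t, t \in s -> (P (A t) <= (b t)%:E)%E) ->
  (P (\big[setU/set0]_(t <- s) A t) <= (\sum_(t <- s) b t)%:E)%E.
Proof.
move=> mA; elim: s => [|t s IH] Ab; first by rewrite !big_nil measure0.
rewrite !big_cons EFinD; have tb := Ab t (mem_head _ _).
have {}IH : (P (\big[setU/set0]_(t <- s) A t) <= (\sum_(t <- s) b t)%:E)%E.
  by apply: IH => u us; apply: Ab; rewrite in_cons us orbT.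
by apply: le_trans (leeD tb IH); apply: measureU2 => //; exact: bigsetU_measurable.
Qed.

End UnionBound.

(** * Tails of the weights *)

Section Tail.
Context (dO : measure_display) (O : measurableType dO) (R : realType).
Context (P : probability O R) (W : {RV P >-> R}) (ell : R -> R) (tau : R).
Context (W1 : P [set w | 1 <= W w] = 1%E) (hell : slowly_varying ell).
Context (hWtail : forall t : R, 0 < t ->
  P [set w | t < W w] = (ell t / t `^ (tau - 1))%:E).

Definition tail (t : R) : R := fine (P [set w | t < W w]).

Lemma measurable_gt (X : {RV P >-> R}) t : measurable [set w | t < X w].
Proof.
rewrite (_ : [set w | t < X w] = X @^-1` `]t, +oo[).
  exact: measurable_funPTI.
by apply/seteqP; split => w /=; rewrite in_itv/= andbT.
Qed.

Lemma measurable_ge (X : {RV P >-> R}) t : measurable [set w | t <= X w].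
Proof. by rewrite -[X in measurable X]setTI; exact: measurable_fun_le. Qed.

Lemma tailE t : P [set w | t < W w] = (tail t)%:E.
Proof. by rewrite /tail fineK// fin_num_measure//; exact: measurable_gt. Qed.

Lemma tail_le1 t : tail t <= 1.
Proof. by rewrite -lee_fin -tailE probability_le1//; exact: measurable_gt. Qed.

Lemma tail_noninc t t' : t <= t' -> tail t' <= tail t.
Proof.
move=> tt'; rewrite -lee_fin -!tailE; apply: le_measure; rewrite ?inE.
- exact: measurable_gt.
- exact: measurable_gt.
- by move=> w /=; exact: le_lt_trans.
Qed.

Lemma tail_ell t : 0 < t -> tail t = ell t / t `^ (tau - 1).
Proof. by move=> t0; rewrite /tail hWtail. Qed.

Lemma tail_gt0 t : 0 < t -> 0 < tail t.
Proof.
move=> t0; case: hell => _ /(_ t t0) l0 _.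
by rewrite tail_ell// divr_gt0// powR_gt0.
Qed.

Lemma tail_ratio n :
  tail (expR n.+1%:R) = tail (expR n%:R) *
    (ell (expR 1 * expR n%:R) / ell (expR n%:R) * expR (- (tau - 1))).
Proof.
case: hell => _ l0 _; rewrite !tail_ell ?expR_gt0//.
have := l0 _ (expR_gt0 n%:R); set u := ell _ => u0.
rewrite -expRD nat1r; set v := ell _.
rewrite !powR_expR ?expR_gt0// !expRK -natr1 mulrDr mulr1 expRD expRN.
by field; rewrite !gt_eqF ?expR_gt0.
Qed.

Lemma ell_ratio_near (l u : R) : l < 1 -> 1 < u -> exists N : nat, forall n : nat,
  (N <= n)%N -> l < ell (expR 1 * expR n%:R) / ell (expR n%:R) < u.
Proof.
move=> l1 u1; case: hell => _ _ /(_ _ (expR_gt0 1)) H.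
have [M1 [_ HM1]] := cvgr_gt _ H _ l1.
have [M2 [_ HM2]] := cvgr_lt _ H _ u1.
exists (Num.truncn (Num.max M1 M2)).+1 => n Nn.
have : Num.max M1 M2 < expR n%:R.
  apply: (@lt_le_trans _ _ n%:R); first by apply: lt_le_trans (truncnS_gt _) _; rewrite ler_nat.
  by apply: le_trans (expR_ge1Dx _); rewrite lerDr.
by rewrite gt_max => /andP[h1 h2]; rewrite HM1 ?HM2.
Qed.

Lemma tail_upper a : 0 <= a -> a < tau - 1 -> exists2 C, 1 <= C &
  forall n : nat, tail (expR n%:R) <= C * expR (- (a * n%:R)).
Proof.
move=> a0 atau; have u1 : 1 < expR (tau - 1 - a) by rewrite expR_gt1 subr_gt0.
have [N HN] := ell_ratio_near ltr01 u1.
exists (expR (a * N%:R)) => [|n].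
  by rewrite -expR0 ler_expR mulr_ge0.
have [nN|Nn] := ltnP n N.
  apply: (le_trans (tail_le1 _)); rewrite -expRD -[leLHS]expR0 ler_expR -mulrBr mulr_ge0//.
  by rewrite subr_ge0 ler_nat ltnW.
rewrite -(subnK Nn); elim: (n - N)%N => [|k IH].
  by rewrite add0n -expRD subrr expR0 tail_le1.
rewrite addSn tail_ratio -natr1 mulrDr mulr1 [in leRHS]opprD expRD [in leRHS]mulrA.
apply: ler_pM IH _; first exact/ltW/tail_gt0/expR_gt0.
  have /andP[h _] := HN (k + N)%N (leq_addl _ _).
  by rewrite mulr_ge0 ?expR_ge0// ltW.
have /andP[_ h] := HN (k + N)%N (leq_addl _ _).
apply: (@le_trans _ _ (expR (tau - 1 - a) * expR (- (tau - 1)))).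
  by rewrite ler_wpM2r ?expR_ge0// ltW.
by rewrite -expRD ler_expR; lra.
Qed.

Lemma tail_lower a : 0 <= a -> tau - 1 < a -> exists2 c, 0 < c &
  forall t, 0 <= t -> c * expR (- (a * t)) <= tail (expR t).
Proof.
move=> a0 atau; have u1 : expR (tau - 1 - a) < 1 by rewrite expR_lt1 subr_lt0.
have [N HN] := ell_ratio_near u1 (ltr1n _ 2 : 1 < 2 :> R).
have N0 : 0 < tail (expR N%:R) by apply/tail_gt0/expR_gt0.
have H n : tail (expR N%:R) * expR (- (a * n%:R)) <= tail (expR n%:R).
  have [nN|Nn] := ltnP n N.
    apply: (@le_trans _ _ (tail (expR N%:R))).
      by rewrite ler_piMr ?(ltW N0)// expR_le1 oppr_le0 mulr_ge0.
    by apply: tail_noninc; rewrite ler_expR ler_nat ltnW.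
  rewrite -(subnK Nn); elim: (n - N)%N => [|k IH].
    by rewrite add0n ler_piMr ?(ltW N0)// expR_le1 oppr_le0 mulr_ge0.
  rewrite addSn tail_ratio -natr1 mulrDr mulr1 [in leLHS]opprD expRD mulrA.
  apply: ler_pM IH _; rewrite ?expR_ge0//.
    by rewrite mulr_ge0 ?expR_ge0// ltW.
  have /andP[h _] := HN (k + N)%N (leq_addl _ _).
  apply: (@le_trans _ _ (expR (tau - 1 - a) * expR (- (tau - 1)))).
    by rewrite -expRD ler_expR; lra.
  by rewrite ler_wpM2r ?expR_ge0// ltW.
exists (tail (expR N%:R) * expR (- a)) => [|t t0]; first by rewrite mulr_gt0// expR_gt0.
have /andP[t1 t2] := truncn_itv t0.
apply: le_trans (tail_noninc (_ : expR t <= expR (Num.truncn t).+1%:R)); last first.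
  by rewrite ler_expR ltW.
apply: le_trans (H _); rewrite -mulrA ler_wpM2l ?(ltW N0)//.
by rewrite -expRD ler_expR -opprD lerN2 -natr1 mulrDr mulr1 addrC lerD2l ler_wpM2l.
Qed.

Definition level (n : nat) : set R := `[expR n%:R, expR n.+1%:R[.

Lemma measurable_level n : measurable (level n). Proof. exact: measurable_itv. Qed.

Definition level_prob (n : nat) : R := fine (P (W @^-1` level n)).

Lemma level_probE n : P (W @^-1` level n) = (level_prob n)%:E.
Proof. by rewrite /level_prob fineK// fin_num_measure//; apply: measurable_funPTI; exact: measurable_level. Qed.

Lemma level_prob_ge0 n : 0 <= level_prob n.
Proof. by rewrite -lee_fin -level_probE. Qed.

Lemma level_sum a : 0 <= a -> a < tau - 1 -> exists2 M, 0 <= M &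
  sums_le (fun n => level_prob n * expR (a * n.+1%:R)) M.
Proof.
move=> a0 atau; pose a' := (a + (tau - 1)) / 2.
have aa' : a < a' by rewrite /a'; lra.
have a'0 : 0 <= a' by lra.
have a't : a' < tau - 1 by rewrite /a'; lra.
clearbody a'.
have [C C1 HC] := tail_upper a'0 a't.
have q01 : 0 <= expR (a - a') < 1 by rewrite expR_ge0 expR_lt1 subr_lt0.
have S := sums_le_scale (_ : 0 <= C * expR (a + a')) (sums_le_geometric q01).
eexists; last first.
  apply: sums_leW (S _) => // [n|]; last by rewrite mulr_ge0 ?expR_ge0//; lra.
  have Hn : level_prob n <= C * expR (a' - a' * n%:R).
    case: n => [|n].
      rewrite mulr0 subr0 -lee_fin -level_probE.
      apply: (le_trans (probability_le1 _ _)); first by apply: measurable_funPTI; exact: measurable_level.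
      by rewrite lee_fin -[leLHS]mulr1 ler_pM// -expR0 ler_expR.
    rewrite -lee_fin -level_probE; apply: (@le_trans _ _ (tail (expR n%:R))%:E).
      rewrite -tailE; apply: le_measure; rewrite ?inE.
      - by apply: measurable_funPTI; exact: measurable_level.
      - exact: measurable_gt.
      - move=> w; rewrite /level /= in_itv/= => /andP[+ _]; apply: lt_le_trans.
        by rewrite ltr_expR ltr_nat.
    apply: (le_trans (HC n)).
    by rewrite -natr1 mulrDr mulr1 opprD addrCA subrr addr0.
  apply: (@le_trans _ _ (C * expR (a' - a' * n%:R) * expR (a * n.+1%:R))).
    by rewrite ler_wpM2r ?expR_ge0.
  rewrite -!mulrA ler_wpM2l//; first by lra.
  by rewrite -expRM_natr -!expRD ler_expR -[n.+1%:R]natr1; lra.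
by apply: sums_le_ge0 (S _); rewrite mulr_ge0 ?expR_ge0//; lra.
Qed.

End Tail.

Arguments level {R}.

Section DistinctEdges.
Context {V : eqType}.
Implicit Types (s : seq V).

Fixpoint path_edges s : seq (V * V) :=
  if s is x :: s' then (if s' is y :: _ then (y, x) :: path_edges s' else [::])
  else [::].

Lemma path_edges_mem s e : e \in path_edges s -> (e.1 \in s) && (e.2 \in s).
Proof.
elim: s => [//|x [//|y s] IH] /=; rewrite in_cons => /orP[/eqP ->|/IH] /=.
  by rewrite !in_cons !eqxx !orbT.
by move=> /andP[h1 h2]; rewrite !(in_cons x) h1 h2 !orbT.
Qed.

Lemma distinct_edges_cons (e : V * V) E :
  distinct_edges (e :: E) =
  [&& e.1 != e.2, all (fun f => (f != e) && (f != (e.2, e.1))) E & distinct_edges E].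
Proof. by rewrite /distinct_edges /=; case: (_ != _); case: (all _ E); case: (all _ E). Qed.

Lemma distinct_path_edges s : uniq s -> distinct_edges (path_edges s).
Proof.
elim: s => [//|x [//|y s] IH] /andP[xs us].
rewrite [path_edges _]/= distinct_edges_cons /= IH// andbT.
apply/andP; split; first by move: xs; rewrite in_cons negb_or eq_sym => /andP[].
apply/allP => f fs; have /andP[f1 f2] := @path_edges_mem (y :: s) f fs.
apply/andP; split; apply/eqP => fE; rewrite fE in f1 f2; move/negP: xs; apply.
  exact: f2.
exact: f1.
Qed.

End DistinctEdges.

(** * The percolation model *)

Section Model.
Context (dO : measure_display) (O : measurableType dO) (R : realType).
Context (P : probability O R) (d : nat) (alpha lambda : R) (W L : {RV P >-> R}).
Context (Wv : 'rV[int]_d -> {RV P >-> R}) (adj : O -> rel 'rV[int]_d).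
Context (Le : 'rV[int]_d -> 'rV[int]_d -> {RV P >-> R}).
Context (H : weighted_sfp alpha lambda W L Wv adj Le).
Notation V := 'rV[int]_d.

Lemma weight_lawE x (B : set R) : measurable B ->
  P (Wv x @^-1` B) = P (W @^-1` B).
Proof. by move=> mB; have := sfp_weight_law H x mB. Qed.

Lemma length_lawE x y (B : set R) : x != y -> measurable B ->
  P (Le x y @^-1` B) = P (L @^-1` B).
Proof. by move=> xy mB; have := sfp_length_law H xy mB. Qed.

Definition weights_in (T : Type) (B : T -> set R) (p : seq (V * T)) : set O :=
  \big[setI/setT]_(t <- p) (Wv t.1 @^-1` B t.2).

Definition all_edges (E : seq (V * V)) : set O :=
  \big[setI/setT]_(e <- E) edge_event adj e.1 e.2.

Lemma all_edgesE E : all_edges E = \bigcap_(e in [set` E]) edge_event adj e.1 e.2.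
Proof. by rewrite bigcap_seq. Qed.

Lemma weights_inE (T : Type) (B : T -> set R) p w :
  weights_in B p w <-> (forall t, List.In t p -> B t.2 (Wv t.1 w)).
Proof.
rewrite /weights_in; elim: p => [|t p IH]; first by rewrite big_nil.
rewrite big_cons; split => [[h1 /IH h2] u [<-//|/h2//]|h].
by split; [exact: h (or_introl erefl)|apply/IH => u up; apply: h; right].
Qed.

Lemma weights_in_prob (T : Type) (B : T -> set R) (p : seq (V * T)) :
  (forall t, measurable (B t)) -> uniq (map fst p) ->
  P (weights_in B p) = (\prod_(t <- p) P (W @^-1` B t.2))%E.
Proof.
move=> mB up.
have [B' mB' HB'] : exists2 B' : V -> set R, (forall x, measurable (B' x)) &
    forall t, List.In t p -> B' t.1 = B t.2.
  elim: p up => [_|t p IH /= /andP[tp up]]; first by exists (fun=> set0).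
  have [B' mB' HB'] := IH up.
  exists (fun x => if x == t.1 then B t.2 else B' x) => [x|u]; first by case: ifP.
  case=> [<-|up']; first by rewrite eqxx.
  case: eqP => [ut|_]; last exact: HB'.
  have : u.1 \in map fst p.
    elim: p up' {IH tp up HB'} => //= v p IH [->|/IH h]; rewrite in_cons ?eqxx ?h ?orbT//.
  by rewrite ut (negbTE tp).
have := sfp_weights H up mB'.
rewrite big_map bigcap_seq big_map.
have E (A : Type) (op : A -> A -> A) idx (F1 F2 : V * T -> A) :
    (forall t, List.In t p -> F1 t = F2 t) ->
    \big[op/idx]_(t <- p) F1 t = \big[op/idx]_(t <- p) F2 t.
  elim: p {up HB'} => [|t p IH] h; first by rewrite !big_nil.
  by rewrite !big_cons h ?IH//=; [move=> u up; apply: h; right|left].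
rewrite /weights_in (E _ _ _ _ (fun t => Wv t.1 @^-1` B t.2)); last by move=> t /HB' ->.
by move=> ->; apply: E => t /HB' <-; rewrite -(weight_lawE t.1).
Qed.

Lemma weight_event_sigma x (B : set R) : measurable B ->
  <<s weight_events Wv >> (Wv x @^-1` B).
Proof.
by move=> mB; apply: sub_sigma_algebra; exists x => //; exists B => //; rewrite setTI.
Qed.

Lemma weights_in_sigma (T : Type) (B : T -> set R) (p : seq (V * T)) :
  (forall t, measurable (B t)) -> <<s weight_events Wv >> (weights_in B p).
Proof.
move=> mB; rewrite /weights_in.
pose X := g_sigma_algebraType (weight_events Wv).
suff : measurable (\big[setI/setT]_(t <- p) (Wv t.1 @^-1` B t.2) : set X) by [].
elim/big_ind: _ => //; first by move=> A A'; exact: (@measurableI _ X).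
by move=> t _; exact: weight_event_sigma.
Qed.

Lemma weights_edges_sigma (T : Type) (B : T -> set R) (p : seq (V * T)) E :
  (forall t, measurable (B t)) ->
  <<s weight_events Wv `|` edge_events adj >> (weights_in B p `&` all_edges E).
Proof.
move=> mB.
pose X := g_sigma_algebraType (weight_events Wv `|` edge_events adj).
suff : measurable (weights_in B p `&` all_edges E : set X) by [].
apply: measurableI.
  rewrite /weights_in; elim/big_ind: _ => //; first by move=> A A'; exact: (@measurableI _ X).
  move=> t _; apply: sub_sigma_algebra; left; exists t.1 => //.
  by exists (B t.2) => //; rewrite setTI.
rewrite /all_edges; elim/big_ind: _ => //; first by move=> A A'; exact: (@measurableI _ X).
by move=> e _; apply: sub_sigma_algebra; right; exists e.1, e.2.
Qed.

Lemma measurable_weights_in (T : Type) (B : T -> set R) (p : seq (V * T)) :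
  (forall t, measurable (B t)) -> measurable (weights_in B p).
Proof.
move=> mB; rewrite /weights_in; elim/big_ind: _ => //; first exact: measurableI.
by move=> t _; apply: measurable_funPTI.
Qed.

Lemma measurable_all_edges E : measurable (all_edges E).
Proof.
rewrite /all_edges; elim/big_ind: _ => //; first exact: measurableI.
by move=> e _; exact: sfp_adj_measurable H _ _.
Qed.

Lemma measurable_conn_prob x y :
  measurable_fun setT (conn_prob alpha lambda Wv x y).
Proof.
rewrite /conn_prob; case: eqP => _; first exact: measurable_cst.
apply: measurable_funB; first exact: measurable_cst.
apply: measurableT_comp => //; apply: measurableT_comp => //.
apply: measurable_funM; last exact: measurable_cst.
by apply: measurable_funM => //; apply: measurable_funM.
Qed.

(* W >= 1 only holds almost surely, hence the assumption on the weights. *)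
Lemma conn_prob_ge0 x y w : 0 < lambda -> 0 <= Wv x w -> 0 <= Wv y w ->
  0 <= conn_prob alpha lambda Wv x y w.
Proof.
move=> l0 x0 y0; rewrite /conn_prob; case: eqP => // _.
rewrite subr_ge0 expR_le1 oppr_le0 !mulr_ge0 ?invr_ge0 ?powR_ge0//.
exact: ltW.
Qed.

Lemma edges_prob_le (T : Type) (B : T -> set R) (p : seq (V * T)) E (c : R) :
  (forall t, measurable (B t)) -> uniq (map fst p) -> distinct_edges E ->
  (forall w, weights_in B p w ->
    0 <= \prod_(e <- E) conn_prob alpha lambda Wv e.1 e.2 w <= c) ->
  (P (weights_in B p `&` all_edges E) <= c%:E * \prod_(t <- p) P (W @^-1` B t.2))%E.
Proof.
move=> mB up dE Hc; rewrite -weights_in_prob// all_edgesE (sfp_edges H)//; last first.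
  exact: weights_in_sigma.
have mp := measurable_weights_in p mB.
rewrite -integral_cst//; apply: ge0_le_integral => //.
- by move=> w /Hc /andP[h _]; rewrite lee_fin.
- apply/measurable_EFinP; apply: measurable_funTS.
  by apply: measurable_prod => e _; exact: measurable_conn_prob.
- by move=> w /Hc /andP[_ h]; rewrite lee_fin.
Qed.

Lemma edges_length_prob (T : Type) (B : T -> set R) (p : seq (V * T)) E x y (D : set R) :
  (forall t, measurable (B t)) -> x != y -> measurable D ->
  P (weights_in B p `&` all_edges E `&` Le x y @^-1` D) =
  (P (weights_in B p `&` all_edges E) * P (L @^-1` D))%E.
Proof.
move=> mB xy mD.
have dE : distinct_edges [:: (x, y)] by rewrite distinct_edges_cons /= xy.
have := sfp_lengths H dE (weights_edges_sigma p E mB) (fun=> mD).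
by rewrite bigcap_seq !big_seq1 /= (length_lawE xy).
Qed.

End Model.

(** * The lower bound *)

Section LowerBound.
Context (dO : measure_display) (O : measurableType dO) (R : realType).
Context (P : probability O R) (d : nat) (alpha lambda : R) (W L : {RV P >-> R}).
Context (Wv : 'rV[int]_d -> {RV P >-> R}) (adj : O -> rel 'rV[int]_d).
Context (Le : 'rV[int]_d -> 'rV[int]_d -> {RV P >-> R}).
Context (H : weighted_sfp alpha lambda W L Wv adj Le).
Context (L0 : P [set w | 0 <= L w] = 1%E).
Notation V := 'rV[int]_d.
(* A path is a list of pairs (vertex, level of its weight), last vertex first. *)
Notation T := (V * nat)%type.
Notation pi := (level_prob W).

Context (s a A C M lamc : R).
Context (l0 : 0 < lambda) (lam : lambda <= expR lamc) (lamc0 : 0 <= lamc).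
Context (alpha0 : 0 < alpha) (s0 : 0 < s) (s1 : s <= 1) (sa : s < a) (a2s : a <= 2 * s).
Context (A0 : 0 <= A) (As : A < alpha * s).
Context (hC : forall x0 : V,
  sums_le (fun x => if x == x0 then 0 else edist R x0 x `^ (- A)) C).
Context (hM : sums_le (fun n => pi n * expR (a * n.+1%:R)) M).

Lemma level_ge1 n u : level n u -> 1 <= u :> R.
Proof.
rewrite /level /= in_itv/= => /andP[+ _]; apply: le_trans.
by rewrite -[leLHS]expR0 ler_expR.
Qed.

Lemma level_lt n u : level n u -> u < expR n.+1%:R :> R.
Proof. by rewrite /level /= in_itv/= => /andP[]. Qed.

Definition edge_bound (t t' : T) : R :=
  expR (s * (lamc + t.2.+1%:R + t'.2.+1%:R)) * edist R t.1 t'.1 `^ (- (alpha * s)).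

Lemma edge_bound_ge0 t t' : 0 <= edge_bound t t'.
Proof. by rewrite mulr_ge0 ?expR_ge0 ?powR_ge0. Qed.

(* 1 - exp (- u) <= min 1 u <= u `^ s turns the connection probability into a
   product of powers of the two weights and of the distance. *)
Lemma conn_prob_bound (t t' : T) w : t.1 != t'.1 ->
  level t.2 (Wv t.1 w) -> level t'.2 (Wv t'.1 w) ->
  0 <= conn_prob alpha lambda Wv t.1 t'.1 w <= edge_bound t t'.
Proof.
move=> tt' lt lt'.
have W1 := level_ge1 lt; have W1' := level_ge1 lt'.
rewrite conn_prob_ge0//=; [|by lra|by lra].
have r1 := edist_ge1 (R := R) tt'; rewrite /conn_prob /edge_bound; set r := edist R _ _ in r1 *.
case: eqP => [->|_].
  rewrite powR1 mulr1 -[leLHS]expR0 ler_expR mulr_ge0 ?addr_ge0//; exact: ltW.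
have r0 : 0 < r by lra.
pose v := expR (lamc + t.2.+1%:R + t'.2.+1%:R) * r `^ (- alpha).
have v0 : 0 < v by rewrite mulr_gt0 ?expR_gt0 ?powR_gt0.
have -> : expR (s * (lamc + t.2.+1%:R + t'.2.+1%:R)) * r `^ (- (alpha * s)) = v `^ s.
  rewrite /v powRM ?expR_ge0 ?powR_ge0// -expRM -powRrM.
  by congr (_ * _); [congr expR|congr powR]; ring.
have uv : lambda * Wv t.1 w * Wv t'.1 w / r `^ alpha <= v.
  rewrite /v powRN ler_wpM2r ?invr_ge0 ?powR_ge0// !expRD.
  have h1 := ltW (level_lt lt); have h2 := ltW (level_lt lt').
  have w0 : 0 <= Wv t.1 w by exact: le_trans W1.
  have w0' : 0 <= Wv t'.1 w by exact: le_trans W1'.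
  by rewrite !ler_pM ?mulr_ge0 ?(ltW l0).
set u := (X in expR (- X)) in uv *.
have h1 : 1 - expR (- u) <= u by have := expR_ge1Dx (- u); lra.
have h2 : 1 - expR (- u) <= 1 by rewrite gerBl expR_ge0.
have [v1|v1] := leP v 1.
  apply: (le_trans h1); apply: (le_trans uv); apply: ger1_powR => //.
  by rewrite v0.
apply: (le_trans h2); rewrite -[leLHS](powRr0 v); apply: ler_powR; exact: ltW.
Qed.

Fixpoint path_bound (p : seq T) : R :=
  if p is t :: q then (if q is t' :: _ then edge_bound t' t else 1) * path_bound q
  else 1.

Lemma path_bound_ge0 p : 0 <= path_bound p.
Proof.
elim: p => [|t [|t' q] IH]; rewrite ?ler01 ?mulr1//=.
by rewrite mulr_ge0 ?edge_bound_ge0.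
Qed.

Definition path_event (p : seq T) : set O :=
  weights_in Wv level p `&` all_edges adj (path_edges (map fst p)).

Definition path_prob (p : seq T) : R := (\prod_(t <- p) pi t.2) * path_bound p.

Lemma path_prob_ge0 p : 0 <= path_prob p.
Proof.
by rewrite mulr_ge0 ?path_bound_ge0// prodr_ge0// => t _; exact: level_prob_ge0.
Qed.

Lemma measurable_path_event p : measurable (path_event p).
Proof.
apply: measurableI; last exact: measurable_all_edges H _.
by apply: measurable_weights_in => n; exact: measurable_level.
Qed.

Lemma path_event_prob p : uniq (map fst p) -> (P (path_event p) <= (path_prob p)%:E)%E.
Proof.
move=> up; rewrite /path_event /path_prob.
have mL : forall n, measurable (level n : set R) by exact: measurable_level.
apply: (le_trans (edges_prob_le H (c := path_bound p) mL up (distinct_path_edges up) _)).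
  move=> w; elim: p up => [|t [|t' q] IH] /= up; rewrite ?big_nil ?mulr1 ?ler01//=.
  rewrite /weights_in big_cons => -[lt lq].
  move: up => /andP[+ up]; rewrite in_cons negb_or => /andP[tt' _].
  have /andP[i1 i2] := IH up lq.
  have lt' : level t'.2 (Wv t'.1 w) by move: lq; rewrite big_cons => -[].
  have /andP[c1 c2] : 0 <= conn_prob alpha lambda Wv t'.1 t.1 w <= edge_bound t' t.
    by apply: conn_prob_bound => //; rewrite eq_sym.
  by rewrite big_cons /= mulr_ge0//= ler_pM.
rewrite EFinM muleC; apply: lee_wpmul2r; first by rewrite lee_fin path_bound_ge0.
elim: p {up} => [|t p IH]; first by rewrite !big_nil.
rewrite !big_cons EFinM level_probE; apply: lee_wpmul2l => //.
by rewrite lee_fin level_prob_ge0.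
Qed.

Lemma path_prob_cons t p : path_prob (t :: p) =
  pi t.2 * (if p is t' :: _ then edge_bound t' t else 1) * path_prob p.
Proof. by rewrite /path_prob big_cons /=; ring. Qed.

Context (x0 : V) (beta : nat -> R) (beta0 : forall k, 0 <= beta k).

Definition rho := 2 * s - a.
Definition sigma := a - s.

Fixpoint valid (p : seq T) : bool :=
  if p is t :: q then
    [&& (if q is t' :: _ then t'.1 != t.1 else t.1 == x0),
        t.2%:R <= beta (size q) & valid q]
  else true.

Definition weight_factor (p : seq T) : R := if p is t :: _ then expR (s * t.2.+1%:R) else 1.

Definition valid_prob (p : seq T) : R :=
  if valid p then path_prob p * weight_factor p else 0.

Definition kappa (x y : V) : R := if y == x then 0 else edist R x y `^ (- A).

Lemma kappa_ge0 x y : 0 <= kappa x y.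
Proof. by rewrite /kappa; case: ifP => // _; exact: powR_ge0. Qed.

Lemma valid_prob_ge0 p : 0 <= valid_prob p.
Proof.
rewrite /valid_prob; case: ifP => // _; rewrite mulr_ge0 ?path_prob_ge0//.
by case: p => //= t p; rewrite expR_ge0.
Qed.

Lemma moment_ge0 : 0 <= M. Proof. exact: sums_le_ge0 hM. Qed.
Lemma lattice_const_ge0 : 0 <= C. Proof. exact: sums_le_ge0 (hC 0). Qed.

Lemma edge_bound_kappa t t' : t.1 != t'.1 -> edge_bound t t' <=
  expR (s * lamc) * expR (s * t.2.+1%:R) * expR (s * t'.2.+1%:R) * kappa t.1 t'.1.
Proof.
move=> tt'; rewrite /edge_bound /kappa eq_sym (negbTE tt') -!expRD -!mulrDr.
rewrite ler_wpM2l ?expR_ge0//; apply: ler_powR; first exact: edist_ge1.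
by rewrite lerN2 ltW.
Qed.

Lemma sums_le_delta : sums_le (fun x : V => if x == x0 then 1 else 0 : R) 1.
Proof.
move=> l ul; rewrite -big_mkcond /= -big_filter.
have [x0l|x0l] := boolP (x0 \in l).
  by rewrite filter_pred1_uniq// big_seq1.
by rewrite big_filter big1_seq// => x /andP[/eqP ->]; rewrite (negbTE x0l).
Qed.

Definition growth_const := expR (s * lamc) * C * M * expR rho + M.

Lemma growth_const_ge0 : 0 <= growth_const.
Proof. by rewrite addr_ge0 ?mulr_ge0 ?expR_ge0 ?moment_ge0 ?lattice_const_ge0. Qed.

Lemma sums_le_level (b : R) : 0 <= b ->
  sums_le (fun n => if n%:R <= b then pi n * expR (2 * s * n.+1%:R) else 0)
    (expR (rho * (b + 1)) * M).
Proof.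
move=> b0; apply: sums_leW (sums_le_scale (expR_ge0 _) hM) => // n.
case: ifP => [nb|_]; last by rewrite !mulr_ge0 ?expR_ge0 ?level_prob_ge0.
rewrite [leRHS]mulrCA ler_wpM2l ?level_prob_ge0// -expRD ler_expR /rho -natr1.
rewrite -subr_ge0 (_ : _ - _ = (2 * s - a) * (b - n%:R)); last by ring.
by rewrite mulr_ge0 ?subr_ge0.
Qed.

Lemma sums_le_valid_step k p : size p = k ->
  sums_le (fun t => valid_prob (t :: p)) (growth_const * expR (rho * beta k) * valid_prob p).
Proof.
move=> kp; case: p kp => [|t' q] kp.
  rewrite {2}/valid_prob /= /path_prob big_nil !mulr1.
  have d0 (x : V) : 0 <= (if x == x0 then 1 else 0 : R) by case: ifP.
  have p0 n : 0 <= pi n * expR (a * n.+1%:R).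
    by rewrite mulr_ge0 ?level_prob_ge0 ?expR_ge0.
  apply: sums_leW (sums_le_prod d0 p0 sums_le_delta hM) => [[x n]|].
  - rewrite /valid_prob /= andbT path_prob_cons /path_prob big_nil !mulr1.
    case: (x == x0) => /=; last by rewrite mul0r.
    rewrite mul1r; case: ifP => _; last by rewrite mulr_ge0 ?level_prob_ge0 ?expR_ge0.
    by rewrite ler_wpM2l ?level_prob_ge0// ler_expR ler_wpM2r// ltW.
  - rewrite mul1r /growth_const; apply: (@le_trans _ _ (growth_const * 1)).
      by rewrite mulr1 lerDr !mulr_ge0 ?expR_ge0 ?moment_ge0 ?lattice_const_ge0.
    by rewrite ler_wpM2l ?growth_const_ge0// -[leLHS]expR0 ler_expR mulr_ge0// /rho subr_ge0.
have [vq|vq] := boolP (valid (t' :: q)); last first.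
  apply: (@sums_leW _ _ _ (fun=> 0) 0) => [t||l _].
  - by rewrite /valid_prob [valid _]/= -/(valid (t' :: q)) (negbTE vq) !andbF.
  - by rewrite mulr_ge0 ?valid_prob_ge0// mulr_ge0 ?growth_const_ge0 ?expR_ge0.
  - by rewrite big1.
have S := sums_le_scale (_ : 0 <= expR (s * lamc) * valid_prob (t' :: q))
  (sums_le_prod (fun x => _) (fun n => _) (hC t'.1) (sums_le_level (beta0 k))).
apply: sums_leW (S _ _ _) => [[x n]|||x|n].
- rewrite /=; set g := if n%:R <= _ then _ else _.
  have g0 : 0 <= g.
    by rewrite /g; case: ifP => // _; rewrite mulr_ge0 ?level_prob_ge0 ?expR_ge0.
  have rhs0 : 0 <= expR (s * lamc) * valid_prob (t' :: q) * (kappa t'.1 x * g).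
    by rewrite !mulr_ge0 ?valid_prob_ge0 ?kappa_ge0 ?expR_ge0.
  have [t'x|t'x] := eqVneq t'.1 x.
    rewrite {1}/valid_prob [valid (_ :: t' :: q)]/= t'x eqxx /=.
    by rewrite mul0r mulr0.
  move: rhs0; rewrite /valid_prob [valid (_ :: t' :: q)]/= -/(valid (t' :: q)) vq andbT.
  rewrite -/(kappa t'.1 x) t'x => rhs0.
  rewrite /= /g -kp; case: ifP => _; last first.
    by rewrite !mulr0.
  rewrite path_prob_cons.
  have := edge_bound_kappa (t := t') (t' := (x, n)) t'x; rewrite /= => eb.
  have c0 : 0 <= pi n * expR (s * n.+1%:R) * path_prob (t' :: q).
    apply: mulr_ge0 (path_prob_ge0 _).
    by rewrite mulr_ge0 ?level_prob_ge0 ?expR_ge0.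
  apply: (le_trans _ (le_trans (ler_wpM2l c0 eb) _)).
  + by rewrite le_eqVlt; apply/orP; left; apply/eqP; ring.
  + rewrite le_eqVlt; apply/orP; left; apply/eqP.
    have -> : 2 * s * n.+1%:R = s * n.+1%:R + s * n.+1%:R by ring.
    by rewrite expRD /kappa eq_sym (negbTE t'x); ring.
- apply: (@le_trans _ _ ((expR (s * lamc) * C * M * expR rho) *
      expR (rho * beta k) * valid_prob (t' :: q))).
    rewrite le_eqVlt; apply/orP; left; apply/eqP.
    by rewrite mulrDr mulr1 expRD; ring.
  rewrite ler_wpM2r ?valid_prob_ge0// ler_wpM2r ?expR_ge0//.
  by rewrite /growth_const lerDl moment_ge0.
- by rewrite mulr_ge0 ?expR_ge0 ?valid_prob_ge0.
- exact: kappa_ge0.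
- by case: ifP => // _; rewrite mulr_ge0 ?level_prob_ge0 ?expR_ge0.
Qed.

Lemma sums_le_valid k :
  sums_le (fun p => if size p == k then valid_prob p else 0)
    (growth_const ^+ k * expR (rho * \sum_(i < k) beta i)).
Proof.
elim: k => [|k IH].
  rewrite big_ord0 mulr0 expR0 mulr1 => l ul; rewrite -big_mkcond -big_filter.
  have -> : \sum_(p <- [seq p <- l | size p == 0%N]) valid_prob p =
            \sum_(p <- [seq p <- l | p == [::]]) 1.
    rewrite !big_filter; apply: eq_big => [[]//|[]//= _].
    by rewrite /valid_prob /path_prob big_nil /= !mulr1.
  have [nl|nl] := boolP ([::] \in l); first by rewrite filter_pred1_uniq// big_seq1.
  by rewrite big_filter big1_seq// => x /andP[/eqP ->]; rewrite (negbTE nl).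
rewrite big_ord_recr /= mulrDr expRD.
have := sums_le_seq valid_prob_ge0 (_ : 0 <= growth_const * expR (rho * beta k)) (@sums_le_valid_step k) IH.
move=> /(_ _) h; apply: sums_leW (h _) => //; last by rewrite mulr_ge0 ?growth_const_ge0 ?expR_ge0.
by rewrite le_eqVlt; apply/orP; left; apply/eqP; rewrite exprS; ring.
Qed.

Definition max_step k : R := expR (sigma * beta k / (alpha * s - A)).

Definition min_length k : R := quantile L (expR (- (sigma * beta k))).

Definition final_weight k (t' t : T) : R :=
  (nat_of_bool (beta k < t.2%:R))%:R + (nat_of_bool (max_step k < edist R t'.1 t.1))%:R + expR (- (sigma * beta k)).

Definition final_prob (p : seq T) : R :=
  if p is t :: q then
    if valid q then
      if q is t' :: _ then
        if t'.1 != t.1 then path_prob p * final_weight (size q) t' t else 0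
      else if (t.1 == x0) && (beta 0 < t.2%:R) then path_prob p else 0
    else 0
  else 0.

Lemma final_weight_ge0 k t t' : 0 <= final_weight k t t'.
Proof. by rewrite !addr_ge0 ?expR_ge0. Qed.

Lemma final_prob_ge0 p : 0 <= final_prob p.
Proof.
case: p => [//|t [|t' q]]; rewrite /final_prob; case: (valid _) => //.
  by case: (_ && _) => //; exact: path_prob_ge0.
case: (_ != _) => //.
by apply: mulr_ge0 (path_prob_ge0 _) (final_weight_ge0 _ _ _).
Qed.

Lemma sigma_ge0 : 0 <= sigma. Proof. by rewrite subr_ge0 ltW. Qed.

Lemma edge_bound_final k t t' : t'.1 != t.1 ->
  edge_bound t' t * final_weight k t' t <=
  3 * expR (- (sigma * beta k)) * (expR (s * lamc) * expR (s * t'.2.+1%:R)) *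
    (kappa t'.1 t.1 * expR (a * t.2.+1%:R)).
Proof.
move=> tt'; set y := expR (- (sigma * beta k)).
set c := expR (s * lamc) * _; set r := edist R t'.1 t.1.
have c0 : 0 <= c by rewrite mulr_ge0 ?expR_ge0.
have r1 : 1 <= r by exact: edist_ge1.
have kE : kappa t'.1 t.1 = r `^ (- A) by rewrite /kappa eq_sym (negbTE tt').
have nE : expR (s * t.2.+1%:R) <= expR (a * t.2.+1%:R).
  by rewrite ler_expR ler_wpM2r// ltW.
have kr : r `^ (- (alpha * s)) <= kappa t'.1 t.1.
  by rewrite kE; apply: ler_powR => //; rewrite lerN2 ltW.
have -> : edge_bound t' t = c * (r `^ (- (alpha * s)) * expR (s * t.2.+1%:R)).
  by rewrite /edge_bound !mulrDr !expRD -/r /c; ring.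
set e := expR (a * _); rewrite [leRHS](_ : _ = c * (3 * (y * (kappa t'.1 t.1 * e)))); last by ring.
rewrite -mulrA; apply: ler_wpM2l => //; rewrite /e {e}.
rewrite /final_weight -/r -/y.
have h1 : r `^ (- (alpha * s)) * expR (s * t.2.+1%:R) <= kappa t'.1 t.1 * expR (a * t.2.+1%:R).
  by rewrite ler_pM ?powR_ge0 ?expR_ge0.
have y0 : 0 <= y by exact: expR_ge0.
have g0 : 0 <= kappa t'.1 t.1 * expR (a * t.2.+1%:R).
  by rewrite mulr_ge0 ?kappa_ge0 ?expR_ge0.
have h2 : r `^ (- (alpha * s)) * expR (s * t.2.+1%:R) * (nat_of_bool (beta k < t.2%:R))%:R <=
    y * (kappa t'.1 t.1 * expR (a * t.2.+1%:R)).
  case: ltP => [bn|_]; last by rewrite mulr0 mulr_ge0.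
  rewrite mulr1 mulrCA; apply: ler_pM; rewrite ?powR_ge0 ?expR_ge0//.
  rewrite -expRD ler_expR -subr_ge0.
  rewrite (_ : _ - _ = sigma * (t.2.+1%:R - beta k)); last by rewrite /sigma; ring.
  by rewrite mulr_ge0 ?sigma_ge0// subr_ge0 -natr1; lra.
have h3 : r `^ (- (alpha * s)) * expR (s * t.2.+1%:R) * (nat_of_bool (max_step k < r))%:R <=
    y * (kappa t'.1 t.1 * expR (a * t.2.+1%:R)).
  case: ltP => [br|_]; last by rewrite mulr0 mulr_ge0.
  rewrite mulr1 mulrA; apply: ler_pM; rewrite ?powR_ge0 ?expR_ge0// kE.
  have as0 : alpha * s - A != 0 by rewrite gt_eqF// subr_gt0.
  have -> : y = max_step k `^ (- (alpha * s - A)).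
    by rewrite /max_step -expRM; congr expR; field.
  have -> : - (alpha * s) = - (alpha * s - A) + - A by ring.
  rewrite powRD; last by rewrite (gt_eqF (lt_le_trans _ r1))// implybT.
  by rewrite ler_wpM2r ?powR_ge0// ler_powRN ?expR_gt0 ?ltW// subr_gt0.
have h4 : r `^ (- (alpha * s)) * expR (s * t.2.+1%:R) * y <=
    y * (kappa t'.1 t.1 * expR (a * t.2.+1%:R)).
  by rewrite mulrC ler_wpM2l.
rewrite !mulrDr.
set u := y * _ in h2 h3 h4; rewrite (_ : 3 * _ = u + u + u); last by rewrite /u; ring.
by rewrite !lerD.
Qed.

Definition final_const := 3 * expR (s * lamc) * C * M + M.

Lemma final_const_ge0 : 0 <= final_const.
Proof. by rewrite addr_ge0 ?mulr_ge0 ?expR_ge0 ?moment_ge0 ?lattice_const_ge0. Qed.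

Lemma sums_le_final_step k p : size p = k ->
  sums_le (fun t => final_prob (t :: p)) (final_const * expR (- (sigma * beta k)) * valid_prob p).
Proof.
move=> kp; set y := expR (- (sigma * beta k)).
have y0 : 0 <= y by exact: expR_ge0.
have [vp|vp] := boolP (valid p); last first.
  apply: (@sums_leW _ _ _ (fun=> 0) 0) => [t||l _].
  - by rewrite /final_prob (negbTE vp).
  - by rewrite /valid_prob (negbTE vp) mulr0.
  - by rewrite big1.
case: p kp vp => [|t' q] kp vp.
  rewrite {1}/valid_prob /= /path_prob big_nil !mulr1.
  have d0 (x : V) : 0 <= (if x == x0 then 1 else 0 : R) by case: ifP.
  have p0 n : 0 <= y * (pi n * expR (a * n.+1%:R)).
    by rewrite !mulr_ge0 ?level_prob_ge0 ?expR_ge0.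
  apply: sums_leW (sums_le_prod d0 p0 sums_le_delta (sums_le_scale y0 hM)) => [[x n]|].
  - rewrite /final_prob big_seq1 /= !mulr1.
    case: (x == x0) => /=; last by rewrite mul0r.
    rewrite mul1r; case: ifP => [bn|_]; last exact: p0.
    rewrite mulrCA ler_peMr ?level_prob_ge0// -[leLHS]expR0 -expRD ler_expR.
    rewrite -kp /= addrC subr_ge0; apply: ler_pM; rewrite ?sigma_ge0 ?beta0//.
      by rewrite /sigma gerBl ltW.
    by rewrite ltW// (lt_trans bn)// ltr_nat.
  - rewrite mul1r mulrC ler_wpM2r// /final_const lerDr.
    by rewrite !mulr_ge0 ?expR_ge0 ?moment_ge0 ?lattice_const_ge0.
have vE : valid_prob (t' :: q) = path_prob (t' :: q) * expR (s * t'.2.+1%:R).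
  by rewrite /valid_prob vp.
have p0 n : 0 <= pi n * expR (a * n.+1%:R).
  by rewrite mulr_ge0 ?level_prob_ge0 ?expR_ge0.
have S0 : 0 <= 3 * y * expR (s * lamc) * valid_prob (t' :: q).
  by rewrite !mulr_ge0 ?expR_ge0 ?valid_prob_ge0.
apply: sums_leW (sums_le_scale S0 (sums_le_prod (kappa_ge0 t'.1) p0 (hC t'.1) hM)) => [[x n]|].
- have r0 : 0 <= 3 * y * expR (s * lamc) * valid_prob (t' :: q) *
      (kappa t'.1 x * (pi n * expR (a * n.+1%:R))).
    by apply: mulr_ge0 S0 _; apply: mulr_ge0 (kappa_ge0 _ _) (p0 n).
  rewrite /final_prob vp [_.1]/=; case: eqVneq => [t'x|t'x] /=; first exact: r0.
  rewrite path_prob_cons.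
  have eb := edge_bound_final (t := (x, n)) k t'x; rewrite /= -/y in eb.
  have c0 : 0 <= pi n * path_prob (t' :: q).
    by apply: mulr_ge0 (path_prob_ge0 _); exact: level_prob_ge0.
  apply: (le_trans _ (le_trans (ler_wpM2l c0 eb) _)).
  + rewrite -kp /= le_eqVlt; apply/orP; left; apply/eqP; ring.
  + rewrite vE le_eqVlt; apply/orP; left; apply/eqP; rewrite -/(kappa t'.1 x); ring.
- apply: (@le_trans _ _ ((3 * expR (s * lamc) * C * M) * y * valid_prob (t' :: q))).
    rewrite le_eqVlt; apply/orP; left; apply/eqP; ring.
  rewrite ler_wpM2r ?valid_prob_ge0// ler_wpM2r//.
  by rewrite /final_const lerDl moment_ge0.
Qed.

Definition bad_path (p : seq T) : set O :=
  if p is t :: q then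
    if valid q && uniq (map fst p) then
      if q is t' :: _ then
        path_event p `&`
          (if (beta (size q) < t.2%:R) || (max_step (size q) < edist R t'.1 t.1) then setT
           else Le t'.1 t.1 @^-1` `]-oo, min_length (size q)[)
      else if (t.1 == x0) && (beta 0 < t.2%:R) then path_event p else set0
    else set0
  else set0.

Lemma measurable_bad_path p : measurable (bad_path p).
Proof.
case: p => [|t [|t' q]]; rewrite /bad_path; first exact: measurable0.
  by case: (_ && _) => //; case: (_ && _) => //; exact: measurable_path_event.
case: (_ && _) => //.
apply: measurableI; first exact: measurable_path_event.
by case: ifP => // _; exact: measurable_funPTI.
Qed.

Lemma bad_path_prob p : (P (bad_path p) <= (final_prob p)%:E)%E.
Proof.
case: p => [|t q]; first by rewrite /bad_path measure0.
rewrite /bad_path /final_prob.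
case: ifP => [/andP[vq uq]|_]; last first.
  by rewrite measure0 lee_fin; exact: (final_prob_ge0 (t :: q)).
rewrite vq; case: q vq uq => [|t' q] vq uq.
  by case: ifP => _; [exact: path_event_prob|rewrite measure0].
have tt' : t'.1 != t.1.
  by move: uq => /= /andP[]; rewrite in_cons negb_or eq_sym => /andP[].
rewrite tt' EFinM.
have E0 := path_event_prob uq; have p0 := path_prob_ge0 (t :: t' :: q).
case: ifP => [h|_].
  rewrite setIT; apply: (le_trans E0); rewrite -EFinM lee_fin ler_peMr//.
  rewrite /final_weight; have := expR_ge0 (- (sigma * beta (size (t' :: q)))).
  move=> e0; case/orP: h => ->; first by rewrite -addrA lerDl addr_ge0.
  by rewrite -addrA addrCA lerDl addr_ge0.
rewrite (edges_length_prob H)//; last exact: measurable_level.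
apply: lee_pmul => //.
apply: (@le_trans _ _ (expR (- (sigma * beta (size (t' :: q)))))%:E).
  apply: (distribution_lt_quantile L0); exact: expR_gt0.
by rewrite lee_fin lerDr addr_ge0.
Qed.

Lemma bad_path_cons t t' q w : valid (t' :: q) -> uniq (map fst (t :: t' :: q)) ->
  path_event (t :: t' :: q) w ->
  ((beta (size q).+1 < t.2%:R) || (max_step (size q).+1 < edist R t'.1 t.1)) \/
    Le t'.1 t.1 w < min_length (size q).+1 ->
  bad_path (t :: t' :: q) w.
Proof.
move=> vq uq pe h; rewrite /bad_path vq uq; split => //.
by case: h => h; [rewrite h|case: ifP => // _; rewrite /= in_itv].
Qed.

(* Step k is the first one to leave the prescribed range: it reaches too heavy a
   vertex, is too long, or is too cheap. *)
Definition bad k : set O :=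
  \bigcup_(p : seq T) (if size p == k.+1 then bad_path p else set0).

Lemma measurable_bad k : measurable (bad k).
Proof.
apply: countable_bigcupT_measurable => // p.
by case: ifP => // _; exact: measurable_bad_path.
Qed.

Lemma bad_prob k : (P (bad k) <=
  (final_const * expR (- (sigma * beta k)) * (growth_const ^+ k * expR (rho * \sum_(i < k) beta i)))%:E)%E.
Proof.
have y0 : 0 <= final_const * expR (- (sigma * beta k)) by rewrite mulr_ge0 ?final_const_ge0 ?expR_ge0.
have S := sums_le_seq final_prob_ge0 y0 (@sums_le_final_step k) (@sums_le_valid k).
apply: union_bound S => p.
  by case: ifP => // _; exact: measurable_bad_path.
by case: ifP => _; [exact: bad_path_prob|rewrite measure0].
Qed.

Definition typed (w : O) (l : seq V) : seq T :=
  [seq (x, Num.truncn (ln (Wv x w))) | x <- l].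

Lemma level_truncn (u : R) : 1 <= u -> level (Num.truncn (ln u)) u.
Proof.
move=> u1; have u0 : u \is Num.pos by rewrite posrE; lra.
have /andP[h1 h2] := truncn_itv (ln_ge0 u1).
by rewrite /level /= in_itv/= -{2 3}(lnK u0) ler_expR ltr_expR h1.
Qed.

Lemma map_fst_typed w l : map fst (typed w l) = l.
Proof. by rewrite /typed -map_comp map_id. Qed.

Lemma path_event_typed w p x : (forall y, 1 <= Wv y w) -> path (adj w) x p ->
  path_event (typed w (rev (x :: p))) w.
Proof.
move=> w1 pp; split.
  apply/weights_inE => t; elim: (rev _) => //= y l IH [<-|//] /=.
  exact: level_truncn.
rewrite map_fst_typed; elim/last_ind: p pp => [|p z IH]; first by rewrite /all_edges big_nil.
rewrite rcons_path => /andP[pp lz].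
rewrite -rcons_cons rev_rcons; have := IH pp.
rewrite lastI rev_rcons /all_edges => h.
by rewrite [path_edges _]/= big_cons; split.
Qed.

Lemma good_path_valid w p : (forall y, 1 <= Wv y w) -> (forall k, ~ bad k w) ->
  path (adj w) x0 p -> uniq (x0 :: p) ->
  valid (typed w (rev (x0 :: p))) /\
  (forall p' z, p = rcons p' z ->
    edist R (last x0 p') z <= max_step (size p) /\
    min_length (size p) <= Le (last x0 p') z w).
Proof.
move=> w1 wb; elim/last_ind: p => [|p z IH] pp up.
  split; last by case.
  have pe := path_event_typed w1 pp.
  rewrite /= eqxx/= andbT leNgt; apply/negP => h; apply: (wb 0%N).
  by exists (typed w (rev [:: x0])) => //=; rewrite eqxx h.
have pe := path_event_typed w1 pp.
move: pp up; rewrite rcons_path -rcons_cons rcons_uniq => /andP[pp lz] /andP[zp up].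
have [vp _] := IH pp up.
have tE : typed w (rev (rcons (x0 :: p) z)) =
    (z, Num.truncn (ln (Wv z w))) :: typed w (rev (x0 :: p)) by rewrite rev_rcons.
have sE : size (typed w (rev (x0 :: p))) = (size p).+1 by rewrite size_map size_rev.
rewrite -rcons_cons tE in pe.
have lE : typed w (rev (x0 :: p)) = (last x0 p, Num.truncn (ln (Wv (last x0 p) w))) ::
    typed w (rev (belast x0 p)) by rewrite lastI rev_rcons.
have zl : last x0 p != z by apply: contraNneq zp => <-; exact: mem_last.
have nb : ~ ((beta (size p).+1 < (Num.truncn (ln (Wv z w)))%:R) ||
    (max_step (size p).+1 < edist R (last x0 p) z)) /\
    ~ Le (last x0 p) z w < min_length (size p).+1.
  have u' : uniq (map fst ((z, Num.truncn (ln (Wv z w))) :: typed w (rev (x0 :: p)))).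
    by rewrite /= map_fst_typed rev_uniq up mem_rev zp.
  have badE : bad_path ((z, Num.truncn (ln (Wv z w))) :: typed w (rev (x0 :: p))) w ->
      False.
    move=> bp; apply: (wb (size p).+1).
    exists ((z, Num.truncn (ln (Wv z w))) :: typed w (rev (x0 :: p))) => //.
    by rewrite [size _]/= sE eqxx.
  have sE' : (size (typed w (rev (belast x0 p)))).+1 = (size p).+1.
    by rewrite size_map size_rev size_belast.
  split => h; apply: badE; rewrite lE; apply: bad_path_cons; rewrite -?lE// sE'.
    by left.
  by right.
case: nb => /negP; rewrite negb_or -!leNgt => /andP[n1 n2] /negP; rewrite -leNgt => n3.
split; last first.
  by move=> p' z' /rcons_inj[<- <-]; rewrite size_rcons.
rewrite tE [valid _]/= -/(valid _) sE n1 vp !andbT.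
by rewrite lE.
Qed.

Lemma path_length_rcons w x p z :
  path_length Le w x (rcons p z) = path_length Le w x p + Le (last x p) z w.
Proof. by rewrite /path_length -cats1 pairmap_cat big_cat /= big_seq1. Qed.

Lemma good_path_length w p : (forall y, 1 <= Wv y w) -> (forall k, ~ bad k w) ->
  path (adj w) x0 p -> uniq (x0 :: p) ->
  \sum_(1 <= k < (size p).+1) min_length k <= path_length Le w x0 p.
Proof.
move=> w1 wb; elim/last_ind: p => [|p z IH] pp up.
  by rewrite big_geq// /path_length big_nil.
have [_ /(_ _ _ erefl)[_ h]] := good_path_valid w1 wb pp up.
rewrite path_length_rcons size_rcons big_nat_recr //= lerD//; last first.
  by move: h; rewrite size_rcons.
by move: pp up; rewrite rcons_path -rcons_cons rcons_uniq => /andP[pp _] /andP[_]; exact: IH.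
Qed.

Lemma good_path_displacement w p i : (forall y, 1 <= Wv y w) -> (forall k, ~ bad k w) ->
  path (adj w) x0 p -> uniq (x0 :: p) ->
  `|last x0 p 0 i - x0 0 i|%:~R <= \sum_(1 <= k < (size p).+1) max_step k.
Proof.
move=> w1 wb; elim/last_ind: p => [|p z IH] pp up.
  by rewrite big_geq//= subrr normr0.
have [_ /(_ _ _ erefl)[h _]] := good_path_valid w1 wb pp up.
rewrite size_rcons big_nat_recr //= last_rcons.
move: pp up; rewrite rcons_path -rcons_cons rcons_uniq => /andP[pp _] /andP[_ up].
apply: le_trans (lerD (IH pp up) (_ : edist R (last x0 p) z <= _)); last first.
  by move: h; rewrite size_rcons.
apply: le_trans (lerD (lexx _) (edist_coord _ _ i)).
rewrite -intrD ler_int [leRHS]addrC [`|last x0 p 0 i - z 0 i|]distrC.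
exact: ler_distD.
Qed.

End LowerBound.

Section PathReversal.
Context (dO : measure_display) (O : measurableType dO) (R : realType).
Context (P : probability O R) (d : nat).
Context (Le : 'rV[int]_d -> 'rV[int]_d -> {RV P >-> R}).
Context (Lsym : forall x y, Le x y = Le y x).
Notation V := 'rV[int]_d.

Lemma path_length_cat w (x : V) p q :
  path_length Le w x (p ++ q) = path_length Le w x p + path_length Le w (last x p) q.
Proof. by rewrite /path_length pairmap_cat big_cat. Qed.

Lemma path_length_cons w (x y : V) p :
  path_length Le w x (y :: p) = Le x y w + path_length Le w y p.
Proof. by rewrite /path_length /= big_cons. Qed.

Lemma path_length_rev w (x : V) p :
  path_length Le w (last x p) (rev (belast x p)) = path_length Le w x p.
Proof.
elim: p x => [|y p IH] x; first by rewrite /path_length /= !big_nil.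
rewrite /= rev_cons path_length_rcons IH path_length_cons addrC Lsym.
case: p {IH} => [|z p] //=.
by rewrite rev_cons last_rcons.
Qed.

End PathReversal.

Section TwoSided.
Context (dO : measure_display) (O : measurableType dO) (R : realType).
Context (P : probability O R) (d : nat) (alpha lambda : R) (W L : {RV P >-> R}).
Context (Wv : 'rV[int]_d -> {RV P >-> R}) (adj : O -> rel 'rV[int]_d).
Context (Le : 'rV[int]_d -> 'rV[int]_d -> {RV P >-> R}).
Context (H : weighted_sfp alpha lambda W L Wv adj Le).
Context (L0 : P [set w | 0 <= L w] = 1%E).
Notation V := 'rV[int]_d.

Context (s a A C M lamc : R).
Context (l0 : 0 < lambda) (lam : lambda <= expR lamc) (lamc0 : 0 <= lamc).
Context (alpha0 : 0 < alpha) (s0 : 0 < s) (s1 : s <= 1) (sa : s < a) (a2s : a <= 2 * s).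
Context (A0 : 0 <= A) (As : A < alpha * s).
Context (hC : forall x0 : V,
  sums_le (fun x => if x == x0 then 0 else edist R x0 x `^ (- A)) C).
Context (hM : sums_le (fun n => level_prob W n * expR (a * n.+1%:R)) M).

Notation bad := (bad alpha L Wv adj Le s a A).
Notation min_length := (min_length L s a).
Notation max_step := (max_step alpha s a A).

Lemma two_sided_length (u v : V) (beta : nat -> R) w h i p :
  (forall k, 0 <= beta k) -> (forall y, 1 <= Wv y w) ->
  (forall k, ~ bad u beta k w) -> (forall k, ~ bad v beta k w) ->
  2 * \sum_(1 <= k < h.+1) max_step beta k < `|v 0 i - u 0 i|%:~R ->
  path (adj w) u p -> uniq (u :: p) -> last u p = v ->
  2 * \sum_(1 <= k < h.+1) min_length beta k <= path_length Le w u p.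
Proof.
move=> b0 w1 wu wv hi pp up lp.
have adj_sym := sfp_adj_sym H w.
pose p1 := take (size p - h) p; pose p2 := drop (size p - h) p.
have pE : p = p1 ++ p2 by rewrite cat_take_drop.
have s1E : size p1 = (size p - h)%N by rewrite size_takel// leq_subr.
have s2E : (size p2 <= h)%N by rewrite size_drop leq_subLR addnC -leq_subLR.
pose y := last u p1; pose r := rev (belast y p2).
have yv : last y p2 = v by rewrite -lp pE last_cat.
move: pp up; rewrite pE cat_path => /andP[pp1 pp2] up.
have up1 : uniq (u :: p1) by move: up; rewrite -cat_cons cat_uniq => /andP[].
have up2 : uniq (y :: p2).
  move: up; rewrite -cat_cons cat_uniq => /and3P[_ h1 h2] /=; rewrite h2 andbT.
  apply: contra h1 => yp2; apply/hasP; exists y => //; exact: mem_last.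
have pr : path (adj w) v r.
  by rewrite -yv rev_path; apply: sub_path pp2 => a' b' /=; rewrite adj_sym.
have ur : uniq (v :: r).
  by rewrite -yv /r -rev_rcons -lastI rev_uniq.
have lr : last v r = y.
  by rewrite /r; case: (p2) yv => [<-|z p2' /=] //; rewrite rev_cons last_rcons.
have sr : size r = size p2 by rewrite /r size_rev size_belast.
have ms0 k : 0 <= max_step beta k by exact: expR_ge0.
have ml0 k : 0 <= min_length beta k by exact/quantile_ge0/expR_gt0.
have mono (F : nat -> R) m n : (forall k, 0 <= F k) -> (m <= n)%N ->
    \sum_(1 <= k < m.+1) F k <= \sum_(1 <= k < n.+1) F k.
  move=> F0 mn; rewrite [leRHS](big_cat_nat _ (n := m.+1))//= lerDl.
  exact: sumr_ge0.
have D1 := good_path_displacement i w1 wu pp1 up1.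
have D2 := good_path_displacement i w1 wv pr ur.
have hp : (h <= size p1)%N /\ size p2 = h.
  have [ph|ph] := leqP (h + h) (size p).
    by rewrite s1E size_drop leq_subRL ?(leq_trans (leq_addl _ _) ph)// subKn// (leq_trans (leq_addl _ _) ph).
  exfalso; move: hi; rewrite ltNge => /negP; apply.
  have s1h : (size p1 <= h)%N by rewrite s1E leq_subLR ltnW.
  rewrite mulrDl !mul1r.
  apply: le_trans (lerD (le_trans D2 (mono _ _ _ ms0 _)) (le_trans D1 (mono _ _ _ ms0 _))) => //.
    by rewrite -intrD ler_int lr -/y [`|y 0 i - v 0 i|]distrC; exact: ler_distD.
  by rewrite sr.
have E1 := good_path_length w1 wu pp1 up1.
have E2 := good_path_length w1 wv pr ur.
rewrite path_length_cat -/y -(path_length_rev (sfp_length_sym H) w y p2) yv -/r.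
rewrite mulrDl !mul1r; apply: lerD; last first.
  by apply: le_trans E2; rewrite sr hp.2.
by apply: le_trans E1; apply: mono ml0 hp.1.
Qed.

Lemma expR_decay (c k eps : R) : 0 < c -> 0 <= k -> 0 < eps ->
  exists2 b0, 0 <= b0 & forall b, b0 <= b -> k * expR (- (c * b)) <= eps.
Proof.
move=> c0 k0 e0; exists (k / (eps * c)) => [|b kb].
  by rewrite divr_ge0// mulr_ge0 ?ltW.
rewrite expRN ler_pdivrMr ?expR_gt0//; apply: (@le_trans _ _ (eps * (c * b))).
  by move: kb; rewrite ler_pdivrMr ?mulr_gt0// => /le_trans; apply; rewrite mulrC mulrA.
by rewrite ler_wpM2l ?(ltW e0)//; apply: le_trans (expR_ge1Dx _); rewrite lerDr.
Qed.

Lemma bernoulli (th : R) k : 1 <= th -> 1 + k%:R * (th - 1) <= th ^+ k.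
Proof.
move=> th1; elim: k => [|k IH]; first by rewrite mul0r addr0 expr0.
rewrite exprS; apply: (@le_trans _ _ (th * (1 + k%:R * (th - 1)))); last first.
  by rewrite ler_wpM2l//; lra.
rewrite -subr_ge0 -natr1.
rewrite (_ : _ - _ = k%:R * (th - 1) ^+ 2); last by ring.
by rewrite mulr_ge0 ?sqr_ge0.
Qed.

Lemma bad_union_prob (th zeta delta : R) : 1 < th -> 0 < zeta -> 0 < delta ->
  rho s a <= (sigma s a - zeta) * (th - 1) ->
  exists2 b0, 0 <= b0 & forall b, b0 <= b -> forall x0 : V,
    (P (\bigcup_k (bad x0 (fun k => b * th ^+ k)%R k)) <= delta%:E)%E.
Proof.
move=> th1 z0 de0 hz.
have th0 : 0 < th - 1 by rewrite subr_gt0.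
pose D := final_const s C M lamc; pose K := growth_const s a C M lamc.
have D0 : 0 <= D by exact: final_const_ge0 hC hM.
have K0 : 0 <= K by exact: growth_const_ge0 hC hM.
have half0 : 0 < 2^-1 :> R by rewrite invr_gt0.
have d2 : 0 < delta / 2 by rewrite divr_gt0.
have [b1 b10 Hb1] := expR_decay (mulr_gt0 z0 th0) K0 half0.
have [b2 b20 Hb2] := expR_decay z0 D0 d2.
exists (b1 + b2) => [|b bb x0]; first exact: addr_ge0.
have b0 : 0 <= b by lra.
pose q := K * expR (- (zeta * (th - 1) * b)).
have q2 : q <= 2^-1 by apply: Hb1; lra.
have q01 : 0 <= q < 1 by rewrite mulr_ge0 ?expR_ge0//=; lra.
have Dd : D * expR (- (zeta * b)) <= delta / 2 by apply: Hb2; lra.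
have D1 : 0 <= D * expR (- (zeta * b)) by rewrite mulr_ge0 ?expR_ge0.
have S := sums_le_scale D1 (sums_le_geometric q01).
apply: (@le_trans _ _ (D * expR (- (zeta * b)) / (1 - q))%:E); last first.
  rewrite lee_fin ler_pdivrMr; last by lra.
  apply: (le_trans Dd); rewrite ler_wpM2l ?(ltW de0)//; lra.
have bk0 k : 0 <= b * th ^+ k by rewrite mulr_ge0// exprn_ge0//; lra.
apply: union_bound S => k; first exact: measurable_bad H _ _ _ _ _ _.
apply: (le_trans (bad_prob H L0 l0 lam lamc0 s0 s1 sa a2s As hC hM x0 bk0 k)).
rewrite lee_fin -/D -/K -!mulrA ler_wpM2l// /q exprMn mulrCA [leRHS]mulrCA ler_wpM2l ?exprn_ge0//.
rewrite -expRM_natr -!expRD ler_expR -mulr_sumr.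
have sumE : (th - 1) * \sum_(i < k) th ^+ i = th ^+ k - 1 by rewrite subrX1.
set S0 := \sum_(i < k) _ in sumE *.
have S00 : 0 <= S0 by apply: sumr_ge0 => i _; rewrite exprn_ge0//; lra.
have h1 : rho s a * (b * S0) <= (sigma s a - zeta) * b * (th ^+ k - 1).
  rewrite -sumE (_ : _ * _ * _ = ((sigma s a - zeta) * (th - 1)) * (b * S0)); last by ring.
  by rewrite ler_wpM2r// mulr_ge0.
have sz : 0 <= sigma s a - zeta.
  rewrite -(pmulr_lge0 _ th0); by apply: le_trans hz; rewrite /rho subr_ge0.
have h2 : (sigma s a - zeta) * b * (th ^+ k - 1) <= (sigma s a - zeta) * b * th ^+ k.
  by rewrite ler_wpM2l ?mulr_ge0//; lra.
have h3 := ler_wpM2l (mulr_ge0 (ltW z0) b0) (bernoulli k (ltW th1)).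
apply: (le_trans (lerD (lexx _) (le_trans h1 h2))).
rewrite -subr_ge0 in h3; rewrite -subr_ge0; apply: (le_trans h3).
by rewrite le_eqVlt; apply/orP; left; apply/eqP; ring.
Qed.

End TwoSided.

(** * The norming sequence *)

Section Norming.
Context (dO : measure_display) (O : measurableType dO) (R : realType).
Context (P : probability O R) (L : {RV P >-> R}) (gamma : R).
Context (L0 : P [set w | 0 <= L w] = 1%E) (hL : explosion_integral L = +oo%E).
Context (g1 : 1 < gamma) (g2 : gamma < 2).
Notation Q := (dexp_quantile L).
Notation I := (primitive Q).

Definition growth_rate : R := - ln (gamma - 1).
Notation eta := growth_rate.

Let Q0 t : 0 <= Q t := dexp_quantile_ge0 L0 t.
Let Qn t t' : t <= t' -> Q t' <= Q t := @dexp_quantile_noninc _ _ _ _ _ L0 t t'.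

Lemma growth_rate_gt0 : 0 < eta.
Proof. by rewrite oppr_gt0 ln_lt0// subr_gt0 g1/= ltrBlDr. Qed.

Lemma normingE m : norming L gamma m =
  2 * \sum_(1 <= k < (Num.truncn (ln (ln m) / eta)).+1) Q (k%:R * eta).
Proof.
rewrite /norming ler0_norm; last by rewrite -oppr_ge0 ltW// growth_rate_gt0.
rewrite mulr_sumr; apply: eq_bigr => k _; congr (_ * quantile _ (expR (- _))).
rewrite /growth_rate mulrN expRN expRM_natl lnK ?posrE ?subr_gt0//.
by rewrite div1r.
Qed.

Lemma primitive_ge0 t : 0 <= I t.
Proof. by rewrite fine_ge0// integral_ge0// => y _; rewrite lee_fin. Qed.

Lemma primitive_nondec x y : 0 <= x -> x <= y -> I x <= I y.
Proof.
move=> a0 ab; have /andP[h _] := primitive_bounds Q0 Qn a0 ab.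
by rewrite -subr_ge0; apply: le_trans h; rewrite mulr_ge0// subr_ge0.
Qed.

Lemma primitive_sum_ge c h n : 0 <= c -> 0 <= h ->
  I (c + n.+1%:R * h) - I (c + h) <= h * \sum_(1 <= k < n.+1) Q (c + k%:R * h).
Proof.
move=> c0 h0; elim: n => [|n IH]; first by rewrite big_geq// mul1r mulr0 subrr.
rewrite big_nat_recr//= mulrDr.
have b0 : 0 <= c + n.+1%:R * h by rewrite addr_ge0// mulr_ge0.
have bb : c + n.+1%:R * h <= c + n.+2%:R * h by rewrite lerD2l ler_wpM2r// ler_nat.
have /andP[_ u] := primitive_bounds Q0 Qn b0 bb.
have E : c + n.+2%:R * h - (c + n.+1%:R * h) = h.
  by rewrite -[n.+2%:R]natr1; ring.
rewrite E in u.
by have := lerD IH u; apply: le_trans; rewrite le_eqVlt; apply/orP; left; apply/eqP; ring.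
Qed.

Lemma primitive_sum_le h n : 0 <= h ->
  h * \sum_(1 <= k < n.+1) Q (k%:R * h) <= I (n%:R * h).
Proof.
move=> h0; elim: n => [|n IH]; first by rewrite big_geq// mulr0 primitive_ge0.
rewrite big_nat_recr//= mulrDr.
have b0 : 0 <= n%:R * h by rewrite mulr_ge0.
have bb : n%:R * h <= n.+1%:R * h by rewrite ler_wpM2r// ler_nat.
have /andP[u _] := primitive_bounds Q0 Qn b0 bb.
have E : n.+1%:R * h - n%:R * h = h by rewrite -[n.+1%:R]natr1; ring.
rewrite E in u.
by have := lerD IH u; move=> /le_trans; apply; rewrite addrC subrK.
Qed.

Lemma norming_le m : 0 <= ln (ln m) -> norming L gamma m <= 2 / eta * I (ln (ln m)).
Proof.
move=> T0; have e0 := growth_rate_gt0; set T := ln (ln m) in T0 *.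
rewrite normingE -/T -mulrA ler_wpM2l// [leRHS]mulrC ler_pdivlMr// mulrC.
have q0 : 0 <= T / eta by rewrite divr_ge0// ltW.
have /andP[h1 h2] := truncn_itv q0.
apply: (le_trans (primitive_sum_le _ (ltW e0))).
apply: primitive_nondec; first by rewrite mulr_ge0// ltW.
by rewrite -ler_pdivlMr.
Qed.

Lemma norming_ge m : 0 <= ln (ln m) ->
  2 / eta * (I (ln (ln m)) - I eta) <= norming L gamma m.
Proof.
move=> T0; have e0 := growth_rate_gt0; set T := ln (ln m) in T0 *.
rewrite normingE -/T -mulrA ler_wpM2l// mulrC ler_pdivrMr// mulrC.
have q0 : 0 <= T / eta by rewrite divr_ge0// ltW.
have /andP[h1 h2] := truncn_itv q0.
have := primitive_sum_ge (Num.truncn (T / eta)) (lexx 0) (ltW e0).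
rewrite !add0r; under [X in _ <= _ * X -> _]eq_bigr do rewrite add0r.
apply: le_trans; rewrite lerD2r primitive_nondec//.
by rewrite -ler_pdivrMr// ltW.
Qed.

Lemma primitive_large M : exists2 T0, 0 <= T0 & forall T, T0 <= T -> M <= I T.
Proof. exact: (primitive_unbounded Q0 Qn hL). Qed.

Lemma norming_gt0 : exists2 T0, 0 <= T0 &
  forall m, T0 <= ln (ln m) -> 0 < norming L gamma m.
Proof.
have [T0 T00 HT] := primitive_large (I eta + 1).
exists T0 => // m mT; apply: lt_le_trans (norming_ge (le_trans T00 mT)).
rewrite mulr_gt0// ?divr_gt0 ?growth_rate_gt0//.
by have := HT _ mT; lra.
Qed.

Lemma shifted_sum_ge eps eta' c C : 0 < eta' -> (1 - eps) * eta' < eta ->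
  0 <= c -> 0 <= C ->
  exists2 T0, 0 <= T0 & forall m, T0 <= ln (ln m) ->
    (1 - eps) * norming L gamma m <=
    2 * \sum_(1 <= k < (Num.truncn ((ln (ln m) - C) / eta')).+1) Q (c + k%:R * eta').
Proof.
move=> e'0 ee' c0 C0; have e0 := growth_rate_gt0.
have [eps1|eps1] := leP 1 eps.
  exists 0 => // m m0; apply: (@le_trans _ _ 0).
    rewrite mulr_le0_ge0//; first by lra.
    by rewrite normingE mulr_ge0// sumr_ge0.
  by rewrite mulr_ge0// sumr_ge0.
pose co := eta'^-1 - (1 - eps) / eta.
have co0 : 0 < co.
  by rewrite subr_gt0 ltr_pdivrMr// mulrC ltr_pdivlMr// .
pose C5 := C * Q 0 + I (c + eta').
have [T0 T00 HT] := primitive_large (C5 / eta' / co).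
exists (T0 + C) => [|m mT]; first exact: addr_ge0.
set T := ln (ln m) in mT *.
have TC : 0 <= T - C by lra.
have T0' : 0 <= T by lra.
set h := Num.truncn _.
have /andP[h1 h2] := truncn_itv (divr_ge0 TC (ltW e'0)).
have S1 := primitive_sum_ge h c0 (ltW e'0).
have S2 : I (T - C) <= I (c + h.+1%:R * eta').
  apply: primitive_nondec => //; apply: (@le_trans _ _ (h.+1%:R * eta')).
    by rewrite -ler_pdivrMr// ltW.
  by rewrite lerDr.
have S3 : I T - I (T - C) <= C * Q 0.
  have TT : T - C <= T by lra.
  have /andP[_ u] := primitive_bounds Q0 Qn TC TT.
  rewrite (_ : T - (T - C) = C) in u; last by ring.
  exact: le_trans u (ler_wpM2l C0 (Qn TC)).
have S4 := HT T (_ : T0 <= T).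
have {S4} : C5 / eta' <= I T * co by rewrite -ler_pdivrMr// S4//; lra.
rewrite /co mulrBr => S4.
have S5 : (1 - eps) * norming L gamma m <= 2 * (I T * ((1 - eps) / eta)).
  apply: (@le_trans _ _ ((1 - eps) * (2 / eta * I T))).
    by rewrite ler_wpM2l ?norming_le//; lra.
  by rewrite le_eqVlt; apply/orP; left; apply/eqP; ring.
apply: (le_trans S5); rewrite ler_wpM2l//.
rewrite -(ler_pM2l e'0); apply: le_trans S1.
have : I T * ((1 - eps) / eta) <= I T / eta' - C5 / eta' by lra.
rewrite -(ler_pM2l e'0) -mulrBl => /le_trans; apply.
rewrite mulrCA divff ?gt_eqF// mulr1 /C5; lra.
Qed.

Lemma truncated_sum_le eps eta' C : 0 < eta' -> eta < (1 + eps) * eta' ->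
  exists2 T0, 0 <= T0 & forall m, T0 <= ln (ln m) ->
    forall n : nat, n%:R * eta' <= ln (ln m) ->
    2 * \sum_(1 <= k < n.+1) Q (k%:R * eta') + C <= (1 + eps) * norming L gamma m.
Proof.
move=> e'0 ee'; have e0 := growth_rate_gt0.
have eps0 : 0 < 1 + eps by rewrite -(pmulr_lgt0 _ e'0); exact: lt_trans ee'.
pose co := (1 + eps) / eta - eta'^-1.
have co0 : 0 < co.
  by rewrite subr_gt0 ltr_pdivlMr// mulrC ltr_pdivrMr.
pose C5 := C / 2 + (1 + eps) / eta * I eta.
have [T0 T00 HT] := primitive_large (C5 / co).
exists T0 => // m mT n nT; set T := ln (ln m) in mT nT *.
have T0' : 0 <= T by lra.
have S1 : 2 * \sum_(1 <= k < n.+1) Q (k%:R * eta') <= 2 * (I T / eta').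
  rewrite ler_wpM2l// ler_pdivlMr// mulrC.
  apply: (le_trans (primitive_sum_le _ (ltW e'0))).
  by apply: primitive_nondec => //; rewrite mulr_ge0// ltW.
have S2 := ler_wpM2l (ltW eps0) (norming_ge T0').
have := HT T mT; rewrite ler_pdivrMr// /co mulrBr => S4.
apply: (le_trans (lerD S1 (lexx _))); apply: le_trans S2.
rewrite -/T; have -> : (1 + eps) * (2 / eta * (I T - I eta)) =
  2 * (I T * ((1 + eps) / eta)) - 2 * ((1 + eps) / eta * I eta) by ring.
rewrite /C5 in S4; lra.
Qed.

End Norming.

Section FloorVec.
Context {R : realType} {d : nat}.

Lemma enorm1_coord (e : 'rV[R]_d) : enorm e = 1 -> exists i, (2 * d%:R)^-1 <= `|e 0 i|.
Proof.
move=> e1; apply: contrapT => /forallNP h.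
have := @enorm_le R d e (2 * d%:R)^-1; rewrite e1 => /(_ _ _) H.
have : 1 <= d%:R * (2 * d%:R)^-1 :> R.
  apply: H; first by rewrite invr_ge0 mulr_ge0.
  by move=> i; rewrite leNgt; apply/negP => /ltW; exact: h.
have [->|d0] := eqVneq d 0%N; first by rewrite mul0r ler10.
by rewrite invfM mulrCA divff ?pnatr_eq0// mulr1; lra.
Qed.

Lemma floor_vec_coord_ge (m : R) (e : 'rV[R]_d) i : 0 <= m -> (2 * d%:R)^-1 <= `|e 0 i| ->
  m / (2 * d%:R) - 1 <= `|floor_vec (m *: e) 0 i|%:~R.
Proof.
move=> m0 ei; rewrite !mxE intr_norm.
have /andP[h1 h2] := floor_itv (m * e 0 i).
have h3 : m / (2 * d%:R) <= `|m * e 0 i| by rewrite normrM ger0_norm// ler_wpM2l.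
have h4 : `|m * e 0 i| <= `|(Num.floor (m * e 0 i))%:~R| + 1.
  set y := m * e 0 i in h1 h2 *; set f := (Num.floor y)%:~R in h1 h2 *.
  have := ler_normD f (y - f); rewrite addrC subrK => /le_trans; apply.
  by rewrite lerD2l ger0_norm ?subr_ge0//; move: h2; rewrite intrD; lra.
by lra.
Qed.

Lemma floor_vec_coord_le (m : R) (e : 'rV[R]_d) i : 0 <= m -> enorm e = 1 ->
  `|floor_vec (m *: e) 0 i|%:~R <= m + 1.
Proof.
move=> m0 e1; rewrite !mxE intr_norm.
have /andP[h1 h2] := floor_itv (m * e 0 i).
have h3 : `|m * e 0 i| <= m.
  by rewrite normrM ger0_norm// ler_piMr// -e1; exact: enorm_coord.
move: h2; rewrite intrD => h2; move: h3; rewrite ler_norml => /andP[h3 h4].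
by rewrite ler_norml; apply/andP; split; lra.
Qed.

End FloorVec.

Lemma midpoint_exists {R : realType} (x y : R) : x < y -> exists2 z, x < z & z < y.
Proof. by move=> xy; exists ((x + y) / 2); lra. Qed.

Section LowerTheorem.
Context (dO : measure_display) (O : measurableType dO) (R : realType).
Context (P : probability O R) (d : nat) (alpha lambda tau gamma : R) (ell : R -> R).
Context (W L : {RV P >-> R}).
Context (Wv : 'rV[int]_d -> {RV P >-> R}) (adj : O -> rel 'rV[int]_d).
Context (Le : 'rV[int]_d -> 'rV[int]_d -> {RV P >-> R}) (e : 'rV[R]_d).
Context (hd : (1 <= d)%N) (halpha : d%:R < alpha) (hlambda : 0 < lambda).
Context (hW1 : P [set w | 1 <= W w] = 1%E) (htau : 1 < tau).
Context (hell : slowly_varying ell).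
Context (hWtail : forall t : R, 0 < t ->
  P [set w | t < W w] = (ell t / t `^ (tau - 1))%:E).
Context (hgamma : gamma = alpha * (tau - 1) / d%:R).
Context (g1 : 1 < gamma) (g2 : gamma < 2).
Context (hL0 : P [set w | 0 <= L w] = 1%E) (hL : explosion_integral L = +oo%E).
Context (hSFP : weighted_sfp alpha lambda W L Wv adj Le) (he : enorm e = 1).
Notation V := 'rV[int]_d.
Notation eta := (growth_rate gamma).

Lemma tau_gamma : tau - 1 = gamma * (d%:R / alpha).
Proof.
have d0 : 0 < d%:R :> R by rewrite ltr0n.
rewrite hgamma; field; rewrite !gt_eqF//; exact: lt_trans halpha.
Qed.

Lemma dim_ratio : 0 < d%:R / alpha < 1.
Proof.
have d0 : 0 < d%:R :> R by rewrite ltr0n.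
have a0 : 0 < alpha by exact: lt_trans halpha.
by rewrite divr_gt0// ltr_pdivrMr// mul1r.
Qed.

(* In the limit th = 1 / (gamma - 1) the exponents are s = d / alpha and
   a = tau - 1, for which (2 s - a) / (a - s) = (2 - gamma) / (gamma - 1) = th - 1. *)
Lemma lower_exponents (th : R) : (gamma - 1)^-1 < th -> exists s a zeta,
  [/\ d%:R < alpha * s, 0 < s, s < 1, s < a & a < tau - 1] /\
  [/\ a <= 2 * s, 0 < zeta & rho s a <= (sigma s a - zeta) * (th - 1)].
Proof.
have := g1; have := g2 => g2' g1' hth; have /andP[] := dim_ratio; set r := _ / _ => r0 r1.
have th0 : 0 < th by apply: lt_trans hth; rewrite invr_gt0; lra.
have th1 : 1 < th by apply: lt_trans hth; rewrite invf_gt1; lra.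
have thV : th^-1 < gamma - 1.
  by rewrite -[ltRHS]invrK ltf_pV2// posrE invr_gt0; lra.
have [a ra at'] : exists2 a, r * (1 + th^-1) < a & a < tau - 1.
  by apply: midpoint_exists; rewrite tau_gamma -/r [ltRHS]mulrC ltr_pM2l//; lra.
have tV0 : 0 < th^-1 by rewrite invr_gt0.
have c0 : 0 < 1 + th^-1 by lra.
have [s rs sm] : exists2 s, r < s & s < Num.min 1 (a / (1 + th^-1)).
  by apply: midpoint_exists; rewrite lt_min r1 ltr_pdivlMr.
move: sm; rewrite lt_min ltr_pdivlMr// => /andP[s1 sa].
have s0 : 0 < s by lra.
have a0 : 0 < alpha by apply: lt_trans halpha; rewrite ltr0n.
have sa' : s < a by apply: le_lt_trans sa; rewrite ler_peMr ?ltW//; lra.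
have thm : 0 < th - 1 by lra.
exists s, a, (sigma s a - rho s a / (th - 1)); split; split => //.
- by move: rs; rewrite /r ltr_pdivrMr// mulrC.
- have tg : tau - 1 <= 2 * s.
    rewrite tau_gamma -/r; apply: (@le_trans _ _ (2 * r)).
      by rewrite ler_wpM2r ?ltW.
    by rewrite ler_wpM2l// ltW.
  by apply/ltW; apply: lt_le_trans at' tg.
- rewrite subr_gt0 ltr_pdivrMr// /rho /sigma.
  have : s * (1 + th^-1) * th < a * th by rewrite ltr_pM2r.
  rewrite -mulrA mulrDl mulVf ?gt_eqF// mul1r; lra.
- by rewrite opprB addrC subrK mulfVK ?gt_eqF.
Qed.

Lemma weights_null : P (\bigcup_(x : V) [set w | Wv x w < 1]) = 0%E.
Proof.
have mlt (X : {RV P >-> R}) : [set w | X w < 1] = X @^-1` `]-oo, 1[.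
  by apply/seteqP; split => w /=; rewrite in_itv.
apply/eqP; rewrite eq_le measure_ge0 andbT.
apply: (union_bound (b := fun=> 0)) => [x|x|s _]; last by rewrite big1.
  by rewrite mlt; exact: measurable_funPTI.
rewrite mlt (weight_lawE hSFP)// -mlt.
have -> : [set w | W w < 1] = ~` [set w | 1 <= W w].
  by apply/seteqP; split => w /=; [rewrite ltNge => /negP|move=> /negP; rewrite -ltNge].
by rewrite probability_setC ?hW1 ?subee//; exact: measurable_ge.
Qed.

Lemma lnln_large (m T : R) : 0 < T -> T <= ln (ln m) ->
  [/\ 1 < ln m, 0 < m, m = expR (ln m) & ln m = expR (ln (ln m))].
Proof.
move=> T0 Tm.
have lm1 : 1 < ln m.
  rewrite ltNge; apply/negP => h; have := lt_le_trans T0 Tm.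
  by rewrite ltNge ln_le0.
have m0 : 0 < m.
  rewrite ltNge; apply/negP => h; have := ln_le0 (le_trans h ler01).
  by rewrite leNgt (lt_trans ltr01).
by split => //; rewrite lnK ?posrE//; exact: lt_trans lm1.
Qed.

Lemma expR_ge_half_sqr (x : R) : 0 <= x -> x ^+ 2 / 2 <= expR x.
Proof.
move=> x0; have := expR_ge1Dxn 1 x0; rewrite (_ : 2`! = 2)%N// => h.
by apply: le_trans h; rewrite lerDr.
Qed.

Lemma max_step_sum (c1 eta' C T : R) h (F : nat -> R) :
  0 < c1 -> 0 < eta' -> c1 * expR (- C) <= 4^-1 ->
  0 <= T - C -> 0 <= C ->
  h = Num.truncn ((T - C) / eta') ->
  (forall k, F k = expR (c1 * expR eta' ^+ k)) ->
  16 / eta' <= T -> 2 * (2 * d%:R) <= T ->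
  2 * \sum_(1 <= k < h.+1) F k < expR (expR T) / (2 * d%:R) - 1.
Proof.
move=> c10 e0 hC TC C0 hh FE T1 T2.
have /andP[h1 h2] := truncn_itv (divr_ge0 TC (ltW e0)).
rewrite -hh in h1 h2.
have T0 : 0 < T by apply: lt_le_trans T1; rewrite divr_gt0.
pose u := expR T.
have Fle k : (k <= h)%N -> F k <= expR (u / 4).
  move=> kh; rewrite FE ler_expR -expRM_natl.
  apply: (@le_trans _ _ (c1 * expR (T - C))).
    rewrite ler_wpM2l ?(ltW c10)// ler_expR; apply: (@le_trans _ _ (h%:R * eta')).
      by rewrite ler_wpM2r ?(ltW e0)// ler_nat.
    by rewrite -ler_pdivlMr.
  by rewrite expRD mulrCA /u ler_wpM2l ?expR_ge0.
have S1 : \sum_(1 <= k < h.+1) F k <= h%:R * expR (u / 4).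
  apply: (@le_trans _ _ (\sum_(1 <= k < h.+1) expR (u / 4))).
    by apply: ler_sum_nat => k /andP[_ kh]; exact: Fle.
  by rewrite sumr_const_nat subn1 -[leLHS]mulr_natl.
have Tu : T ^+ 2 / 2 <= u by exact/expR_ge_half_sqr/ltW.
have h3 : 2 * h%:R <= expR (u / 4).
  have hT : h%:R <= T / eta'.
    by apply: (le_trans h1); rewrite ler_wpM2r ?invr_ge0 ?(ltW e0)//; lra.
  have : 2 * (T / eta') <= u / 4.
    have : 16 / eta' * T <= T * T by rewrite ler_wpM2r// ltW.
    move: Tu; rewrite expr2 => Tu; have -> : 16 / eta' * T = 16 * (T / eta') by ring.
    lra.
  move=> h4; apply: le_trans (expR_ge1Dx _); lra.
have S2 : 2 * \sum_(1 <= k < h.+1) F k <= expR (u / 2).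
  apply: (@le_trans _ _ (2 * h%:R * expR (u / 4))).
    by rewrite -mulrA ler_wpM2l.
  apply: (@le_trans _ _ (expR (u / 4) * expR (u / 4))).
    by rewrite ler_wpM2r ?expR_ge0.
  by rewrite -expRD ler_expR; lra.
apply: (le_lt_trans S2); set z := expR (u / 2).
have -> : expR (expR T) = z * z by rewrite -expRD; congr expR; rewrite -/u; lra.
have d0 : 1 <= d%:R :> R by rewrite ler1n.
have uT : 1 + T <= u by exact: expR_ge1Dx.
have zd : 2 * d%:R + 1 <= z by apply: le_trans (expR_ge1Dx _); lra.
set D := 2 * d%:R in zd T2 *.
have D0 : 2 <= D by rewrite /D; lra.
rewrite ltrBrDr ltr_pdivlMr; last by lra.
apply: (@lt_le_trans _ _ (z * (D + 1))); last by rewrite ler_wpM2l//; lra.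
by rewrite mulrDl mulrDr mul1r mulr1 ltrD2l; lra.
Qed.

Lemma graph_dist_lower (eps delta : R) : 0 < eps -> 0 < delta ->
  exists2 T0, 0 < T0 & forall m, T0 <= ln (ln m) -> exists B : set O,
    [/\ measurable B, (P B <= delta%:E)%E & forall w, ~ B w ->
      (((1 - eps) * norming L gamma m)%:E <=
       graph_dist adj Le 0%R (floor_vec (m *: e)) w)%E].
Proof.
move=> eps0 delta0; have e0 := growth_rate_gt0 g1 g2.
pose eta' := eta * (1 + eps / 2).
have ee' : eta < eta' by rewrite /eta' ltr_pMr// ltrDl divr_gt0.
have e'0 : 0 < eta' by exact: lt_trans ee'.
have ee2 : (1 - eps) * eta' < eta.
  rewrite /eta' mulrCA gtr_pMr//; have : 0 < eps * eps by rewrite mulr_gt0.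
  by nra.
pose th := expR eta'.
have thg : (gamma - 1)^-1 < th.
  rewrite -[ltLHS]lnK ?posrE ?invr_gt0 ?subr_gt0// ltr_expR.
  by rewrite lnV ?posrE ?subr_gt0.
have th1 : 1 < th by rewrite expR_gt1.
have [s [a [zeta [[ds s0 s1 sa at'] [a2s z0 hz]]]]] := lower_exponents thg.
have alpha0 : 0 < alpha by apply: lt_trans halpha; rewrite ltr0n.
have [A dA As] := midpoint_exists ds.
have [C _ hC] := @lattice_sum R d A hd dA.
have a0 : 0 <= a by lra.
have [M _ hM] := level_sum hell hWtail a0 at'.
pose lamc := Num.max 0 (ln lambda).
have lamc0 : 0 <= lamc by rewrite le_max lexx.
have lam : lambda <= expR lamc.
  by rewrite -[leLHS]lnK ?posrE// ler_expR le_max lexx orbT.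
have A0 : 0 <= A by apply/ltW; apply: le_lt_trans dA.
have d20 : 0 < delta / 2 by rewrite divr_gt0.
have [b0 b00 Hb] := bad_union_prob hSFP hL0 hlambda lam lamc0 s0 (ltW s1) sa a2s As
  hC hM th1 z0 d20 hz.
have sg0 : 0 < sigma s a by rewrite /sigma subr_gt0.
pose b := b0 + (sigma s a)^-1.
have bb : b0 <= b by rewrite lerDl invr_ge0 ltW.
have sb1 : 1 <= sigma s a * b.
  by rewrite mulrDr divff ?gt_eqF// lerDr mulr_ge0// ltW.
have b_gt0 : 0 < b by apply: ltr_wpDl => //; rewrite invr_gt0.
pose beta k := b * th ^+ k.
pose c0 := ln (sigma s a * b).
have c00 : 0 <= c0 by exact: ln_ge0.
pose c1 := sigma s a * b / (alpha * s - A).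
have c10 : 0 < c1 by rewrite divr_gt0 ?subr_gt0//; lra.
pose C3 := Num.max 0 (ln (4 * c1)).
have C30 : 0 <= C3 by rewrite le_max lexx.
have hC3 : c1 * expR (- C3) <= 4^-1.
  have h4 : 4 * c1 <= expR C3.
    have h40 : 0 < 4 * c1 by exact: mulr_gt0.
    by rewrite -ler_ln ?posrE ?h40 ?expR_gt0// expRK le_max lexx orbT.
  by rewrite expRN ler_pdivrMr ?expR_gt0//; lra.
clearbody C3.
have [T1 _ HT1] := shifted_sum_ge hL0 hL g1 g2 e'0 ee2 c00 C30.
pose T0 := Num.max T1 (Num.max C3 (Num.max (16 / eta') (2 * (2 * d%:R)))).
have q0 : 0 < 16 / eta' by rewrite divr_gt0.
have T00 : 0 < T0 by rewrite !lt_max q0 !orbT.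
exists T0 => // m mT.
have [lm1 m0 mE lmE] := lnln_large T00 mT.
move: mT; rewrite !ge_max => /and4P[mT mC mq md].
have {}HT1 := HT1 m mT.
set T := ln (ln m) in mT mC mq md HT1 lmE.
set h := Num.truncn _ in HT1.
pose x := floor_vec (m *: e).
pose B (y : V) := \bigcup_k bad alpha L Wv adj Le s a A y beta k.
have mB y : measurable (B y).
  by apply: bigcup_measurable => k _; exact: (measurable_bad hSFP).
pose N := \bigcup_(y : V) [set w | Wv y w < 1].
have mN : measurable N.
  apply: countable_bigcupT_measurable => // y.
  rewrite (_ : [set w | _] = Wv y @^-1` `]-oo, 1[); first exact: measurable_funPTI.
  by apply/seteqP; split => w /=; rewrite in_itv.
exists (N `|` (B 0 `|` B x)); split.
- by apply: measurableU => //; exact: measurableU.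
- have mBB := measurableU _ _ (mB 0) (mB x).
  have h1 : (P (N `|` (B 0%R `|` B x)) <= P N + P (B 0%R `|` B x))%E by exact: measureU2.
  have h2 : (P (B 0%R `|` B x) <= P (B 0%R) + P (B x))%E by exact: measureU2.
  apply: (le_trans h1); rewrite weights_null add0e; apply: (le_trans h2).
  by rewrite [delta]splitr EFinD leeD//; exact: Hb.
move=> w; rewrite !not_orP => -[wN [w0 wx]].
have w1 y : 1 <= Wv y w.
  by rewrite leNgt; apply/negP => h'; apply: wN; exists y.
have nb0 k : ~ bad alpha L Wv adj Le s a A 0 beta k w by move=> hb; apply: w0; exists k.
have nbx k : ~ bad alpha L Wv adj Le s a A x beta k w by move=> hb; apply: wx; exists k.
have beta0 k : 0 <= beta k by rewrite mulr_ge0 ?exprn_ge0 ?ltW ?expR_gt0.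
have mlE k : min_length L s a beta k = dexp_quantile L (c0 + k%:R * eta').
  rewrite /min_length /dexp_quantile expRD lnK ?posrE; last exact: lt_le_trans sb1.
  by rewrite expRM_natl /beta mulrA.
have [i ei] := enorm1_coord he.
apply: le_ereal_inf_tmp => _ [p [pp up lp] <-]; rewrite lee_fin.
apply: le_trans (two_sided_length hSFP hL0 (h := h) (i := i) beta0 w1 nb0 nbx _ pp up lp).
  by under eq_bigr do rewrite mlE; exact: HT1.
rewrite [X in _ - X]mxE subr0.
apply: lt_le_trans (floor_vec_coord_ge (ltW m0) ei).
rewrite mE lmE.
rewrite -subr_ge0 in mC.
have FE k : max_step alpha s a A beta k = expR (c1 * expR eta' ^+ k).
  by rewrite /max_step /beta /c1; congr expR; rewrite -/th; ring.
exact: (max_step_sum c10 e'0 hC3 mC C30 erefl FE mq md).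
Qed.

End LowerTheorem.

(** * Failure probabilities of the greedy chain *)

Section ComplementProduct.
Context (dO : measure_display) (O : measurableType dO) (R : realType).
Context (P : probability O R).

Lemma integrable01 (G : set O) (h : O -> R) : measurable G -> measurable_fun G h ->
  (forall w, G w -> 0 <= h w <= 1) -> P.-integrable G (EFin \o h).
Proof.
move=> mG mh h01; apply: measurable_bounded_integrable => //.
  by apply: le_lt_trans (probability_le1 P mG) _; rewrite ltry.
exists 1; split=> // M M1 w Gw; have /andP[h0 h1] := h01 w Gw.
by apply: le_trans (ltW M1); rewrite /= ger0_norm.
Qed.

Lemma prod01 (I : eqType) (Z : seq I) (f : I -> R) :
  (forall z, z \in Z -> 0 <= f z <= 1) -> 0 <= \prod_(z <- Z) f z <= 1.
Proof.
elim: Z => [|z Z IH] h; first by rewrite big_nil ler01 lexx.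
rewrite big_cons; have /andP[a b] := h z (mem_head _ _).
have /andP[a' b'] : 0 <= \prod_(y <- Z) f y <= 1.
  by apply: IH => y yZ; apply: h; rewrite in_cons yZ orbT.
by rewrite mulr_ge0//= -[leRHS]mulr1 ler_pM.
Qed.

(* Inclusion-exclusion: the integrals of the products over all subfamilies
   determine those of the products of the complements. *)
Lemma compl_prod (I : eqType) (Z : seq I) (f g : I -> O -> R) (G : set O) :
  measurable G -> uniq Z ->
  (forall z, z \in Z -> measurable_fun G (f z)) ->
  (forall z, z \in Z -> measurable_fun G (g z)) ->
  (forall z w, z \in Z -> G w -> 0 <= f z w <= 1) ->
  (forall z w, z \in Z -> G w -> 0 <= g z w <= 1) ->
  (forall Z1, uniq Z1 -> {subset Z1 <= Z} ->
    \int[P]_(w in G) (\prod_(z <- Z1) f z w)%R%:E =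
    \int[P]_(w in G) (\prod_(z <- Z1) g z w)%R%:E)%E ->
  (\int[P]_(w in G) (\prod_(z <- Z) (1 - f z w))%R%:E =
   \int[P]_(w in G) (\prod_(z <- Z) (1 - g z w))%R%:E)%E.
Proof.
move=> mG uZ mf mg f01 g01 fg.
suff H Z2 Z1 : uniq (Z1 ++ Z2) -> {subset Z1 ++ Z2 <= Z} ->
    (\int[P]_(w in G) (\prod_(z <- Z1) f z w * \prod_(z <- Z2) (1 - f z w))%R%:E =
     \int[P]_(w in G) (\prod_(z <- Z1) g z w * \prod_(z <- Z2) (1 - g z w))%R%:E)%E.
  have := H Z [::] uZ (fun _ => id).
  under eq_integral do rewrite big_nil mul1r.
  by under [RHS]eq_integral do rewrite big_nil mul1r.
elim: Z2 Z1 => [|z Z2 IH] Z1 u12 s12.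
  rewrite cats0 in u12 s12.
  under eq_integral do rewrite big_nil mulr1.
  under [RHS]eq_integral do rewrite big_nil mulr1.
  exact: fg.
have s1 : {subset Z1 <= Z} by move=> y y1; apply: s12; rewrite mem_cat y1.
have s2 : {subset Z2 <= Z} by move=> y y2; apply: s12; rewrite mem_cat in_cons y2 !orbT.
have zZ : z \in Z by apply: s12; rewrite mem_cat mem_head orbT.
have u1 : uniq (Z1 ++ Z2).
  by move: u12; rewrite !cat_uniq /= negb_or => /and3P[-> /andP[_ ->] /andP[_ ->]].
have s1' : {subset Z1 ++ Z2 <= Z} by move=> y; rewrite mem_cat => /orP[/s1|/s2].
have pm : perm_eq ((z :: Z1) ++ Z2) (Z1 ++ z :: Z2).
  by rewrite perm_sym -cat1s -[z :: Z1]cat1s -catA perm_catCA.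
have u2 : uniq ((z :: Z1) ++ Z2) by rewrite (perm_uniq pm).
have s2' : {subset (z :: Z1) ++ Z2 <= Z} by move=> y; rewrite (perm_mem pm); exact: s12.
have step (h : I -> O -> R) : (forall y, y \in Z -> measurable_fun G (h y)) ->
    (forall y w, y \in Z -> G w -> 0 <= h y w <= 1) ->
    (\int[P]_(w in G) (\prod_(y <- Z1) h y w * \prod_(y <- z :: Z2) (1 - h y w))%R%:E =
     \int[P]_(w in G) (\prod_(y <- Z1) h y w * \prod_(y <- Z2) (1 - h y w))%R%:E -
     \int[P]_(w in G) (\prod_(y <- z :: Z1) h y w * \prod_(y <- Z2) (1 - h y w))%R%:E)%E.
  move=> mh h01.
  have int Y1 : {subset Y1 <= Z} ->
      P.-integrable G (EFin \o (fun w => \prod_(y <- Y1) h y w * \prod_(y <- Z2) (1 - h y w))).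
    move=> Y1Z; apply: integrable01 => //.
      apply: measurable_funM; apply: measurable_prod => y yZ; first exact/mh/Y1Z.
      by apply: measurable_funB => //; exact/mh/s2.
    move=> w Gw.
    have /andP[a b] : 0 <= \prod_(y <- Y1) h y w <= 1 by apply: prod01 => y /Y1Z /h01; apply.
    have /andP[a' b'] : 0 <= \prod_(y <- Z2) (1 - h y w) <= 1.
      by apply: prod01 => y /s2 /h01 /(_ Gw) /andP[? ?]; rewrite subr_ge0 gerBl; apply/andP.
    by rewrite mulr_ge0//= -[leRHS]mulr1 ler_pM.
  rewrite -integralB_EFin//; [|exact: int|apply: int].
    apply: eq_integral => w _; rewrite -EFinB; congr EFin.
    by rewrite !big_cons; ring.
  by move=> y; rewrite in_cons => /orP[/eqP ->|/s1].
rewrite step// [RHS]step//; congr (_ - _)%E; first exact: IH.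
exact: IH.
Qed.

Lemma prod_indic (I : Type) (Z : seq I) (C : I -> set O) w :
  \prod_(z <- Z) \1_(C z) w = \1_(\big[setI/setT]_(z <- Z) C z) w :> R.
Proof.
elim: Z => [|z Z IH]; first by rewrite !big_nil indicE in_setT.
by rewrite !big_cons IH indicI.
Qed.

Lemma prod_compl_indic (I : Type) (Z : seq I) (C : I -> set O) w :
  \prod_(z <- Z) (1 - \1_(C z) w) = \1_(\big[setI/setT]_(z <- Z) ~` C z) w :> R.
Proof.
rewrite -prod_indic; apply: eq_bigr => z _.
by rewrite indicC indicE; case: (_ \in _); rewrite ?subrr ?subr0.
Qed.

End ComplementProduct.

Section StarFail.
Context (dO : measure_display) (O : measurableType dO) (R : realType).
Context (P : probability O R) (d : nat) (alpha lambda : R) (W L : {RV P >-> R}).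
Context (Wv : 'rV[int]_d -> {RV P >-> R}) (adj : O -> rel 'rV[int]_d).
Context (Le : 'rV[int]_d -> 'rV[int]_d -> {RV P >-> R}).
Context (H : weighted_sfp alpha lambda W L Wv adj Le).
Notation V := 'rV[int]_d.

Definition ray (u : R) : set R := `[u, +oo[.

Definition thresholds (u : R) (s : seq V) : seq (V * R) := [seq (x, u) | x <- s].

Definition heavy (u : R) (s : seq V) : set O := weights_in Wv ray (thresholds u s).

Definition lengths_in (D : set R) (E : seq (V * V)) : set O :=
  \big[setI/setT]_(e <- E) (Le e.1 e.2 @^-1` D).

Lemma measurable_ray u : measurable (ray u). Proof. exact: measurable_itv. Qed.

Lemma heavyE u s w : heavy u s w <-> (forall x, x \in s -> u <= Wv x w).
Proof.
rewrite /heavy /weights_in /thresholds big_map.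
elim: s => [|x s IH]; first by rewrite big_nil.
rewrite big_cons; split => [[h1 /IH h2] y|h].
  rewrite in_cons => /orP[/eqP ->|/h2//].
  by move: h1; rewrite /= /ray /= in_itv/= andbT.
split; first by rewrite /= /ray /= in_itv/= andbT h ?mem_head.
by apply/IH => y ys; apply: h; rewrite in_cons ys orbT.
Qed.

Lemma measurable_heavy u s : measurable (heavy u s).
Proof. by apply: measurable_weights_in; exact: measurable_ray. Qed.

Lemma measurable_lengths_in D E : measurable D -> measurable (lengths_in D E).
Proof.
move=> mD; rewrite /lengths_in; elim/big_ind: _ => //; first exact: measurableI.
by move=> e _; exact: measurable_funPTI.
Qed.

Lemma distinct_edges_neq (E : seq (V * V)) e : distinct_edges E -> e \in E -> e.1 != e.2.
Proof. by move=> /andP[/allP h _] /h. Qed.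

Lemma conn_prob_le1 x y w : conn_prob alpha lambda Wv x y w <= 1.
Proof. by rewrite /conn_prob; case: eqP => // _; rewrite gerBl expR_ge0. Qed.

Lemma edges_lengths_prob (p : seq (V * R)) E (D : set R) (kap : R) :
  distinct_edges E -> measurable D -> P (L @^-1` D) = kap%:E -> 0 <= kap ->
  (forall w, weights_in Wv ray p w -> forall e, e \in E ->
    0 <= conn_prob alpha lambda Wv e.1 e.2 w) ->
  P (weights_in Wv ray p `&` (all_edges adj E `&` lengths_in D E)) =
  (\int[P]_(w in weights_in Wv ray p)
    (\prod_(e <- E) (kap * conn_prob alpha lambda Wv e.1 e.2 w))%R%:E)%E.
Proof.
move=> dE mD kapE kap0 c0; rewrite setIA.
have mG : measurable (weights_in Wv ray p) by apply: measurable_weights_in; exact: measurable_ray.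
have := sfp_lengths H dE (weights_edges_sigma p E measurable_ray) (fun=> mD).
rewrite bigcap_seq => ->.
have -> : (\prod_(e <- E) P (Le e.1 e.2 @^-1` D) = (kap ^+ size E)%:E)%E.
  have : forall e, e \in E -> P (Le e.1 e.2 @^-1` D) = kap%:E.
    by move=> e eE; rewrite (length_lawE H (distinct_edges_neq dE eE) mD).
  elim: E {dE c0} => [|e E IH] h; first by rewrite big_nil expr0.
  rewrite big_cons h ?mem_head// IH ?exprS ?EFinM// => f fE.
  by apply: h; rewrite in_cons fE orbT.
rewrite all_edgesE (sfp_edges H)//; last by apply: weights_in_sigma; exact: measurable_ray.
rewrite muleC -ge0_integralZl_EFin ?exprn_ge0//.
- by apply: eq_integral => w _; rewrite -EFinM big_split /= big_const_seq count_predT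
    iter_mulr_1.
- by move=> w Gw; rewrite lee_fin big_seq_cond prodr_ge0// => e /andP[eE _]; exact: c0.
- apply/measurable_EFinP; apply: measurable_funTS; apply: measurable_prod => e _.
  exact: measurable_conn_prob.
Qed.

Definition star_event (u : R) (D : set R) (E : V -> seq (V * V)) (z : V) : set O :=
  (Wv z @^-1` ray u) `&` (all_edges adj (E z) `&` lengths_in D (E z)).

Lemma measurable_star_event u D E z : measurable D -> measurable (star_event u D E z).
Proof.
move=> mD; apply: measurableI; first by apply: measurable_funPTI; exact: measurable_ray.
by apply: measurableI; [exact: measurable_all_edges H _|exact: measurable_lengths_in].
Qed.

Lemma star_events_all u u' D E s Z :
  heavy u s `&` \big[setI/setT]_(z <- Z) star_event u' D E z =
  weights_in Wv ray (thresholds u s ++ thresholds u' Z) `&`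
    (all_edges adj (flatten (map E Z)) `&` lengths_in D (flatten (map E Z))).
Proof.
rewrite /weights_in big_cat /= -/(weights_in Wv ray (thresholds u s)).
rewrite -setIA -/(heavy u s); congr (_ `&` _).
elim: Z => [|z Z IH]; first by rewrite /all_edges /lengths_in !big_nil !setIT.
rewrite /all_edges /lengths_in /= !big_cat /= !big_cons IH /star_event /=.
by apply/seteqP; split => w /=; rewrite /all_edges /lengths_in /=; tauto.
Qed.

Lemma star_fail (s Z : seq V) (u u' c kap p : R) (D : set R) (E : V -> seq (V * V)) :
  0 < lambda -> 0 <= u -> 0 <= u' -> uniq Z -> measurable D -> 0 <= c <= 1 ->
  P (L @^-1` D) = kap%:E -> P [set w | u' <= W w] = p%:E ->
  (forall Z1, uniq Z1 -> {subset Z1 <= Z} -> distinct_edges (flatten (map E Z1))) ->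
  (forall z e, z \in Z -> e \in E z -> (e.1 \in z :: s) && (e.2 \in z :: s)) ->
  (forall z w, z \in Z -> heavy u s w -> u' <= Wv z w ->
    c <= \prod_(e <- E z) (kap * conn_prob alpha lambda Wv e.1 e.2 w)) ->
  (P (heavy u s `&` \big[setI/setT]_(z <- Z) ~` star_event u' D E z) <=
    (expR (- ((size Z)%:R * (c * p))))%:E)%E.
Proof.
move=> l0 u0 u'0 uZ mD /andP[c0 c1] kapE pE dE Es hc.
have kap01 : 0 <= kap <= 1.
  rewrite -!lee_fin -kapE measure_ge0/= probability_le1//.
  exact: measurable_funPTI.
have /andP[kap0 kap1] := kap01.
pose G := heavy u s; have mG : measurable G by exact: measurable_heavy.
pose B z := Wv z @^-1` ray u'.
have mB z : measurable (B z) by apply: measurable_funPTI; exact: measurable_ray.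
have Bw z w : B z w -> u' <= Wv z w by rewrite /B /ray /= in_itv/= andbT.
pose f z : O -> R := \1_(star_event u' D E z).
pose g z w := \1_(B z) w * \prod_(e <- E z) (kap * conn_prob alpha lambda Wv e.1 e.2 w).
have mprod E' : measurable_fun G (fun w => \prod_(e <- E')
    (kap * conn_prob alpha lambda Wv e.1 e.2 w)).
  apply: measurable_funTS; apply: measurable_prod => e _.
  by apply: measurable_funM => //; exact: measurable_conn_prob.
have conn0 z w e : z \in Z -> e \in E z -> G w -> B z w ->
    0 <= conn_prob alpha lambda Wv e.1 e.2 w.
  move=> zZ eE /heavyE Gw /Bw zw.
  have W0 x : x \in z :: s -> 0 <= Wv x w.
    by rewrite in_cons => /orP[/eqP ->|/Gw]; [exact: le_trans zw|exact: le_trans].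
  by have /andP[e1 e2] := Es z e zZ eE; apply: conn_prob_ge0 => //; exact: W0.
have g01 z w : z \in Z -> G w -> 0 <= g z w <= 1.
  move=> zZ Gw; rewrite /g indicE; have [zw|_] := boolP (w \in B z); last first.
    by rewrite mul0r lexx ler01.
  rewrite mul1r; apply: prod01 => e eE; rewrite inE in zw.
  have h := conn0 z w e zZ eE Gw zw.
  by rewrite mulr_ge0//= -[leRHS]mulr1 ler_pM// conn_prob_le1.
have mf z : measurable_fun G (f z).
  exact/measurable_funTS/measurable_indic/measurable_star_event.
have mg z : measurable_fun G (g z).
  by apply: measurable_funM => //; exact/measurable_funTS/measurable_indic.
have E1 Z1 : uniq Z1 -> {subset Z1 <= Z} ->
    (\int[P]_(w in G) (\prod_(z <- Z1) f z w)%R%:E =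
     \int[P]_(w in G) (\prod_(z <- Z1) g z w)%R%:E)%E.
  move=> uZ1 sZ1.
  under eq_integral do rewrite prod_indic.
  rewrite integral_indic//; last first.
    elim/big_ind: _ => //; first exact: measurableI.
    by move=> z _; exact: measurable_star_event.
  have c01 w : weights_in Wv ray (thresholds u s ++ thresholds u' Z1) w ->
      forall e, e \in flatten (map E Z1) -> 0 <= conn_prob alpha lambda Wv e.1 e.2 w.
    rewrite /weights_in big_cat => -[Gw Zw] e /flattenP[_ /mapP[z zZ1 ->] eE].
    apply: (conn0 z) => //; first exact: sZ1.
    by move/heavyE: Zw => /(_ z zZ1) h; rewrite /B /ray /= in_itv/= h.
  rewrite setIC star_events_all.
  apply: (etrans (edges_lengths_prob (dE Z1 uZ1 sZ1) mD kapE kap0 c01)).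
  rewrite (_ : weights_in _ _ _ = G `&` \big[setI/setT]_(z <- Z1) B z); last first.
    by rewrite /weights_in big_cat /= [in X in _ `&` X]big_map.
  rewrite integral_mkcondr; apply: eq_integral => w _.
  rewrite /g big_split /= prod_indic /patch big_flatten /= big_map indicE.
  by case: ifP => _; rewrite ?mul1r ?mul0r.
have F := compl_prod mG uZ (fun z _ => mf z) (fun z _ => mg z) _ g01 E1.
have {}F : P (G `&` \big[setI/setT]_(z <- Z) ~` star_event u' D E z) =
    (\int[P]_(w in G) (\prod_(z <- Z) (1 - g z w))%R%:E)%E.
  rewrite -F; last first.
    by move=> z w _ _; rewrite /f indicE; case: (_ \in _); rewrite ?lexx ler01.
  under eq_integral do rewrite prod_compl_indic.
  have mC : measurable (\big[setI/setT]_(z <- Z) ~` star_event u' D E z).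
    elim/big_ind: _ => //; first exact: measurableI.
    by move=> z _; exact/measurableC/measurable_star_event.
  by rewrite setIC; exact: (esym (integral_indic _ _ mC)).
rewrite F.
pose h z w : R := c * \1_(B z) w.
have h01 z w : 0 <= h z w <= 1.
  by rewrite /h indicE; case: (_ \in _); rewrite ?mulr1 ?mulr0 ?c0// lexx ler01.
have mh z : measurable_fun setT (h z).
  by apply: measurable_funM => //; exact: measurable_indic.
have mprodh : measurable_fun setT (fun w => \prod_(z <- Z) (1 - h z w)).
  by apply: measurable_prod => z _; apply: measurable_funB.
have p01 : 0 <= p <= 1.
  rewrite -!lee_fin -pE measure_ge0/= probability_le1//.
  exact: measurable_ge.
have /andP[p0 p1] := p01.
apply: (@le_trans _ _ (\int[P]_(w in G) (\prod_(z <- Z) (1 - h z w))%R%:E)%E).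
  apply: ge0_le_integral => //.
  - move=> w Gw; rewrite lee_fin big_seq_cond prodr_ge0// => z /andP[zZ _].
    by rewrite subr_ge0; have /andP[] := g01 z w zZ Gw.
  - apply/measurable_EFinP; apply: measurable_prod => z _; exact: measurable_funB.
  - by apply/measurable_EFinP; exact: measurable_funTS.
  - move=> w Gw; rewrite lee_fin big_seq_cond [leRHS]big_seq_cond.
    apply: ler_prod => z /andP[zZ _]; have /andP[g0 g1] := g01 z w zZ Gw.
    rewrite subr_ge0 g1 lerD2l lerN2 /g /h indicE.
    have [zw|_] := boolP (w \in B z); last by rewrite mulr0 mul0r lexx.
    by rewrite inE in zw; rewrite mulr1 mul1r; apply: hc => //; exact: Bw.
apply: (@le_trans _ _ (\int[P]_w (\prod_(z <- Z) (1 - h z w))%R%:E)%E).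
  apply: ge0_subset_integral => //; first exact/measurable_EFinP.
  by move=> w _; rewrite lee_fin prodr_ge0// => z _; rewrite subr_ge0; have /andP[] := h01 z w.
have cp01 : 0 <= c * p <= 1 by rewrite mulr_ge0//= -[leRHS]mulr1 ler_pM.
have K := @compl_prod _ _ _ P _ Z h (fun _ _ => c * p) setT measurableT uZ
  (fun z _ => mh z) (fun z _ => measurable_cst _) (fun z w _ _ => h01 z w) (fun _ _ _ _ => cp01).
have PB Z1 : uniq Z1 ->
    P (\big[setI/setT]_(z <- Z1) B z) = (\prod_(z <- Z1) p)%:E.
  move=> uZ1.
  have -> : \big[setI/setT]_(z <- Z1) B z = weights_in Wv ray (thresholds u' Z1).
    by rewrite /weights_in big_map.
  rewrite (weights_in_prob H)//; [|exact: measurable_ray|by rewrite -map_comp map_id].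
  rewrite big_map /= (_ : P (W @^-1` ray u') = p%:E) ?prodEFin//.
  rewrite -pE; congr (P _); apply/seteqP.
  by split => w; rewrite /ray /= in_itv/= andbT.
rewrite K; last first.
  move=> Z1 uZ1 _; rewrite /h.
  have mBB : measurable (\big[setI/setT]_(z <- Z1) B z).
    by elim/big_ind: _ => //; exact: measurableI.
  under eq_integral do rewrite big_split /= prod_indic EFinM.
  rewrite ge0_integralZl_EFin ?prodr_ge0//; last exact/measurable_EFinP/measurable_indic.
  rewrite integral_indic// setIT.
  rewrite [X in (_ * X)%E = _](_ : _ = (\prod_(z <- Z1) p)%:E); last exact: PB.
  rewrite integral_cst// [X in (_ = _ * X)%E](_ : _ = 1%E) ?mule1; last exact: probability_setT.
  by rewrite -EFinM big_split.
rewrite integral_cst// [X in (_ * X <= _)%E](_ : _ = 1%E) ?mule1 ?lee_fin; last exact: probability_setT.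
rewrite big_const_seq count_predT iter_mulr_1.
rewrite -[in leRHS]mulrN expRM_natl lerXn2r ?nnegrE ?expR_ge0 ?subr_ge0//.
  by have /andP[] := cp01.
by have := expR_ge1Dx (- (c * p)); rewrite addrC; apply: le_trans; rewrite addrC.
Qed.

End StarFail.

Section Reach.
Context (dO : measure_display) (O : measurableType dO) (R : realType).
Context (P : probability O R) (d : nat) (alpha lambda : R) (W L : {RV P >-> R}).
Context (Wv : 'rV[int]_d -> {RV P >-> R}) (adj : O -> rel 'rV[int]_d).
Context (Le : 'rV[int]_d -> 'rV[int]_d -> {RV P >-> R}).
Context (H : weighted_sfp alpha lambda W L Wv adj Le).
Notation V := 'rV[int]_d.

Definition reach (w : O) (x y : V) (c : R) : Prop :=
  exists p, [/\ path (fun a b => adj w a b && (a != b)) x p, last x p = y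
    & path_length Le w x p <= c].

Lemma reach_refl w x : reach w x x 0.
Proof. by exists [::]; split => //; rewrite /path_length big_nil. Qed.

Lemma reach_edge w x y c : adj w x y -> x != y -> Le x y w <= c -> reach w x y c.
Proof.
move=> xy nxy Lc; exists [:: y]; split => //=; first by rewrite xy nxy.
by rewrite /path_length /= big_seq1.
Qed.

Lemma reach_trans w x y z c c' : reach w x y c -> reach w y z c' -> reach w x z (c + c').
Proof.
move=> [p [pp lp cp]] [q [pq lq cq]]; exists (p ++ q); split.
- by rewrite cat_path pp lp.
- by rewrite last_cat lp.
- by rewrite path_length_cat lp lerD.
Qed.

Lemma reach_sym w x y c : reach w x y c -> reach w y x c.
Proof.
move=> [p [pp lp cp]]; exists (rev (belast x p)); rewrite -lp; split.
- rewrite rev_path; apply: sub_path pp => a b /=.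
  by rewrite (sfp_adj_sym H) eq_sym.
- by case: p {pp lp cp} => [//|z p] /=; rewrite rev_cons last_rcons.
- by rewrite (path_length_rev (sfp_length_sym H)).
Qed.

Lemma reachW w x y c c' : c <= c' -> reach w x y c -> reach w x y c'.
Proof. by move=> cc [p [pp lp cp]]; exists p; split => //; exact: le_trans cc. Qed.

Lemma path_length_ge0 w x p : (forall a b : V, a != b -> 0 <= Le a b w) -> uniq (x :: p) ->
  0 <= path_length Le w x p.
Proof.
move=> L0; elim: p x => [|y p IH] x up; first by rewrite /path_length big_nil.
move: up => /andP[xp up]; rewrite path_length_cons addr_ge0//; last exact: IH.
by apply: L0; move: xp; rewrite in_cons negb_or => /andP[].
Qed.

Lemma shorten_walk w x p : (forall a b : V, a != b -> 0 <= Le a b w) ->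
  path (fun a b => adj w a b && (a != b)) x p ->
  exists q, [/\ path (adj w) x q, uniq (x :: q), last x q = last x p
    & path_length Le w x q <= path_length Le w x p].
Proof.
move=> L0; elim: p x => [|y p IH] x /=; first by exists [::].
move=> /andP[/andP[xy nxy] /IH [q [pq uq lq cq]]].
have Lxy := L0 _ _ nxy.
have [xq|xq] := boolP (x \in y :: q); last first.
  exists (y :: q); split => //=; first by rewrite xy.
  - by rewrite xq.
  - by rewrite !path_length_cons lerD2l.
move: xq; rewrite in_cons (negbTE nxy) /= => xq.
case/splitPr: xq pq uq lq cq => q1 q2 pq uq lq cq.
exists q2; split.
- by move: pq; rewrite cat_path /= => /and3P[].
- by move: uq => /= /andP[_]; rewrite cat_uniq => /and3P[].
- by rewrite -lq last_cat.
have u1 : uniq (y :: rcons q1 x).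
  by move: uq; rewrite -cat_rcons -cat_cons cat_uniq => /andP[].
have l1 := path_length_ge0 L0 u1.
move: cq; rewrite -cat_rcons path_length_cat last_rcons path_length_cons => cq.
lra.
Qed.

Lemma graph_dist_le_reach w x y c : (forall a b : V, a != b -> 0 <= Le a b w) ->
  reach w x y c -> (graph_dist adj Le x y w <= c%:E)%E.
Proof.
move=> L0 [p [pp lp cp]]; have [q [pq uq lq cq]] := shorten_walk L0 pp.
apply: ge_ereal_inf; exists (path_length Le w x q)%:E; last first.
  by rewrite lee_fin (le_trans cq).
by exists q => //; split => //; rewrite lq.
Qed.

Lemma nn_edge_null (x y : V) : edist R x y = 1 -> P (~` edge_event adj x y) = 0%E.
Proof.
move=> xy1; have nxy : x != y.
  apply/eqP => xy; move: xy1; rewrite xy /edist subrr /enorm big1 ?sqrtr0.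
    by move=> /eqP; rewrite eq_sym oner_eq0.
  by move=> i _; rewrite !mxE mulr0z expr0n.
have mE := sfp_adj_measurable H x y.
have dE : distinct_edges [:: (x, y)] by rewrite distinct_edges_cons /= nxy.
have sT : <<s weight_events Wv >> (setT : set O).
  have : measurable (setT : set (g_sigma_algebraType (weight_events Wv))) by [].
  by [].
have := sfp_edges H dE sT; rewrite bigcap_seq big_seq1 setTI /=.
under eq_integral do rewrite big_seq1 /conn_prob xy1 eqxx.
rewrite integral_cst// mul1e [X in _ = X -> _](_ : _ = 1%E); last exact: probability_setT.
by move=> PE; rewrite probability_setC// PE subee.
Qed.

Lemma l1_step (x z : V) (N : nat) : z \in box x N -> z != x -> exists z' : V,
  [/\ z' \in box x N, edist R z' z = 1, z' != z &
    (\sum_i `|z 0%R i - x 0%R i| = (\sum_i `|z' 0%R i - x 0%R i|).+1)%N].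
Proof.
move=> zb /neq_coord[i zxi].
pose s : int := if (x 0 i < z 0 i) then 1 else -1.
pose z' : V := \row_j (z 0 j - (if j == i then s else 0)).
have s1 : `|s| = 1 by rewrite /s; case: ifP.
have s2 : s%:~R ^+ 2 = 1 :> R.
  by rewrite /s; case: ifP => _; rewrite ?rmorphN1 ?rmorph1 ?sqrrN expr1n.
have zi : (`|z 0%R i - x 0%R i| = `|z' 0%R i - x 0%R i|.+1)%N.
  rewrite mxE eqxx /s; move: zxi; move: (z 0 i) (x 0 i) => a b ab.
  by case: ifP => ?; lia.
have zj j : j != i -> z' 0 j = z 0 j by move=> /negbTE ji; rewrite mxE ji subr0.
exists z'; split.
- rewrite mem_box; apply/forallP => j; move: zb; rewrite mem_box => /forallP /(_ j).
  have [->|ji] := eqVneq j i; last by rewrite zj.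
  by move: zi; move: (z 0 i) (z' 0 i) (x 0 i) => a b c; lia.
- rewrite /edist /enorm (bigD1 i)//= big1 ?addr0.
    rewrite !mxE eqxx addrC addKr mulrNz sqrrN s2.
    by rewrite sqrtr1.
  by move=> j ji; rewrite !mxE (negbTE ji) subr0 subrr mulr0z expr0n.
- apply/eqP => /rowP /(_ i); rewrite mxE eqxx => /eqP.
  by rewrite -subr_eq0 addrC addKr oppr_eq0 -normr_eq0 s1.
- rewrite (bigD1 i)//= [in RHS](bigD1 i)//= zi addSn; congr (_ + _).+1.
  by apply: eq_bigr => j /zj ->.
Qed.

Lemma lattice_reach w (x : V) (N : nat) (c : R) : 0 <= c ->
  (forall a b, a \in box x N -> b \in box x N -> edist R a b = 1 ->
    adj w a b /\ Le a b w <= c) ->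
  forall z, z \in box x N -> reach w x z (c * (d * N)%:R).
Proof.
move=> c0 hc z zb.
have h n : forall z : V, z \in box x N -> (\sum_i `|z 0%R i - x 0%R i| = n)%N ->
    reach w x z (c * n%:R).
  elim: n => [|n IH] {}z {}zb zn.
    have [->|zx] := eqVneq z x; first by rewrite mulr0; exact: reach_refl.
    by have [z' [_ _ _]] := l1_step zb zx; rewrite zn.
  have [zx|zx] := eqVneq z x.
    by exfalso; move: zn; rewrite zx big1// => i _; rewrite subrr.
  have [z' [z'b zz' nz]] := l1_step zb zx; rewrite zn => -[z'n].
  have [az Lz] := hc _ _ z'b zb zz'.
  rewrite -natr1 mulrDr mulr1; apply: reach_trans (IH z' z'b (esym z'n)) _.
  exact: reach_edge.
apply: reachW (h _ z zb erefl); rewrite ler_wpM2l// ler_nat.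
apply: (@leq_trans (\sum_(i < d) N)); last by rewrite sum_nat_const card_ord.
apply: leq_sum => i _; move: zb; rewrite mem_box => /forallP /(_ i).
by rewrite -abszE lez_nat.
Qed.

Lemma length_tail (eps : R) : 0 < eps -> exists2 c, 0 <= c &
  forall x y : V, x != y -> (P (Le x y @^-1` `]c, +oo[) <= eps%:E)%E.
Proof.
move=> e0.
have [c c0 hc] : exists2 c, 0 <= c & (1 - eps%:E <= cdf L c)%E.
  apply: contrapT => h.
  have : (1%E <= 1 - eps%:E)%E.
    apply: (cvge_to_le (cvg_cdfy1 L)); exists 0; split => // c c0.
    by rewrite leNgt; apply/negP => /ltW ?; apply: h; exists c => //; exact: ltW.
  by rewrite -EFinB lee_fin; lra.
exists c => // x y xy; rewrite (length_lawE H xy)//.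
have -> : L @^-1` `]c, +oo[ = ~` (L @^-1` `]-oo, c]).
  by apply/seteqP; split => w /=; rewrite !in_itv/= andbT; [move/lt_geF => ->|move/negP; rewrite -ltNge].
rewrite probability_setC; last exact: measurable_funPTI.
have hf : P (L @^-1` `]-oo, c]) \is a fin_num by rewrite fin_num_measure//; exact: measurable_funPTI.
have hc' : (1 - eps%:E <= P (L @^-1` `]-oo, c]))%E by exact: hc.
by move: hf hc'; case: (P _) => // r _; rewrite -!EFinB !lee_fin; lra.
Qed.

Lemma box_reach_prob (N : nat) (delta : R) : 0 < delta -> exists2 A, 0 <= A &
  forall x : V, exists B : set O, [/\ measurable B, (P B <= delta%:E)%E &
    forall w, ~ B w -> forall z, z \in box x N -> reach w x z A].
Proof.
move=> de0.
pose n := ((N.*2.+1 ^ d) * (N.*2.+1 ^ d))%N.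
have n0 : 0 < n%:R :> R by rewrite ltr0n muln_gt0 !expn_gt0.
have [c c0 hc] := length_tail (divr_gt0 de0 n0).
exists (c * (d * N)%:R) => [|x]; first by rewrite mulr_ge0.
pose F (ab : V * V) : set O := if edist R ab.1 ab.2 == 1 then
  ~` edge_event adj ab.1 ab.2 `|` Le ab.1 ab.2 @^-1` `]c, +oo[ else set0.
have mF ab : measurable (F ab).
  rewrite /F; case: ifP => // _; apply: measurableU; last exact: measurable_funPTI.
  exact/measurableC/(sfp_adj_measurable H).
pose s := [seq (a, b) | a <- box x N, b <- box x N].
have sn : size s = n by rewrite size_allpairs !size_box.
exists (\big[setU/set0]_(ab <- s) F ab); split.
- exact: bigsetU_measurable.
- have := finite_union_bound (P := P) (s := s) mF (b := fun=> delta / n%:R).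
  rewrite big_const_seq count_predT iter_addr_0 sn.
  have -> : (delta / n%:R) *+ n = delta by rewrite -mulr_natr divfK ?gt_eqF.
  apply=> -[a b] _; rewrite /F /=.
  case: eqP => [ab1|_]; last by rewrite measure0 lee_fin divr_ge0 ?ltW.
  have nab : a != b.
    by apply/eqP => ab; have := nn_edge_null ab1; rewrite ab;
      move: ab1; rewrite ab /edist subrr /enorm big1 ?sqrtr0 => [/eqP|i _];
      [rewrite eq_sym oner_eq0|rewrite !mxE mulr0z expr0n].
  have mE := sfp_adj_measurable H a b.
  have mL : measurable (Le a b @^-1` `]c, +oo[) by exact: measurable_funPTI.
  have U : (P (~` edge_event adj a b `|` Le a b @^-1` `]c, +oo[) <=
      P (~` edge_event adj a b) + P (Le a b @^-1` `]c, +oo[))%E.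
    by apply: measureU2 => //; exact: measurableC.
  apply: (le_trans U).
  by rewrite nn_edge_null// add0e; exact: hc.
move=> w wB z zb; apply: lattice_reach => // a b ab bb ab1.
have {}wB : ~ F (a, b) w.
  move=> Fw; apply: wB; rewrite -bigcup_seq; exists (a, b) => //=.
  by apply/allpairsP; exists (a, b).
move: wB; rewrite /F /= ab1 eqxx => /not_orP[/contrapT ? ].
by rewrite /= in_itv/= andbT => /negP; rewrite -leNgt.
Qed.

End Reach.

Section Upper.
Context (dO : measure_display) (O : measurableType dO) (R : realType).
Context (P : probability O R) (d : nat) (alpha lambda : R) (W L : {RV P >-> R}).
Context (Wv : 'rV[int]_d -> {RV P >-> R}) (adj : O -> rel 'rV[int]_d).
Context (Le : 'rV[int]_d -> 'rV[int]_d -> {RV P >-> R}).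
Context (H : weighted_sfp alpha lambda W L Wv adj Le).
Context (L0 : P [set w | 0 <= L w] = 1%E).
Notation V := 'rV[int]_d.
Context (nu a2 ct dl : R).
Context (hd : (1 <= d)%N) (alpha0 : 0 < alpha) (l0 : 0 < lambda) (ct0 : 0 < ct) (dl0 : 0 < dl).
Context (hdl : 3 * dl = d%:R - nu * a2) (nu0 : 0 <= nu).
Context (hct : forall t, 0 <= t -> ct * expR (- (a2 * t)) <= tail W (expR t)).

(* At scale l the boxes have radius e^l and heavy means weight at least e^(nu l). *)
Definition radius (l : R) : nat := Num.truncn (expR l).
Definition threshold (l : R) : R := expR (nu * l).
Definition step_cost (l : R) : R := quantile L (expR (- (dl * l))).
Definition fail_bound (l : R) : R := expR (- (ct / 32 * expR (2 * dl * l))).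

Lemma conn_prob_half (x y : V) w (r u u' : R) : x != y -> edist R x y <= r ->
  0 < u -> 0 < u' -> u <= Wv x w -> u' <= Wv y w -> r `^ alpha <= lambda * u * u' ->
  2^-1 <= conn_prob alpha lambda Wv x y w.
Proof.
move=> xy xr u0 u'0 ux uy hr; rewrite /conn_prob; case: eqP => _; first by lra.
have r1 := edist_ge1 (R := R) xy.
have e0 : 0 < edist R x y `^ alpha by rewrite powR_gt0; lra.
have : 1 <= lambda * Wv x w * Wv y w / edist R x y `^ alpha.
  rewrite ler_pdivlMr// mul1r; apply: (@le_trans _ _ (r `^ alpha)).
    have ed0 := le_trans ler01 r1; have r0 := le_trans ed0 xr.
    by apply: ge0_ler_powR xr; rewrite ?nnegrE ?(ltW alpha0).
  apply: (le_trans hr); apply: ler_pM; rewrite ?mulr_ge0 ?(ltW l0) ?(ltW u0) ?(ltW u'0)//.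
  by rewrite ler_wpM2l ?(ltW l0).
set t := (X in 1 <= X) => t1.
have e2 : 2 <= expR t by apply: le_trans (expR_ge1Dx _); lra.
have : expR (- t) <= 2^-1 by rewrite expRN lef_pV2// posrE; lra.
lra.
Qed.

Lemma radius_le l : (radius l)%:R <= expR l.
Proof. by have /andP[] := truncn_itv (expR_ge0 l). Qed.

Lemma radius_nondec l l' : l <= l' -> (radius l <= radius l')%N.
Proof.
move=> ll; rewrite /radius truncn_ge_nat ?expR_ge0//; apply: le_trans (radius_le l) _.
by rewrite ler_expR.
Qed.

Lemma size_box_ge (x : V) l : expR l ^+ d <= (size (box x (radius l)))%:R.
Proof.
rewrite size_box natrX lerXn2r ?nnegrE ?expR_ge0//.
have /andP[_ h] := truncn_itv (expR_ge0 l).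
apply: (le_trans (ltW h)); rewrite ler_nat ltnS -addnn; exact: leq_addr.
Qed.

Lemma size_box_le (x : V) l : 0 <= l -> (size (box x (radius l)))%:R <= (3 * expR l) ^+ d.
Proof.
move=> l_ge0; rewrite size_box natrX lerXn2r ?nnegrE ?mulr_ge0 ?expR_ge0//.
have := radius_le l; have : 1 <= expR l by rewrite -expR0 ler_expR.
rewrite -addnn -natr1 natrD; lra.
Qed.

Lemma box_coord (x z : V) l i : z \in box x (radius l) -> `|z 0 i - x 0 i|%:~R <= expR l.
Proof.
rewrite mem_box => /forallP /(_ i) h; apply: le_trans (radius_le l).
by rewrite pmulrn ler_int.
Qed.

Lemma size_filter_ge (T : eqType) (s : seq T) v : uniq s ->
  (size s <= (size [seq z <- s | z != v]).+1)%N.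
Proof.
move=> us; have := count_predC (fun z => z != v) s; rewrite size_filter => <-.
rewrite -[leqRHS]addn1 leq_add2l.
have -> : count (predC (fun z => z != v)) s = count_mem v s.
  by apply: eq_count => z /=; rewrite negbK.
by rewrite count_uniq_mem//; case: (_ \in _).
Qed.

Lemma threshold_gt0 l : 0 < threshold l. Proof. exact: expR_gt0. Qed.

Lemma ln_threshold l : ln (threshold l) = nu * l. Proof. by rewrite /threshold expRK. Qed.

Lemma threshold_prob l : 0 <= l -> exists2 p, P [set w | threshold l <= W w] = p%:E &
  ct * expR (- (a2 * (nu * l))) <= p.
Proof.
move=> l_ge0; exists (fine (P [set w | threshold l <= W w])).
  by rewrite fineK// fin_num_measure//; exact: measurable_ge.
have h0 : 0 <= nu * l by rewrite mulr_ge0.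
apply: (le_trans (hct h0)); rewrite -lee_fin -tailE fineK.
  apply: le_measure; rewrite ?inE.
  - exact: measurable_gt.
  - exact: measurable_ge.
  - by move=> w /= /ltW.
by rewrite fin_num_measure//; exact: measurable_ge.
Qed.

Lemma expR_dim_ge (l : R) : 2 <= l -> 4 <= expR l ^+ d.
Proof.
move=> l2; rewrite -expRM_natl; apply: (@le_trans _ _ (expR 2)).
  have -> : 2 = 1 + 1 :> R by lra.
  rewrite expRD; have h := expR_ge1Dx (1 : R).
  apply: (@le_trans _ _ (2 * 2)); first by lra.
  by rewrite ler_pM//; lra.
rewrite ler_expR; apply: (le_trans l2); rewrite ler_peMl//; first by lra.
by rewrite ler1n.
Qed.

Lemma exponent_bound (l n p c : R) : 2 <= l -> expR l ^+ d <= 2 * n ->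
  ct * expR (- (a2 * (nu * l))) <= p -> expR (- (dl * l)) <= 16 * c ->
  expR (- (n * (c * p))) <= fail_bound l.
Proof.
move=> l2 hn hp hc; rewrite /fail_bound ler_expR lerN2.
have E : expR (2 * dl * l) = expR l ^+ d * (expR (- (dl * l)) * expR (- (a2 * (nu * l)))).
  rewrite -expRM_natl -!expRD; congr expR.
  have -> : d%:R = 3 * dl + nu * a2 by rewrite hdl subrK.
  by ring.
rewrite E; apply: (@le_trans _ _ ((expR l ^+ d / 2) * ((expR (- (dl * l)) / 16) *
    (ct * expR (- (a2 * (nu * l))))))).
  by rewrite le_eqVlt; apply/orP; left; apply/eqP; field.
have x0 : 0 <= expR l ^+ d by rewrite exprn_ge0 ?expR_ge0.
have y0 := expR_ge0 (- (dl * l)).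
have z0 : 0 <= ct * expR (- (a2 * (nu * l))) by rewrite mulr_ge0 ?expR_ge0// ltW.
apply: ler_pM; [by lra|by rewrite mulr_ge0//; lra|by lra|].
by apply: ler_pM; lra.
Qed.

Lemma distinct_star (v : V) Z : uniq Z -> v \notin Z ->
  distinct_edges (flatten (map (fun z => [:: (v, z)]) Z)).
Proof.
elim: Z => [//|z Z IH] /= /andP[zZ uZ]; rewrite in_cons negb_or => /andP[vz vZ].
rewrite distinct_edges_cons /= vz IH// andbT; apply/allP => f /flattenP[_ /mapP[y yZ ->]].
rewrite in_cons in_nil orbF => /eqP ->; apply/andP; split; apply/eqP => -[].
  by move=> yz; move: zZ; rewrite -yz yZ.
by move=> vz'; rewrite vz' eqxx in vz.
Qed.

Lemma distinct_bridge (v v' : V) Z : uniq Z -> v != v' -> v \notin Z -> v' \notin Z ->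
  distinct_edges (flatten (map (fun z => [:: (v, z); (z, v')]) Z)).
Proof.
move=> + vv'; elim: Z => [//|z Z IH] /= /andP[zZ uZ].
rewrite !in_cons !negb_or => /andP[vz vZ] /andP[v'z v'Z].
have rest f : f \in flatten (map (fun z => [:: (v, z); (z, v')]) Z) ->
    exists2 y, y \in Z & f = (v, y) \/ f = (y, v').
  move=> /flattenP[_ /mapP[y yZ ->]]; rewrite !in_cons in_nil orbF.
  by move=> /orP[/eqP ->|/eqP ->]; exists y => //; [left|right].
have zy y : y \in Z -> y != z by move=> yZ; apply: contraNneq zZ => <-.
rewrite !distinct_edges_cons /= IH// andbT vz [z == v']eq_sym v'z.
have neq a b a' b' : ((a, b) != (a', b') :> V * V) = (a != a') || (b != b').
  by rewrite xpair_eqE negb_and.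
rewrite !neq /= [z == v]eq_sym vz [v' == v]eq_sym vv' ?orbT /=.
apply/andP; split; apply/allP => f /rest[y yZ [->|->]]; rewrite !neq /=.
- by rewrite (zy _ yZ) vz !orbT.
- by rewrite (memPn vZ _ yZ) (zy _ yZ).
- by rewrite vv' vz.
- by rewrite (zy _ yZ) v'z orbT.
Qed.

Lemma powR_threshold l l' : alpha * (ln (4 * d%:R) + l') <= ln lambda + nu * (l + l') ->
  (4 * d%:R * expR l') `^ alpha <= lambda * threshold l * threshold l'.
Proof.
move=> hl; have d0 : 0 < 4 * d%:R :> R by rewrite mulr_gt0// ltr0n.
have t0 := threshold_gt0; have e0 := expR_gt0 l'.
have p1 : 0 < lambda * threshold l by rewrite mulr_gt0.
have p2 : 0 < lambda * threshold l * threshold l' by rewrite mulr_gt0.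
rewrite powR_expR; last by rewrite mulr_gt0.
rewrite -ler_ln ?posrE ?expR_gt0// expRK lnM ?posrE// expRK.
by rewrite (lnM p1 (t0 _)) (lnM l0 (t0 _)) !ln_threshold; lra.
Qed.

Definition step_fail (x v : V) (l l' : R) : set O :=
  heavy Wv (threshold l) [:: v] `&`
  \big[setI/setT]_(z <- [seq z <- box x (radius l') | z != v])
    ~` star_event Wv adj Le (threshold l') `]-oo, step_cost l'] (fun z => [:: (v, z)]) z.

Lemma step_fail_prob x v l l' : l <= l' -> 2 <= l' ->
  v \in box x (radius l) ->
  alpha * (ln (4 * d%:R) + l') <= ln lambda + nu * (l + l') ->
  (P (step_fail x v l l') <= (fail_bound l')%:E)%E.
Proof.
move=> ll' l2 vb hl; set Z := [seq z <- box x (radius l') | z != v].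
have d0 : 0 < 4 * d%:R :> R by rewrite mulr_gt0// ltr0n.
have l'0 : 0 <= l' by lra.
have [p pE hp] := threshold_prob l'0.
pose D := `]-oo, step_cost l']%classic.
have mD : measurable D by exact: measurable_itv.
pose kap := fine (P (L @^-1` D)).
have kapE : P (L @^-1` D) = kap%:E.
  by rewrite /kap fineK// fin_num_measure//; exact: measurable_funPTI.
have kap_ge : expR (- (dl * l')) <= kap.
  rewrite -lee_fin -kapE; apply: (distribution_le_quantile L0); first exact: expR_gt0.
  by rewrite expR_lt1 oppr_lt0 mulr_gt0//; lra.
pose c := expR (- (dl * l')) / 2.
have c01 : 0 <= c <= 1.
  have : expR (- (dl * l')) <= 1 by rewrite expR_le1 oppr_le0 mulr_ge0// ltW.
  by have := expR_ge0 (- (dl * l')); rewrite /c => h1 h2; apply/andP; split; lra.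
have uZ : uniq Z by rewrite filter_uniq// uniq_box.
have vZ : v \notin Z by rewrite mem_filter eqxx.
have h := @star_fail _ _ _ _ _ _ _ _ _ _ _ _ H [:: v] Z (threshold l) (threshold l') c kap p D
  (fun z => [:: (v, z)]) l0 (expR_ge0 _) (expR_ge0 _) uZ mD c01 kapE pE.
apply: (le_trans (h _ _ _)).
- move=> Z1 uZ1 sZ1; apply: distinct_star => //.
  by apply: contra vZ => /sZ1.
- move=> z e zZ /=; rewrite inE => /eqP -> /=.
  by rewrite !in_cons !eqxx !orbT.
- move=> z w zZ /heavyE hv hz; rewrite big_seq1 /c.
  apply: (ler_pM (expR_ge0 _) _ kap_ge); first by rewrite invr_ge0.
  move: zZ; rewrite mem_filter => /andP[zv zb].
  apply: (@conn_prob_half _ _ w (4 * d%:R * expR l') (threshold l) (threshold l'));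
    rewrite ?expR_gt0//; first by rewrite eq_sym.
  + rewrite mulrAC mulrC; apply: edist_le; first by rewrite mulr_ge0 ?expR_ge0.
    move=> i; apply: (@le_trans _ _ (expR l + expR l')).
      apply: le_trans (lerD (box_coord i vb) (box_coord i zb)).
      rewrite -intrD ler_int [`|z 0 i - _|]distrC; exact: ler_distD.
    have : expR l <= expR l' by rewrite ler_expR.
    by have := expR_ge0 l'; lra.
  + by apply: hv; rewrite mem_head.
  + by apply: powR_threshold.
- rewrite lee_fin; apply: exponent_bound => //; last first.
    by rewrite /c; have := expR_ge0 (- (dl * l')); lra.
  have := size_filter_ge v (uniq_box x (radius l')); rewrite -/Z -(ler_nat R) -natr1.
  by have := size_box_ge x l'; have := expR_dim_ge l2; lra.
Qed.

Definition init_fail (x : V) (l : R) : set O :=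
  heavy Wv (threshold l) [::] `&` \big[setI/setT]_(z <- box x (radius l))
    ~` star_event Wv adj Le (threshold l) setT (fun=> [::]) z.

Lemma init_fail_prob x l : 2 <= l -> (P (init_fail x l) <= (fail_bound l)%:E)%E.
Proof.
move=> l2; have l_ge0 : 0 <= l by lra.
have [p pE hp] := threshold_prob l_ge0.
have kapE : P (L @^-1` setT) = (1 : R)%:E by exact: probability_setT.
have c01 : 0 <= (1 : R) <= 1 by rewrite ler01 lexx.
have h := @star_fail _ _ _ _ _ _ _ _ _ _ _ _ H [::] (box x (radius l)) (threshold l) (threshold l)
  1 1 p setT (fun=> [::]) l0 (expR_ge0 _) (expR_ge0 _) (uniq_box _ _) measurableT c01 kapE pE.
apply: (le_trans (h _ _ _)) => //.
- by move=> Z1 _ _; elim: Z1.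
- by move=> z w _ _ _; rewrite big_nil.
- rewrite lee_fin; apply: exponent_bound => //.
    by have := size_box_ge x l; have : 0 <= (size (box x (radius l)))%:R :> R by []; lra.
  have : expR (- (dl * l)) <= 1 by rewrite expR_le1 oppr_le0 mulr_ge0// ltW.
  by lra.
Qed.

Definition bridge_fail (x v v' : V) (l c : R) : set O :=
  heavy Wv (threshold l) [:: v; v'] `&`
  \big[setI/setT]_(z <- [seq z <- [seq z <- box 0 (radius l) | z != v] | z != v'])
    ~` star_event Wv adj Le (threshold l) `]-oo, c] (fun z => [:: (v, z); (z, v')]) z.

Lemma bridge_fail_prob x v v' l c : 2 <= l -> v != v' ->
  v \in box 0 (radius l) -> v' \in box x (radius l) ->
  (forall i, `|x 0 i|%:~R <= 2 * expR l) ->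
  ((2^-1)%:E <= P (L @^-1` `]-oo, c]))%E ->
  alpha * (ln (4 * d%:R) + l) <= ln lambda + nu * (l + l) ->
  (P (bridge_fail x v v' l c) <= (fail_bound l)%:E)%E.
Proof.
move=> l2 vv' vb vb' hx hkap hl.
set Z := [seq z <- [seq z <- box 0 (radius l) | z != v] | z != v'].
have d0 : 0 < 4 * d%:R :> R by rewrite mulr_gt0// ltr0n.
have l_ge0 : 0 <= l by lra.
have [p pE hp] := threshold_prob l_ge0.
pose D := `]-oo, c]%classic.
have mD : measurable D by exact: measurable_itv.
pose kap := fine (P (L @^-1` D)).
have kapE : P (L @^-1` D) = kap%:E.
  by rewrite /kap fineK// fin_num_measure//; exact: measurable_funPTI.
have kap_ge : 2^-1 <= kap by rewrite -lee_fin -kapE.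
have c01 : 0 <= (16^-1 : R) <= 1 by apply/andP; split; lra.
have uZ : uniq Z by rewrite !filter_uniq// uniq_box.
have vZ : v \notin Z by rewrite !mem_filter eqxx /= andbF.
have v'Z : v' \notin Z by rewrite mem_filter eqxx.
have h := @star_fail _ _ _ _ _ _ _ _ _ _ _ _ H [:: v; v'] Z (threshold l) (threshold l)
  16^-1 kap p D
  (fun z => [:: (v, z); (z, v')]) l0 (expR_ge0 _) (expR_ge0 _) uZ mD c01 kapE pE.
have pw : (4 * d%:R * expR l) `^ alpha <= lambda * threshold l * threshold l.
  exact: powR_threshold.
apply: (le_trans (h _ _ _)).
- move=> Z1 uZ1 sZ1; apply: distinct_bridge => //.
    by apply: contra vZ => /sZ1.
  by apply: contra v'Z => /sZ1.
- move=> z e zZ /=; rewrite !inE => /orP[|] /eqP -> /=.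
    by rewrite !eqxx !orbT.
  by rewrite !eqxx !orbT.
- move=> z w zZ /heavyE hv hz; rewrite big_cons big_seq1 /=.
  move: zZ; rewrite !mem_filter => /andP[zv' /andP[zv zb]].
  have zc i := box_coord i zb; have vc i := box_coord i vb; have v'c i := box_coord i vb'.
  have c1 : 2^-1 <= conn_prob alpha lambda Wv v z w.
    apply: (@conn_prob_half _ _ w (4 * d%:R * expR l) (threshold l) (threshold l));
      rewrite ?expR_gt0//; first by rewrite eq_sym.
    + rewrite mulrAC mulrC; apply: edist_le; first by rewrite mulr_ge0 ?expR_ge0.
      move=> i; apply: (@le_trans _ _ (expR l + expR l)).
        apply: le_trans (lerD (vc i) (zc i)).
        rewrite -intrD ler_int [`|z 0 i - _|]distrC; exact: ler_distD.
      by have := expR_ge0 l; lra.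
    + by apply: hv; rewrite mem_head.
  have c2 : 2^-1 <= conn_prob alpha lambda Wv z v' w.
    apply: (@conn_prob_half _ _ w (4 * d%:R * expR l) (threshold l) (threshold l));
      rewrite ?expR_gt0//.
    + rewrite mulrAC mulrC; apply: edist_le; first by rewrite mulr_ge0 ?expR_ge0.
      move=> i; apply: (@le_trans _ _ (expR l + (2 * expR l + expR l))); last first.
        by have := expR_ge0 l; lra.
      apply: le_trans (lerD (zc i) (lerD (hx i) (v'c i))).
      rewrite -!intrD ler_int mxE subr0.
      apply: le_trans (ler_normB _ _) _; rewrite lerD2l.
      by rewrite -[X in `|X| <= _](subrK (x 0 i)) addrC; exact: ler_normD.
    + by apply: hv; rewrite !in_cons eqxx orbT.
  have -> : 16^-1 = (2^-1 * 2^-1) * (2^-1 * 2^-1) :> R by field.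
  have h0 : 0 <= 2^-1 :> R by rewrite invr_ge0.
  have h00 := mulr_ge0 h0 h0.
  exact: (ler_pM h00 h00 (ler_pM h0 h0 kap_ge c1) (ler_pM h0 h0 kap_ge c2)).
- rewrite lee_fin; apply: exponent_bound => //; last first.
    have : expR (- (dl * l)) <= 1 by rewrite expR_le1 oppr_le0 mulr_ge0// ltW.
    by rewrite divff.
  have h1 := size_filter_ge v (uniq_box 0 (radius l)).
  have h2 := size_filter_ge v' (filter_uniq (fun z => z != v) (uniq_box (0 : V) (radius l))).
  rewrite -/Z in h2; have {}h1 := leq_trans h1 (h2 : (_ < _.+2)%N).
  move: h1; rewrite -(ler_nat R) -addn2 natrD.
  by have := size_box_ge 0 l; have := expR_dim_ge l2; lra.
Qed.

End Upper.

Section Chain.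
Context (dO : measure_display) (O : measurableType dO) (R : realType).
Context (P : probability O R) (d : nat) (alpha lambda : R) (W L : {RV P >-> R}).
Context (Wv : 'rV[int]_d -> {RV P >-> R}) (adj : O -> rel 'rV[int]_d).
Context (Le : 'rV[int]_d -> 'rV[int]_d -> {RV P >-> R}).
Context (H : weighted_sfp alpha lambda W L Wv adj Le).
Context (L0 : P [set w | 0 <= L w] = 1%E).
Notation V := 'rV[int]_d.
Context (nu a2 ct dl : R).
Context (hd : (1 <= d)%N) (alpha0 : 0 < alpha) (l0 : 0 < lambda) (ct0 : 0 < ct) (dl0 : 0 < dl).
Context (hdl : 3 * dl = d%:R - nu * a2) (nu0 : 0 <= nu).
Context (hct : forall t, 0 <= t -> ct * expR (- (a2 * t)) <= tail W (expR t)).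

Notation step_cost := (step_cost L dl).
Notation fail_bound := (fail_bound ct dl).

Lemma fail_decay : exists2 ls, 2 <= ls & forall l, ls <= l ->
  ((3 * expR l) ^+ d) ^+ 2 * fail_bound l <= expR (- l).
Proof.
pose B := (4 * d%:R + 1) * 16 / (ct * dl ^+ 2).
have cd0 : 0 < ct * dl ^+ 2 by rewrite mulr_gt0// exprn_gt0.
have B0 : 0 <= B by rewrite divr_ge0 ?(ltW cd0)// mulr_ge0// addr_ge0// mulr_ge0.
exists (2 + B) => [|l hl]; first by rewrite lerDl.
have l2 : 2 <= l by lra.
have h3 : 3 * expR l <= expR (2 * l).
  have -> : 2 * l = l + l by ring.
  rewrite expRD ler_wpM2r ?expR_ge0//.
  by have := expR_ge1Dx l; lra.
have h4 : ((3 * expR l) ^+ d) ^+ 2 <= expR (4 * d%:R * l).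
  rewrite -exprM (_ : 4 * d%:R * l = (d * 2)%:R * (2 * l)); last by rewrite natrM; ring.
  by rewrite expRM_natl; apply: lerXn2r h3; rewrite ?nnegrE ?mulr_ge0 ?expR_ge0.
have x0 : 0 <= 2 * dl * l by rewrite !mulr_ge0 ?(ltW dl0)//; lra.
have hx := expR_ge_half_sqr x0.
apply: (@le_trans _ _ (expR (4 * d%:R * l) * fail_bound l)).
  by rewrite ler_wpM2r ?expR_ge0.
rewrite -expRD ler_expR.
have hB : (4 * d%:R + 1) * 16 <= l * (ct * dl ^+ 2).
  by rewrite -ler_pdivrMr// -/B; lra.
have h5 : ct / 32 * ((2 * dl * l) ^+ 2 / 2) <= ct / 32 * expR (2 * dl * l).
  by rewrite ler_wpM2l// divr_ge0// ltW.
have E : ct / 32 * ((2 * dl * l) ^+ 2 / 2) = l * (ct * dl ^+ 2) * l / 16 by field.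
rewrite E in h5.
have h6 : (4 * d%:R + 1) * 16 * l <= l * (ct * dl ^+ 2) * l by rewrite ler_wpM2r//; lra.
set a := 4 * d%:R + 1 in h6.
have -> : 4 * d%:R * l = a * l - l by rewrite /a; ring.
have {}h6 : a * l * 16 <= l * (ct * dl ^+ 2) * l by move: h6; rewrite mulrAC.
lra.
Qed.

Lemma not_all_compl (I : choiceType) (Z : seq I) (C : I -> set O) w :
  ~ (\big[setI/setT]_(z <- Z) ~` C z) w -> exists2 z, z \in Z & C z w.
Proof.
move=> h; apply: contrapT => h'; apply: h.
rewrite -(bigcap_seq Z (fun z => ~` C z)) => z /= zZ Cz.
by apply: h'; exists z.
Qed.

Context (th lam0 : R) (th1 : 1 < th) (lam2 : 2 <= lam0).
Context (hdecay : forall l, lam0 <= l ->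
  ((3 * expR l) ^+ d) ^+ 2 * fail_bound l <= expR (- l)).
Context (hconn : forall l, lam0 <= l ->
  alpha * (ln (4 * d%:R) + th * l) <= ln lambda + nu * (l + th * l)).

Notation lev k := (lam0 * th ^+ k).

Lemma lev_ge k : lam0 <= lev k.
Proof. by have h := th1; have h2 := lam2; rewrite ler_peMr ?exprn_ege1//; lra. Qed.

Lemma levS k : lev k.+1 = th * lev k. Proof. by rewrite exprS mulrCA. Qed.

Lemma lev_nondec k : lev k <= lev k.+1.
Proof.
rewrite levS ler_peMl//; first by apply: le_trans (lev_ge k); apply: le_trans lam2.
exact: ltW.
Qed.

Definition chain_fail (x : V) (K : nat) : set O :=
  init_fail Wv adj Le nu x lam0 `|`
  \big[setU/set0]_(k <- iota 0 K) \big[setU/set0]_(v <- box x (radius (lev k)))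
    step_fail L Wv adj Le nu dl x v (lev k) (lev k.+1).

Lemma measurable_step_fail x v l l' : measurable (step_fail L Wv adj Le nu dl x v l l').
Proof.
apply: measurableI; first exact: measurable_heavy.
elim/big_ind: _ => //; first exact: measurableI.
by move=> z _; apply: measurableC; apply: (measurable_star_event H).
Qed.

Lemma measurable_init_fail x l : measurable (init_fail Wv adj Le nu x l).
Proof.
apply: measurableI; first exact: measurable_heavy.
elim/big_ind: _ => //; first exact: measurableI.
by move=> z _; apply: measurableC; apply: (measurable_star_event H).
Qed.

Lemma measurable_chain_fail x K : measurable (chain_fail x K).
Proof.
apply: measurableU; first exact: measurable_init_fail.
apply: bigsetU_measurable => k _; apply: bigsetU_measurable => v _.
exact: measurable_step_fail.
Qed.

Lemma fail_bound_box (x : V) l l' : 0 <= l -> l <= l' -> lam0 <= l' ->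
  (size (box x (radius l)))%:R * fail_bound l' <= expR (- l').
Proof.
move=> l_ge0 ll' hl'; apply: le_trans (hdecay hl').
rewrite ler_wpM2r ?expR_ge0//; apply: (le_trans (size_box_le x l_ge0)).
have e1 : 1 <= 3 * expR l'.
  by have := expR_ge1Dx l'; lra.
have e2 : 3 * expR l <= 3 * expR l' by rewrite ler_wpM2l// ler_expR.
have e3 : 0 <= 3 * expR l by rewrite mulr_ge0 ?expR_ge0.
apply: (@le_trans _ _ ((3 * expR l') ^+ d)).
  by apply: lerXn2r; rewrite ?nnegrE//; exact: le_trans e2.
by rewrite ler_eXnr// exprn_ege1.
Qed.

Lemma chain_fail_prob x K : expR (- (lam0 * (th - 1))) <= 2^-1 ->
  (P (chain_fail x K) <= (2 * expR (- lam0))%:E)%E.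
Proof.
move=> hq.
pose q := expR (- (lam0 * (th - 1))).
have lev_le k : expR (- lev k) <= expR (- lam0) * q ^+ k.
  have -> : expR (- lam0) * q ^+ k = expR (- (lam0 * (1 + k%:R * (th - 1)))).
    by rewrite /q -expRM_natl -expRD; congr expR; ring.
  rewrite ler_expR lerN2; have := bernoulli k (ltW th1) => h.
  exact: (ler_wpM2l (le_trans (ler0n R 2) lam2) h).
have lg k := lev_ge k.
have U1 : (P (\big[setU/set0]_(k <- iota 0 K) \big[setU/set0]_(v <- box x (radius (lev k)))
    step_fail L Wv adj Le nu dl x v (lev k) (lev k.+1)) <=
    (\sum_(k <- iota 0 K) expR (- lam0) * q ^+ k.+1)%:E)%E.
  apply: finite_union_bound => k.
    by apply: bigsetU_measurable => v _; exact: measurable_step_fail.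
  move=> _; apply: (@le_trans _ _ ((size (box x (radius (lev k))))%:R * fail_bound (lev k.+1))%:E).
    have -> : (size (box x (radius (lev k))))%:R * fail_bound (lev k.+1) =
        \sum_(v <- box x (radius (lev k))) fail_bound (lev k.+1).
      by rewrite big_const_seq count_predT iter_addr_0 mulr_natl.
    apply: finite_union_bound => v; first exact: measurable_step_fail.
    move=> vb; apply: (step_fail_prob H L0 hd alpha0 l0 ct0 dl0 hdl nu0 hct) => //.
    - exact: lev_nondec.
    - exact: le_trans lam2 (lg _).
    - by rewrite levS; apply: hconn.
  rewrite lee_fin; apply: le_trans (lev_le k.+1); apply: fail_bound_box => //.
    by apply: le_trans (lg k); exact: le_trans lam2.
  exact: lev_nondec.
have U0 : (P (init_fail Wv adj Le nu x lam0) <= (expR (- lam0))%:E)%E.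
  apply: (le_trans (init_fail_prob H l0 ct0 dl0 hdl nu0 hct x lam2)).
  rewrite lee_fin; apply: le_trans (hdecay (lexx _)); rewrite ler_peMl ?expR_ge0//.
  rewrite -exprM exprn_ege1//; have := expR_ge1Dx lam0; have := lam2; lra.
have mI := measurable_init_fail x lam0.
have mU : measurable (\big[setU/set0]_(k <- iota 0 K)
    \big[setU/set0]_(v <- box x (radius (lev k)))
    step_fail L Wv adj Le nu dl x v (lev k) (lev k.+1)).
  by apply: bigsetU_measurable => k _; apply: bigsetU_measurable => v _;
    exact: measurable_step_fail.
have U2 : (P (chain_fail x K) <= P (init_fail Wv adj Le nu x lam0) +
  P (\big[setU/set0]_(k <- iota 0 K) \big[setU/set0]_(v <- box x (radius (lev k)))
    step_fail L Wv adj Le nu dl x v (lev k) (lev k.+1)))%E by exact: measureU2.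
apply: (le_trans U2); apply: (le_trans (leeD U0 U1)); rewrite -EFinD lee_fin.
have q01 : 0 <= q < 1 by rewrite expR_ge0/=; apply: le_lt_trans hq _; lra.
have := geometric_sum_le K.+1 q01.
rewrite big_nat_recl//= expr0 => S.
rewrite -mulr_sumr -[X in X + _]mulr1 -mulrDr mulrC ler_wpM2r ?expR_ge0//.
rewrite /index_iota subn0 in S; apply: (le_trans S).
rewrite -[leRHS]invrK lef_pV2 ?posrE ?invr_gt0//; last by have /andP[_] := q01; lra.
by rewrite /q in hq *; lra.
Qed.

Lemma chain_reach x K w : ~ chain_fail x K w ->
  exists v0 v, [/\ v0 \in box x (radius lam0), v \in box x (radius (lev K)),
    threshold nu (lev K) <= Wv v w &
    reach adj Le w v0 v (\sum_(k <- iota 0 K) step_cost (lev k.+1))].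
Proof.
elim: K => [|K IH] wf.
  have wi : ~ init_fail Wv adj Le nu x lam0 w by move=> h; apply: wf; left.
  have : ~ (\big[setI/setT]_(z <- box x (radius lam0))
      ~` star_event Wv adj Le (threshold nu lam0) setT (fun=> [::]) z) w.
    by move=> h; apply: wi; split => //; apply/heavyE.
  move=> /not_all_compl[z zb [zt _]]; exists z, z; rewrite expr0 mulr1; split => //.
    by move: zt; rewrite /ray /= in_itv/= andbT.
  by rewrite big_nil; exact: reach_refl.
have [] := IH.
  move=> [h|h]; apply: wf; [by left|right].
  by rewrite -addn1 iotaD big_cat; left.
move=> v0 [v [v0b vb vt vr]].
have ws : ~ step_fail L Wv adj Le nu dl x v (lev K) (lev K.+1) w.
  move=> h; apply: wf; right; rewrite -addn1 iotaD big_cat; right.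
  by rewrite big_seq1 add0n -bigcup_seq; exists v.
have : ~ (\big[setI/setT]_(z <- [seq z <- box x (radius (lev K.+1)) | z != v])
    ~` star_event Wv adj Le (threshold nu (lev K.+1)) `]-oo, step_cost (lev K.+1)]
      (fun z => [:: (v, z)]) z) w.
  move=> h; apply: ws; split => //; apply/heavyE => y.
  by rewrite in_cons in_nil orbF => /eqP ->.
move=> /not_all_compl[z]; rewrite mem_filter => /andP[zv zb] [zt [ze zl]].
exists v0, z; split => //; first by move: zt; rewrite /ray /= in_itv/= andbT.
rewrite -addn1 iotaD big_cat big_seq1 add0n /=; apply: reach_trans vr _.
apply: reach_edge; last 2 first.
- by rewrite eq_sym.
- by move: zl; rewrite /lengths_in big_seq1 /= in_itv/=.
- by move: ze; rewrite /all_edges big_seq1.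
Qed.

End Chain.

(** * The upper bound *)

Section UpperTheorem.
Context (dO : measure_display) (O : measurableType dO) (R : realType).
Context (P : probability O R) (d : nat) (alpha lambda tau gamma : R) (ell : R -> R).
Context (W L : {RV P >-> R}).
Context (Wv : 'rV[int]_d -> {RV P >-> R}) (adj : O -> rel 'rV[int]_d).
Context (Le : 'rV[int]_d -> 'rV[int]_d -> {RV P >-> R}) (e : 'rV[R]_d).
Context (hd : (1 <= d)%N) (halpha : d%:R < alpha) (hlambda : 0 < lambda).
Context (htau : 1 < tau) (hell : slowly_varying ell).
Context (hWtail : forall t : R, 0 < t ->
  P [set w | t < W w] = (ell t / t `^ (tau - 1))%:E).
Context (hgamma : gamma = alpha * (tau - 1) / d%:R).
Context (g1 : 1 < gamma) (g2 : gamma < 2).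
Context (hL0 : P [set w | 0 <= L w] = 1%E) (hL : explosion_integral L = +oo%E).
Context (hSFP : weighted_sfp alpha lambda W L Wv adj Le) (he : enorm e = 1).
Notation V := 'rV[int]_d.
Notation eta := (growth_rate gamma).

(* In the limit th = 1 / (gamma - 1) the exponents are nu = d / (tau - 1) and
   a2 = tau - 1, for which nu (1 + 1 / th) = alpha and nu a2 = d. *)
Lemma upper_exponents (th : R) : 0 < th -> th < (gamma - 1)^-1 -> exists nu a2 dl : R,
  [/\ 0 < nu, alpha < nu * (1 + th^-1), tau - 1 < a2, 0 < dl & 3 * dl = d%:R - nu * a2].
Proof.
have := g1; have := htau => htau' g1' th0 hth.
have t0 : 0 < tau - 1 by lra.
have g0 : 0 < gamma - 1 by lra.
have a0 : 0 < alpha by apply: lt_trans halpha; rewrite ltr0n.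
have d0 : 0 < d%:R :> R by rewrite ltr0n.
have thV : gamma < 1 + th^-1.
  have : gamma - 1 < th^-1 by rewrite -[ltLHS]invrK ltf_pV2// posrE invr_gt0.
  lra.
have c0 : 0 < 1 + th^-1 by lra.
have [nu n1 n2] : exists2 nu, alpha / (1 + th^-1) < nu & nu < d%:R / (tau - 1).
  apply: midpoint_exists; rewrite ltr_pdivrMr// mulrAC ltr_pdivlMr//.
  have -> : alpha * (tau - 1) = gamma * d%:R by rewrite hgamma divfK// gt_eqF.
  by rewrite mulrC ltr_pM2l.
have nu0 : 0 < nu by apply: lt_trans n1; rewrite divr_gt0.
have [a2 b1 b2] : exists2 a2, tau - 1 < a2 & a2 < d%:R / nu.
  apply: midpoint_exists; rewrite ltr_pdivlMr// mulrC.
  by move: n2; rewrite ltr_pdivlMr.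
exists nu, a2, ((d%:R - nu * a2) / 3); split => //.
- by rewrite -ltr_pdivrMr.
- by rewrite divr_gt0// subr_gt0 mulrC -ltr_pdivlMr.
- by rewrite mulrC divfK.
Qed.

Definition negative_length : set O :=
  \bigcup_(ab : V * V) (if ab.1 != ab.2 then Le ab.1 ab.2 @^-1` `]-oo, 0[ else set0).

Lemma measurable_negative_length : measurable negative_length.
Proof.
apply: countable_bigcupT_measurable => // ab.
by case: ifP => // _; exact: measurable_funPTI.
Qed.

Lemma negative_length_null : P negative_length = 0%E.
Proof.
apply/eqP; rewrite eq_le measure_ge0 andbT.
apply: (union_bound (b := fun=> 0)) => [ab|ab|s _]; last by rewrite big1.
  by case: ifP => // _; exact: measurable_funPTI.
case: ifP => [nab|_]; last by rewrite measure0.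
rewrite (length_lawE hSFP)//.
have -> : L @^-1` `]-oo, 0[ = ~` [set w | 0 <= L w].
  apply/seteqP; split => w /=; first by rewrite in_itv/= ltNge => /negP.
  by move=> /negP; rewrite -ltNge in_itv.
by rewrite probability_setC ?hL0 ?subee//; exact: measurable_ge.
Qed.

Definition any_bridge_fail (nu : R) (x : V) (l c : R) : set O :=
  \big[setU/set0]_(v <- box 0 (radius l)) \big[setU/set0]_(v' <- box x (radius l))
    (if v != v' then bridge_fail Wv adj Le nu x v v' l c else set0).

Lemma measurable_bridge_fail nu x v v' l c :
  measurable (bridge_fail Wv adj Le nu x v v' l c).
Proof.
apply: measurableI; first exact: measurable_heavy.
elim/big_ind: _ => //; first exact: measurableI.
by move=> z _; apply: measurableC; apply: (measurable_star_event hSFP).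
Qed.

Lemma measurable_any_bridge_fail nu x l c : measurable (any_bridge_fail nu x l c).
Proof.
apply: bigsetU_measurable => v _; apply: bigsetU_measurable => v' _.
by case: ifP => // _; exact: measurable_bridge_fail.
Qed.

Lemma bridge_reach nu x l c v v' w : 0 <= c -> ~ any_bridge_fail nu x l c w ->
  v \in box 0 (radius l) -> v' \in box x (radius l) ->
  threshold nu l <= Wv v w -> threshold nu l <= Wv v' w -> reach adj Le w v v' (2 * c).
Proof.
move=> c0 wf vb vb' tv tv'.
have [->|vv'] := eqVneq v v'.
  by apply: reachW (reach_refl _ _ _ _); rewrite mulr_ge0.
have nb : ~ bridge_fail Wv adj Le nu x v v' l c w.
  move=> h; apply: wf; rewrite /any_bridge_fail -bigcup_seq; exists v => //.
  by rewrite -bigcup_seq; exists v' => //; rewrite vv'.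
have : ~ (\big[setI/setT]_(z <- [seq z <- [seq z <- box 0 (radius l) | z != v] | z != v'])
    ~` star_event Wv adj Le (threshold nu l) `]-oo, c] (fun z => [:: (v, z); (z, v')]) z) w.
  move=> h; apply: nb; split => //; apply/heavyE => y.
  by rewrite !inE => /orP[|] /eqP ->.
move=> /not_all_compl[z]; rewrite !mem_filter => /and3P[zv' zv _] [_ [ze zl]].
move: ze zl; rewrite /all_edges /lengths_in !big_cons !big_nil => -[e1 [e2 _]] [l1 [l2 _]].
rewrite mulrDl !mul1r; apply: (@reach_trans _ _ _ _ _ _ _ _ _ z).
  by apply: reach_edge => //; rewrite eq_sym.
exact: reach_edge.
Qed.

Lemma any_bridge_fail_prob nu a2 ct dl (x : V) l c :
  0 < ct -> 0 < dl -> 3 * dl = d%:R - nu * a2 -> 0 <= nu ->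
  (forall t, 0 <= t -> ct * expR (- (a2 * t)) <= tail W (expR t)) ->
  2 <= l -> (forall i, `|x 0 i|%:~R <= 2 * expR l) ->
  ((2^-1)%:E <= P (L @^-1` `]-oo, c]))%E ->
  alpha * (ln (4 * d%:R) + l) <= ln lambda + nu * (l + l) ->
  (P (any_bridge_fail nu x l c) <=
   (((3 * expR l) ^+ d) ^+ 2 * fail_bound ct dl l)%:E)%E.
Proof.
move=> ct0 dl0 hdl nu0 hct l2 hx hc hl.
have alpha0 : 0 < alpha by apply: lt_trans halpha; rewrite ltr0n.
pose n (v : V) : R := (size (box v (radius l)))%:R.
have n_le v : n v <= (3 * expR l) ^+ d by apply: size_box_le; exact: le_trans l2.
have f0 : 0 <= fail_bound ct dl l by exact: expR_ge0.
apply: (@le_trans _ _ (n 0 * (n x * fail_bound ct dl l))%:E); last first.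
  by rewrite lee_fin mulrA ler_wpM2r// expr2 ler_pM//; exact: ler0n.
have sumE (s : seq V) (y : R) : (size s)%:R * y = \sum_(v <- s) y.
  by rewrite big_const_seq count_predT iter_addr_0 mulr_natl.
rewrite /n !sumE; apply: finite_union_bound => v.
  by apply: bigsetU_measurable => v' _; case: ifP => // _; exact: measurable_bridge_fail.
move=> vb; apply: finite_union_bound => v'.
  by case: ifP => // _; exact: measurable_bridge_fail.
move=> vb'; case: ifP => [vv'|_]; last by rewrite measure0 lee_fin.
exact: (bridge_fail_prob hSFP hd alpha0 hlambda ct0 dl0 hdl nu0 hct).
Qed.

Lemma connection_scale (th nu : R) : 1 < th -> 0 <= nu -> alpha < nu * (1 + th^-1) ->
  exists2 l1 : R, 0 <= l1 & forall l, l1 <= l ->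
    alpha * (ln (4 * d%:R) + th * l) <= ln lambda + nu * (l + th * l) /\
    alpha * (ln (4 * d%:R) + l) <= ln lambda + nu * (l + l).
Proof.
move=> th1 nu0 hnu; set a := ln (4 * d%:R); set b := ln lambda.
have th0 : 0 < th by lra.
pose kap := nu * (1 + th^-1) - alpha.
have kap0 : 0 < kap by rewrite subr_gt0.
exists (`|alpha * a - b| / kap) => [|l hl]; first by rewrite divr_ge0// ltW.
have l0 : 0 <= l by apply: le_trans hl; rewrite divr_ge0// ltW.
have hk l' : l <= l' -> alpha * a - b <= kap * l'.
  move=> ll'; apply: (le_trans (ler_norm _)).
  by rewrite [leRHS]mulrC -ler_pdivrMr//; exact: le_trans hl ll'.
have thl : l <= th * l by rewrite ler_peMl// ltW.
split.
  have := hk _ thl; rewrite /kap.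
  have -> : (nu * (1 + th^-1) - alpha) * (th * l) = nu * (th * l) + nu * l - alpha * (th * l).
    by field; rewrite gt_eqF.
  rewrite !mulrDr; move: (nu * (th * l)) (nu * l) (alpha * (th * l)) => ? ? ?; lra.
have := hk _ (lexx l).
have : nu * (1 + th^-1) * l <= nu * (1 + 1) * l.
  by rewrite ler_wpM2r// ler_wpM2l// lerD2l invf_le1// ltW.
rewrite /kap mulrBl; move: (nu * (1 + th^-1) * l) => u; rewrite !mulrDr mulrDl mulr1.
move: (nu * l) (alpha * l) => ? ?; lra.
Qed.

Lemma start_scale (ct dl th delta : R) : 0 < ct -> 0 < dl -> 1 < th -> 0 < delta ->
  exists2 b : R, 2 <= b & forall l, b <= l ->
    [/\ ((3 * expR l) ^+ d) ^+ 2 * fail_bound ct dl l <= expR (- l),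
        expR (- (l * (th - 1))) <= 2^-1, 2 * expR (- l) <= delta & 1 <= dl * l].
Proof.
move=> ct0 dl0 th1 delta0.
have [ls ls2 hls] := fail_decay d ct0 dl0.
have [b1 b10 Hb1] := expR_decay ltr01 (ler0n R 2) delta0.
have thm0 : 0 < th - 1 by rewrite subr_gt0.
have v1 : 0 < (th - 1)^-1 by rewrite invr_gt0.
have v2 : 0 < dl^-1 by rewrite invr_gt0.
exists (ls + (th - 1)^-1 + dl^-1 + b1) => [|l hl]; first by lra.
split.
- by apply: hls; lra.
- have h1 : 1 <= l * (th - 1) by rewrite -ler_pdivrMr// mul1r; lra.
  by rewrite expRN lef_pV2 ?posrE ?expR_gt0//; apply: le_trans (expR_ge1Dx _); lra.
- by rewrite -[l]mul1r; apply: Hb1; lra.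
- by rewrite mulrC -ler_pdivrMr// mul1r; lra.
Qed.

Lemma start_level (eta' b T : R) : 0 < eta' -> 1 <= b -> b <= T -> exists K (lam0 : R),
  [/\ b <= lam0, lam0 <= b * expR eta', lam0 * expR eta' ^+ K = expR T & K%:R * eta' <= T].
Proof.
move=> e'0 b1 bT; have b0 : 0 < b by lra.
have lb : ln b <= b by exact/ltW/ln_sublinear.
have lb0 : 0 <= ln b by exact: ln_ge0.
have Tb : 0 <= T - ln b by lra.
have /andP[K1 K2] := truncn_itv (divr_ge0 Tb (ltW e'0)).
set K := Num.truncn _ in K1 K2.
rewrite ler_pdivlMr// in K1; rewrite ltr_pdivrMr// -natr1 mulrDl mul1r in K2.
have bE : b = expR (ln b) by rewrite lnK.
exists K, (expR (T - K%:R * eta')); split.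
- by rewrite [leLHS]bE ler_expR; lra.
- by rewrite [X in _ <= X * _]bE -expRD ler_expR; lra.
- by rewrite -expRM_natl -expRD subrK.
- by lra.
Qed.

Lemma length_median : exists2 c : R, 0 <= c & ((2^-1)%:E <= P (L @^-1` `]-oo, c]))%E.
Proof.
have half1 : 2^-1 < 1 :> R by lra.
have [y hy] := quantile_set_nonempty L half1.
exists (Num.max 0 y); first by rewrite le_max lexx.
by apply: (le_trans hy); apply: (@cdf_nondecreasing _ _ _ _ L); rewrite le_max lexx orbT.
Qed.

Lemma chain_cost_le (dl lam0 eta' : R) K : 1 <= dl * lam0 ->
  \sum_(k <- iota 0 K) step_cost L dl (lam0 * expR eta' ^+ k.+1) <=
  \sum_(1 <= k < K.+1) dexp_quantile L (k%:R * eta').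
Proof.
move=> h; rewrite big_add1 /= /index_iota subn0; apply: ler_sum => k _.
apply: quantile_le => //; [exact: expR_gt0| |exact: dexp_lt1].
by rewrite ler_expR lerN2 -expRM_natl mulrA ler_peMl ?expR_ge0.
Qed.

Lemma five_fifths (y : R) : y / 5 + (y / 5 + (y / 5 + (y / 5 + y / 5))) = y.
Proof. by field. Qed.

Lemma measure_union_le (A B : set O) (a b : R) : measurable A -> measurable B ->
  (P A <= a%:E)%E -> (P B <= b%:E)%E -> (P (A `|` B) <= (a + b)%:E)%E.
Proof.
by move=> mA mB h1 h2; rewrite EFinD; apply: le_trans (leeD h1 h2); exact: measureU2.
Qed.

Lemma box_subset (z v : V) (l l' : R) : l <= l' -> v \in box z (radius l) -> v \in box z (radius l').
Proof.
move=> ll; rewrite !mem_box => /forallP h; apply/forallP => i; apply: (le_trans (h i)).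
by rewrite lez_nat; exact: radius_nondec.
Qed.

Lemma graph_dist_upper (eps delta : R) : 0 < eps -> 0 < delta ->
  exists2 T0, 0 < T0 & forall m, T0 <= ln (ln m) -> exists B : set O,
    [/\ measurable B, (P B <= delta%:E)%E & forall w, ~ B w ->
      (graph_dist adj Le 0%R (floor_vec (m *: e)) w <=
       ((1 + eps) * norming L gamma m)%:E)%E].
Proof.
move=> eps0 delta0; have e0 := growth_rate_gt0 g1 g2.
pose eta' := eta / (1 + eps / 2).
have c1 : 1 < 1 + eps / 2 by rewrite ltrDl divr_gt0.
have c0 : 0 < 1 + eps / 2 by exact: lt_trans c1.
have e'0 : 0 < eta' by rewrite divr_gt0.
have ee' : eta' < eta by rewrite /eta' ltr_pdivrMr// ltr_pMr.
have ee2 : eta < (1 + eps) * eta'.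
  by rewrite /eta' mulrA ltr_pdivlMr// mulrC ltr_pM2r//; lra.
clearbody eta'.
pose th := expR eta'.
have th1 : 1 < th by rewrite expR_gt1.
have th0 : 0 < th by exact: expR_gt0.
have thg : th < (gamma - 1)^-1.
  rewrite -[ltRHS]lnK ?posrE ?invr_gt0 ?subr_gt0// ltr_expR.
  by rewrite lnV ?posrE ?subr_gt0.
have [nu [a2 [dl [nu0 hnu at2 dl0 hdl]]]] := upper_exponents th0 thg.
have nu_ge0 := ltW nu0.
have alpha0 : 0 < alpha by apply: lt_trans halpha; rewrite ltr0n.
have a20 : 0 <= a2 by apply/ltW; apply: lt_trans at2; rewrite subr_gt0.
have [ct ct0 hct] := tail_lower hell hWtail a20 at2.
have d5 : 0 < delta / 5 by rewrite divr_gt0.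
have [l1 l10 hl1] := connection_scale th1 nu_ge0 hnu.
have [l2 l22 hl2] := start_scale ct0 dl0 th1 d5.
pose b := l1 + l2.
have b_l1 : l1 <= b by rewrite lerDl; exact: le_trans l22.
have b_l2 : l2 <= b by rewrite lerDr.
have b2 : 2 <= b by exact: le_trans b_l2.
have b1 : 1 <= b by apply: le_trans b2; rewrite ler1n.
have [c2 c20 hc2] := length_median.
have [A A0 hA] := box_reach_prob hSFP (radius (b * th)) d5.
have [T1 T10 HT1] := truncated_sum_le hL0 hL g1 g2 (2 * A + 2 * c2) e'0 ee2.
exists (T1 + b) => [|m mT]; first by rewrite ltr_wpDl//; exact: lt_le_trans b1.
have T00 : 0 < T1 + b by rewrite ltr_wpDl//; exact: lt_le_trans b1.
have [lm1 m0 mE lmE] := lnln_large T00 mT.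
have T1T : T1 <= ln (ln m) by apply: le_trans mT; rewrite lerDl; exact: le_trans b1.
have bT : b <= ln (ln m) by apply: le_trans mT; rewrite lerDr.
have {}HT1 := HT1 m T1T.
have [K [lam0 [lam_ge lam_le lamK KT]]] := start_level e'0 b1 bT.
rewrite -lmE -/th in lamK; rewrite -/th in lam_le.
have lam2 : 2 <= lam0 by exact: le_trans lam_ge.
have scale l : lam0 <= l -> l1 <= l /\ l2 <= l.
  move=> h; have h' := le_trans lam_ge h.
  by split; [exact: le_trans b_l1 h'|exact: le_trans b_l2 h'].
have hdecay l : lam0 <= l -> ((3 * expR l) ^+ d) ^+ 2 * fail_bound ct dl l <= expR (- l).
  by move=> /scale[_ /hl2[]].
have hconn l : lam0 <= l ->
    alpha * (ln (4 * d%:R) + th * l) <= ln lambda + nu * (l + th * l).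
  by move=> /scale[/hl1[]].
have [_ hq hlam hdlam] := hl2 _ (scale _ (lexx _)).2.
pose x := floor_vec (m *: e).
have lamK_ge : lam0 <= ln m by rewrite -lamK; apply: lev_ge.
have lm2 : 2 <= ln m by exact: le_trans lamK_ge.
have x_le i : `|x 0 i|%:~R <= 2 * expR (ln m).
  rewrite -mE; apply: (le_trans (floor_vec_coord_le i (ltW m0) he)).
  by rewrite mulrDl mul1r lerD2l mE -expR0 ler_expR; exact: le_trans lm2.
have hbridge := (hl1 _ (scale _ lamK_ge).1).2.
have [B0 [mB0 PB0 hB0]] := hA 0.
have [Bx [mBx PBx hBx]] := hA x.
pose C (y : V) := chain_fail L Wv adj Le nu dl th lam0 y K.
have mC y : measurable (C y) by exact: (measurable_chain_fail hSFP).
have PC y : (P (C y) <= (delta / 5)%:E)%E.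
  apply: (le_trans (chain_fail_prob hSFP hL0 hd alpha0 hlambda ct0 dl0 hdl nu_ge0 hct th1 lam2
    hdecay hconn y K hq)).
  by rewrite lee_fin.
pose G := any_bridge_fail nu x (ln m) c2.
have mG : measurable G by exact: measurable_any_bridge_fail.
have PG : (P G <= (delta / 5)%:E)%E.
  apply: (le_trans (any_bridge_fail_prob ct0 dl0 hdl nu_ge0 hct lm2 x_le hc2 hbridge)).
  rewrite lee_fin; apply: (le_trans (hdecay _ lamK_ge)); apply: le_trans hlam.
  apply: (@le_trans _ _ (expR (- lam0))); first by rewrite ler_expR lerN2.
  by rewrite ler_peMl ?expR_ge0// ler1n.
exists (negative_length `|` (B0 `|` (Bx `|` (C 0 `|` (C x `|` G))))).
have mN := measurable_negative_length.
have m5 : measurable (C x `|` G) by exact: measurableU.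
have m4 : measurable (C 0 `|` (C x `|` G)) by exact: measurableU.
have m3 : measurable (Bx `|` (C 0 `|` (C x `|` G))) by exact: measurableU.
have m2 : measurable (B0 `|` (Bx `|` (C 0 `|` (C x `|` G)))) by exact: measurableU.
split; first exact: measurableU.
  have PN : (P negative_length <= 0%:E)%E by rewrite negative_length_null.
  have := measure_union_le mN m2 PN (measure_union_le mB0 m3 PB0 (measure_union_le mBx m4 PBx
    (measure_union_le (mC 0) m5 (PC 0) (measure_union_le (mC x) mG (PC x) PG)))).
  move=> /le_trans; apply; rewrite lee_fin add0r.
  by rewrite five_fifths.
move=> w /not_orP[wN /not_orP[wB0 /not_orP[wBx /not_orP[wC0 /not_orP[wCx wG]]]]].
have L_ge0 (y z : V) : y != z -> 0 <= Le y z w.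
  move=> ab; rewrite leNgt; apply/negP => h; apply: wN; exists (y, z) => //=.
  by rewrite ab /= in_itv.
have [v0 [v [v0b vb vt vr]]] := chain_reach wC0.
have [z0 [z [z0b zb zt zr]]] := chain_reach wCx.
rewrite lamK in vb vt zb zt.
have R1 := hB0 w wB0 v0 (box_subset lam_le v0b).
have R2 := hBx w wBx z0 (box_subset lam_le z0b).
have R3 := bridge_reach c20 wG vb zb vt zt.
have Rall := reach_trans (reach_trans (reach_trans R1 vr) R3)
  (reach_sym hSFP (reach_trans R2 zr)).
apply: (le_trans (graph_dist_le_reach L_ge0 Rall)); rewrite lee_fin.
apply: le_trans (HT1 K KT).
have := chain_cost_le eta' K hdlam; rewrite -/th.
set S := \sum_(k <- iota 0 K) _; set S' := \sum_(1 <= k < K.+1) _ => hS.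
have -> : A + S + 2 * c2 + (A + S) = 2 * S + (2 * A + 2 * c2) by ring.
by rewrite lerD2r ler_wpM2l.
Qed.

End UpperTheorem.

Section MeasurableGraphDist.
Context (dO : measure_display) (O : measurableType dO) (R : realType).
Context (P : probability O R) (d : nat).
Context (adj : O -> rel 'rV[int]_d) (Le : 'rV[int]_d -> 'rV[int]_d -> {RV P >-> R}).
Context (madj : forall x y, measurable (edge_event adj x y)).
Notation V := 'rV[int]_d.

Lemma measurable_path_length (x : V) p :
  measurable_fun setT (fun w => path_length Le w x p).
Proof.
elim: p x => [|y p IH] x.
  by rewrite [X in measurable_fun _ X](_ : _ = cst 0)//; apply/funext => w;
    rewrite /path_length big_nil.
rewrite [X in measurable_fun _ X](_ : _ = Le x y \+ (fun w => path_length Le w y p)).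
  exact: measurable_funD.
by apply/funext => w; rewrite path_length_cons.
Qed.

Lemma measurable_is_path (x : V) p : measurable [set w | path (adj w) x p].
Proof.
elim: p x => [|y p IH] x.
  by rewrite [X in measurable X](_ : _ = setT)//; apply/seteqP.
rewrite [X in measurable X](_ : _ = edge_event adj x y `&` [set w | path (adj w) y p]).
  exact: measurableI.
by apply/seteqP; split => w /=; [move=> /andP[]|move=> [-> ->]].
Qed.

Lemma measurable_graph_dist (x y : V) : measurable_fun setT (graph_dist adj Le x y).
Proof.
apply: (measurability _ (ErealGenInftyO.measurableE R)) => _ [_ [r ->] <-].
rewrite setTI.
have -> : graph_dist adj Le x y @^-1` `]-oo, r%:E[ =
    \bigcup_(p : seq V) (if uniq (x :: p) && (last x p == y) then
      [set w | path (adj w) x p] `&` [set w | path_length Le w x p < r] else set0).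
  apply/seteqP; split => w /=; rewrite in_itv/=.
    move=> /ereal_inf_lt[_ [p [pp up lp] <-]]; rewrite lte_fin => pr.
    by exists p => //; rewrite -/(uniq (x :: p)) up lp eqxx.
  move=> [p _]; case: ifP => [/andP[up /eqP lp] [pp pr]|//].
  apply: (@le_lt_trans _ _ (path_length Le w x p)%:E); last by rewrite lte_fin.
  by apply: ereal_inf_lbound; exists p.
apply: countable_bigcupT_measurable => // p; case: ifP => // _.
apply: measurableI; first exact: measurable_is_path.
rewrite [X in measurable X](_ : _ = (fun w => path_length Le w x p) @^-1` `]-oo, r[).
  rewrite -[X in measurable X]setTI.
  by apply: measurable_path_length.
by apply/seteqP; split => w /=; rewrite in_itv.
Qed.

End MeasurableGraphDist.

Lemma ratio_close {R : realType} (N eps : R) (D : \bar R) : 0 < N ->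
  (((1 - eps) * N)%:E <= D)%E -> (D <= ((1 + eps) * N)%:E)%E ->
  (`|D / N%:E - 1| <= eps%:E)%E.
Proof.
move=> N0; case: D => [r| |]; rewrite ?leye_eq ?leeNy_eq//.
rewrite !lee_fin => h1 h2; rewrite inver gt_eqF// -EFinM -EFinB abse_EFin lee_fin.
rewrite ler_norml; apply/andP; split.
  have : 1 - eps <= r / N by rewrite ler_pdivlMr.
  lra.
have : r / N <= 1 + eps by rewrite ler_pdivrMr.
lra.
Qed.

Theorem theorem1p3 (R : realType) (dO : measure_display)
    (O : measurableType dO) (P : probability O R) (d : nat)
    (alpha lambda tau gamma : R) (ell : R -> R) (W L : {RV P >-> R})
    (Wv : 'rV[int]_d -> {RV P >-> R}) (adj : O -> rel 'rV[int]_d)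
    (Le : 'rV[int]_d -> 'rV[int]_d -> {RV P >-> R}) (e : 'rV[R]_d)
    (hd : (1 <= d)%N) (halpha : d%:R < alpha) (hlambda : 0 < lambda)
    (hW1 : P [set w | 1 <= W w] = 1%E)
    (htau : 1 < tau) (hell : slowly_varying ell)
    (hWtail : forall t : R, 0 < t ->
      P [set w | t < W w] = (ell t / t `^ (tau - 1))%:E)
    (hgamma : gamma = alpha * (tau - 1) / d%:R)
    (hgamma12 : 1 < gamma < 2)
    (hL0 : P [set w | 0 <= L w] = 1%E)
    (hL : explosion_integral L = +oo%E)
    (hSFP : weighted_sfp alpha lambda W L Wv adj Le)
    (he : enorm e = 1) :
  cvg_in_probability P
    (fun m w =>
      (graph_dist adj Le 0%R (floor_vec (m *: e)) w / (norming L gamma m)%:E)%E)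
    1.
Proof.
move: hgamma12 => /andP[g1 g2].
have [Tn _ HN] := norming_gt0 hL0 hL g1 g2.
have madj := sfp_adj_measurable hSFP.
move=> eps eps0.
have mbad m : measurable [set w | (eps%:E < `|graph_dist adj Le 0%R (floor_vec (m *: e)) w /
    (norming L gamma m)%:E - 1%:E|)%E].
  rewrite -[X in measurable X]setTI; apply: emeasurable_fun_o_infty => //.
  apply: measurableT_comp => //; apply: emeasurable_funB; last exact: measurable_cst.
  by apply: emeasurable_funM; [exact: measurable_graph_dist|exact: measurable_cst].
apply/fine_cvgP; split.
  by apply: nearW => m; rewrite fin_num_measure.
apply/cvgrPdist_le => delta delta0.
have d2 : 0 < delta / 2 by rewrite divr_gt0.
have [Tl Tl0 Hl] := graph_dist_lower hd halpha hlambda hW1 hell hWtail hgamma g1 g2 hL0 hL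
  hSFP he eps0 d2.
have [Tu Tu0 Hu] := graph_dist_upper hd halpha hlambda htau hell hWtail hgamma g1 g2 hL0 hL
  hSFP he eps0 d2.
pose T := Num.max Tn (Num.max Tl Tu).
exists (expR (expR T)); split => // m hm.
have : T <= ln (ln m).
  have l1 : expR T <= ln m.
    by rewrite -[leLHS]expRK ler_ln ?posrE ?expR_gt0 ?(lt_trans _ hm) ?expR_gt0// ltW.
  have l0 := lt_le_trans (expR_gt0 T) l1.
  by rewrite -[leLHS]expRK ler_ln ?posrE ?expR_gt0.
rewrite /T !ge_max => /and3P[hn hl hu].
have N0 := HN m hn.
have [B1 [mB1 PB1 hB1]] := Hl m hl; have [B2 [mB2 PB2 hB2]] := Hu m hu.
rewrite sub0r normrN /= ger0_norm ?fine_ge0//.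
rewrite -lee_fin fineK ?fin_num_measure//.
apply: (@le_trans _ _ (P (B1 `|` B2))).
  apply: le_measure; rewrite ?inE//; first exact: measurableU.
  move=> w /= hw; apply: contrapT => /not_orP[w1 w2].
  by move: hw; rewrite ltNge (ratio_close N0 (hB1 w w1) (hB2 w w2)).
have U : (P (B1 `|` B2) <= P B1 + P B2)%E by exact: measureU2.
apply: (le_trans U); apply: (le_trans (leeD PB1 PB2)).
by rewrite -EFinD lee_fin; lra.
Qed.
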